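(* Let $k$ be an algebraically closed field and let $R$ be a finite dimensional ideally ordered monomial $k$-algebra. Then $E_R^{\mathrm{PI}}=\operatorname{End}_R(\mathrm{PI}(R))$ is both left and right strongly quasi-hereditary with respect to the ordering induced by the ideal layer function.
   Context: Modules are finitely generated left modules; products in endomorphism algebras are compositions; in a path algebra $kQ$ the product $pq$ is the path $q$ followed by the path $p$. A finite dimensional monomial algebra is a finite dimensional algebra $R=kQ/I$ with $Q$ a finite quiver and $I$ a two-sided ideal generated by paths; a monomial of $R$ is the class of a path (including lazy paths). $R$ is ideally ordered if for every primitive idempotent $e\in R$ and every pair of monomials $m,n\in eR$ there is an epimorphism of left $R$-modules $Rm\to Rn$ or an epimorphism $Rn\to Rm$. A principal left ideal is $Rp\subseteq R$ with $p\in eR$ for a primitive idempotent $e$; $\mathrm{PI}(R)$ is the direct sum of all nonzero principal left ideals up to isomorphism (finitely many for ideally ordered $R$; they are indecomposable), $E_R^{\mathrm{PI}}:=\operatorname{End}_R(\mathrm{PI}(R))$. The indecomposable projective $E_R^{\mathrm{PI}}$-modules are $P(\Lambda)=\operatorname{Hom}_R(\Lambda,\mathrm{PI}(R))$ with $\Lambda$ a principal left ideal, and $S(\Lambda)$ is the simple top of $P(\Lambda)$. The ideal layer function is $l(S(\Lambda))=l(\Lambda):=\dim_kR-\dim_k\Lambda$, inducing the order $S(\Lambda_1)<S(\Lambda_2)$ iff $l(\Lambda_1)<l(\Lambda_2)$. Let $A$ be a finite dimensional $k$-algebra with simples $S_i$, projective covers $P_i$, injective envelopes $Q_i$, and an adapted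 partial order on the index set (adapted: for each module $M$ with top $S_i$ and socle $S_j$, $i,j$ incomparable, some $S_h$ with $h>i$ or $h>j$ is a composition factor of $M$). The standard module $\Delta_i$ is the largest quotient of $P_i$, and the costandard module $\nabla_i$ the largest submodule of $Q_i$, all of whose composition factors $S_j$ satisfy $j\le i$. $A$ is quasi-hereditary if $\operatorname{End}_A(\Delta_i)\cong k$ for all $i$ and $A$ has a finite filtration with subquotients direct sums of standard modules; it is left strongly quasi-hereditary if moreover all standard modules have projective dimension $\le1$, right strongly quasi-hereditary if moreover all costandard modules have injective dimension $\le1$. *)

(* Defs.v *)
From HB Require Import structures.
From mathcomp Require Import all_boot all_algebra falgebra finmap.
From mathcomp.multinomials Require Import monalg.
From mathcomp Require Import boolp.

Set Implicit Arguments.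
Unset Strict Implicit.
Unset Printing Implicit Defensive.

Import GRing.Theory.
Local Open Scope ring_scope.
Local Open Scope quotient_scope.

Section Submodule.
Context (A : pzRingType) (M : lmodType A) (U : submodClosed M).

Definition subm := {x : M | x \in U}.
HB.instance Definition _ := SubChoice.on subm.
HB.instance Definition _ := [SubChoice_isSubLmodule of subm by <:].

End Submodule.

Section QuotientModule.
Context (A : pzRingType) (M : lmodType A) (U : submodClosed M).

Fact submod_opprC : oppr_closed U.
Proof. by move=> x Ux; rewrite -scaleN1r rpredZ. Qed.

Definition submod_pred : M -> bool := GRing.SubmodClosed.sort U.
HB.instance Definition _ := GRing.SubmodClosed.on submod_pred.
HB.instance Definition _ := GRing.isOppClosed.Build M submod_pred submod_opprC.
Definition submod_zmod := GRing.ZmodClosed.clone M submod_pred _.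

Definition quotm := Quotient.quot submod_zmod.
HB.instance Definition _ := GRing.Zmodule.on quotm.
HB.instance Definition _ : EqQuotient M (Quotient.equiv submod_zmod) quotm :=
  EqQuotient.on quotm.

Definition quotm_scale (a : A) (x : quotm) : quotm := \pi_quotm (a *: repr x).

Fact quotm_piE (x y : M) :
  (\pi_quotm x == \pi_quotm y) = (x - y \in U).
Proof. exact/esym/(Quotient.idealrBE submod_zmod). Qed.

Fact quotm_scale_pi a x : quotm_scale a (\pi_quotm x) = \pi_quotm (a *: x).
Proof.
apply/eqP; rewrite quotm_piE -scalerBr rpredZ //.
by rewrite -quotm_piE reprK.
Qed.

Fact quotm_piD (x y : M) : \pi_quotm x + \pi_quotm y = \pi_quotm (x + y).
Proof. by rewrite !piE. Qed.

Fact quotm_surj (x : quotm) : exists y, x = \pi_quotm y.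
Proof. by exists (repr x); rewrite reprK. Qed.

Fact quotm_scaleA a b x :
  quotm_scale a (quotm_scale b x) = quotm_scale (a * b) x.
Proof. by have [y ->] := quotm_surj x; rewrite !quotm_scale_pi scalerA. Qed.
Fact quotm_scale1 : left_id 1 quotm_scale.
Proof.
by move=> x; have [y ->] := quotm_surj x; rewrite quotm_scale_pi scale1r.
Qed.
Fact quotm_scaleDr : right_distributive quotm_scale +%R.
Proof.
move=> a x y; have [x' ->] := quotm_surj x; have [y' ->] := quotm_surj y.
by rewrite quotm_piD !quotm_scale_pi quotm_piD scalerDr.
Qed.
Fact quotm_scaleDl x : {morph quotm_scale^~ x : a b / a + b}.
Proof.
move=> a b; have [y ->] := quotm_surj x.
by rewrite !quotm_scale_pi quotm_piD scalerDl.
Qed.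
HB.instance Definition _ := GRing.Zmodule_isLmodule.Build A quotm
  quotm_scaleA quotm_scale1 quotm_scaleDr quotm_scaleDl.

End QuotientModule.

Section DirectSum.
Context (A : pzRingType) (J : finType) (D : J -> lmodType A).

Definition dsum := {dffun forall j, D j}.
HB.instance Definition _ := Choice.on dsum.
Implicit Types f g : dsum.

Definition dsum0 : dsum := [ffun j => 0 : D j].
Definition dsum_opp f : dsum := [ffun j => - f j].
Definition dsum_add f g : dsum := [ffun j => f j + g j].
Definition dsum_scale (a : A) f : dsum := [ffun j => a *: f j].

Fact dsum_addA : associative dsum_add.
Proof. by move=> f g h; apply/ffunP=> j; rewrite !ffunE addrA. Qed.
Fact dsum_addC : commutative dsum_add.
Proof. by move=> f g; apply/ffunP=> j; rewrite !ffunE addrC. Qed.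
Fact dsum_add0 : left_id dsum0 dsum_add.
Proof. by move=> f; apply/ffunP=> j; rewrite !ffunE add0r. Qed.
Fact dsum_addN : left_inverse dsum0 dsum_opp dsum_add.
Proof. by move=> f; apply/ffunP=> j; rewrite !ffunE addNr. Qed.
HB.instance Definition _ := GRing.isZmodule.Build dsum
  dsum_addA dsum_addC dsum_add0 dsum_addN.

Fact dsum_scaleA a b f : dsum_scale a (dsum_scale b f) = dsum_scale (a * b) f.
Proof. by apply/ffunP=> j; rewrite !ffunE scalerA. Qed.
Fact dsum_scale1 : left_id 1 dsum_scale.
Proof. by move=> f; apply/ffunP=> j; rewrite !ffunE scale1r. Qed.
Fact dsum_scaleDr : right_distributive dsum_scale +%R.
Proof. by move=> a f g; apply/ffunP=> j; rewrite !ffunE scalerDr. Qed.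
Fact dsum_scaleDl f : {morph dsum_scale^~ f : a b / a + b}.
Proof. by move=> a b; apply/ffunP=> j; rewrite !ffunE scalerDl. Qed.
HB.instance Definition _ := GRing.Zmodule_isLmodule.Build A dsum
  dsum_scaleA dsum_scale1 dsum_scaleDr dsum_scaleDl.

End DirectSum.

Section Hom.
Context (A : pzRingType) (M N : lmodType A).

Definition lhom := {linear M -> N}.
HB.instance Definition _ := gen_eqMixin lhom.
HB.instance Definition _ := gen_choiceMixin lhom.

Fact homP (f g : lhom) : f =1 g -> f = g.
Proof.
case: f g => [f [[f1] [f2]]] [g [[g1] [g2]]] /= /funext eq_fg.
case: _ / eq_fg g1 g2 => g1 g2.
by rewrite (Prop_irrelevance f1 g1) (Prop_irrelevance f2 g2).
Qed.

Definition hom0 : lhom := (\0 : M -> N).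
Definition hom_opp (f : lhom) : lhom := (\- f).
Definition hom_add (f g : lhom) : lhom := f \+ g.

Fact hom_addA : associative hom_add.
Proof. by move=> f g h; apply/homP=> x /=; rewrite addrA. Qed.
Fact hom_addC : commutative hom_add.
Proof. by move=> f g; apply/homP=> x /=; rewrite addrC. Qed.
Fact hom_add0 : left_id hom0 hom_add.
Proof. by move=> f; apply/homP=> x /=; rewrite add0r. Qed.
Fact hom_addN : left_inverse hom0 hom_opp hom_add.
Proof. by move=> f; apply/homP=> x /=; rewrite addNr. Qed.
HB.instance Definition _ := GRing.isZmodule.Build lhom
  hom_addA hom_addC hom_add0 hom_addN.

End Hom.

Section Endo.
Context (k : fieldType) (A : algType k) (M : lmodType A).

Definition endo := lhom M M.
HB.instance Definition _ := GRing.Zmodule.on endo.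
Implicit Types f g h : endo.

Definition endo1 : endo := (idfun : M -> M).
Definition endo_mul f g : endo := f \o g.

Fact endo_mulA : associative endo_mul.
Proof. by move=> f g h; apply/homP. Qed.
Fact endo_mul1 : left_id endo1 endo_mul.
Proof. by move=> f; apply/homP. Qed.
Fact endo_mulr1 : right_id endo1 endo_mul.
Proof. by move=> f; apply/homP. Qed.
Fact endo_mulDl : left_distributive endo_mul +%R.
Proof. by move=> f g h; apply/homP. Qed.
Fact endo_mulDr : right_distributive endo_mul +%R.
Proof. by move=> f g h; apply/homP=> x /=; rewrite raddfD. Qed.
HB.instance Definition _ := GRing.Zmodule_isPzRing.Build endo
  endo_mulA endo_mul1 endo_mulr1 endo_mulDl endo_mulDr.

Section Scale.
Context (c : k) (f : endo).
Definition endo_scale_fun (x : M) : M := c%:A *: f x.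
Fact endo_scale_linear : linear endo_scale_fun.
Proof.
move=> a x y; rewrite /endo_scale_fun linearP scalerDr !scalerA.
by rewrite mulr_algl mulr_algr.
Qed.
HB.instance Definition _ :=
  GRing.isLinear.Build A M M *:%R endo_scale_fun endo_scale_linear.
Definition endo_scale : endo := endo_scale_fun.
End Scale.

Fact endo_scaleA a b f : endo_scale a (endo_scale b f) = endo_scale (a * b) f.
Proof.
by apply/homP=> x /=; rewrite /endo_scale_fun /= scalerA mulr_algl scalerA.
Qed.
Fact endo_scale1 : left_id 1 endo_scale.
Proof. by move=> f; apply/homP=> x; rewrite /= /endo_scale_fun !scale1r. Qed.
Fact endo_scaleDr : right_distributive endo_scale +%R.
Proof. by move=> a f g; apply/homP=> x; rewrite /= /endo_scale_fun scalerDr. Qed.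
Fact endo_scaleDl f : {morph endo_scale^~ f : a b / a + b}.
Proof.
by move=> a b; apply/homP=> x; rewrite /= /endo_scale_fun !scalerDl.
Qed.
HB.instance Definition _ := GRing.Zmodule_isLmodule.Build k endo
  endo_scaleA endo_scale1 endo_scaleDr endo_scaleDl.

Fact endo_scaleAl c f g : c *: (f * g) = (c *: f) * g.
Proof. exact/homP. Qed.
Fact endo_scaleAr c f g : c *: (f * g) = f * (c *: g).
Proof. by apply/homP=> x /=; rewrite /endo_scale_fun /= linearZ. Qed.

End Endo.

Section HomModule.
Context (k : fieldType) (A : algType k) (M N : lmodType A).
Implicit Types (f : endo N) (g : lhom M N).

Definition ehom := lhom M N.
HB.instance Definition _ := GRing.Zmodule.on ehom.

Definition ehom_scale (f : endo N) (g : ehom) : ehom := f \o g.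

Fact ehom_scaleA f1 f2 g : ehom_scale f1 (ehom_scale f2 g) = ehom_scale (f1 * f2) g.
Proof. exact/homP. Qed.
Fact ehom_scale1 : left_id 1 ehom_scale.
Proof. by move=> g; apply/homP. Qed.
Fact ehom_scaleDr : right_distributive ehom_scale +%R.
Proof. by move=> f g1 g2; apply/homP=> x /=; rewrite raddfD. Qed.
Fact ehom_scaleDl g : {morph ehom_scale^~ g : f1 f2 / f1 + f2}.
Proof. by move=> f1 f2; apply/homP. Qed.
HB.instance Definition _ := GRing.Zmodule_isLmodule.Build (endo N) ehom
  ehom_scaleA ehom_scale1 ehom_scaleDr ehom_scaleDl.
End HomModule.

Section ModuleTheory.
Context (A : pzRingType).
Implicit Types (M N S P Q : lmodType A).

Definition surj_map (X Y : Type) (f : X -> Y) := forall y, exists x, f x = y.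

Definition isomorphic M N := exists f : {linear M -> N}, bijective f.

Definition fin_gen M := exists n (x : 'I_n -> M),
  forall y, exists a : 'I_n -> A, y = \sum_(i < n) a i *: x i.

Definition is_zero M (U : submodClosed M) := forall x, x \in U -> x = 0.
Definition is_full M (U : submodClosed M) := forall x, x \in U.

Definition simple_module M :=
  (exists x : M, x != 0) /\ forall U : submodClosed M, is_zero U \/ is_full U.

Definition maximal M (U : submodClosed M) :=
  ~ is_full U /\ forall V : submodClosed M,
    {subset U <= V} -> {subset V <= U} \/ is_full V.

Definition smeet_pred M (F : submodClosed M -> Prop) : M -> bool :=
  fun x => `[< forall U, F U -> x \in U >].
Fact smeet_closed M F : submod_closed (@smeet_pred M F).
Proof.
split=> [|a x y /asboolP Fx /asboolP Fy].
  by apply/asboolP=> U _; exact: rpred0.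
by apply/asboolP=> U FU; rewrite rpredD ?rpredZ ?Fx ?Fy.
Qed.
HB.instance Definition _ M F :=
  GRing.isSubmodClosed.Build A M (smeet_pred F) (@smeet_closed M F).

(* the intersection, resp. the sum, of all the submodules satisfying F *)
Definition smeet M (F : submodClosed M -> Prop) :=
  GRing.SubmodClosed.clone A M (smeet_pred F) _.
Definition sjoin M (F : submodClosed M -> Prop) :=
  smeet (fun V : submodClosed M => forall U, F U -> {subset U <= V}).

Definition radical M := smeet (@maximal M).
Definition socle M := sjoin (fun U : submodClosed M => simple_module (subm U)).
Definition module_top M := quotm (radical M).

Section Subquotient.
Context M (U V : submodClosed M).
Definition trace_pred : subm V -> bool := fun x => val x \in U.
Fact trace_pred_closed : submod_closed trace_pred.
Proof.
split=> [|a x y Ux Uy]; rewrite /trace_pred unfold_in /= ?rpred0 //.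
by rewrite rpredD ?rpredZ.
Qed.
HB.instance Definition _ :=
  GRing.isSubmodClosed.Build A (subm V) trace_pred trace_pred_closed.
Definition trace_submod := GRing.SubmodClosed.clone A (subm V) trace_pred _.
Definition subquot := quotm trace_submod.
End Subquotient.

Definition composition_series M n (U : nat -> submodClosed M) :=
  [/\ is_zero (U 0), is_full (U n) &
      forall j, (j < n)%N ->
        {subset U j <= U j.+1} /\ simple_module (subquot (U j) (U j.+1))].

Definition composition_factor M S := exists n (U : nat -> submodClosed M),
  composition_series n U /\
  exists2 j, (j < n)%N & isomorphic S (subquot (U j) (U j.+1)).

(* Modules being finitely generated, projectivity and injectivity are taken in
   the category of finitely generated modules. *)
Definition projective_module P := forall M N (g : {linear M -> N}) (f : {linear P -> N}),
  fin_gen M -> fin_gen N -> surj_map g -> exists h : {linear P -> M}, g \o h =1 f.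

Definition injective_module Q :=
  forall M N (g : {linear M -> N}) (f : {linear M -> Q}),
  fin_gen M -> fin_gen N -> injective g -> exists h : {linear N -> Q}, h \o g =1 f.

Definition projective_cover P S := [/\ fin_gen P, projective_module P &
  exists2 f : {linear P -> S}, surj_map f &
    forall U : submodClosed P,
      (forall x, exists2 u, u \in U & f (x - u) = 0) -> is_full U].

Definition injective_envelope Q S := [/\ fin_gen Q, injective_module Q &
  exists2 f : {linear S -> Q}, injective f &
    forall U : submodClosed Q, (forall x, f x \in U -> f x = 0) -> is_zero U].

Definition short_exact L M N (f : {linear L -> M}) (g : {linear M -> N}) :=
  [/\ injective f, surj_map g & forall y, g y = 0 <-> exists x, f x = y].

Definition projdim_le1 M :=
  exists (P1 P0 : lmodType A) (d : {linear P1 -> P0}) (e : {linear P0 -> M}),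
  [/\ fin_gen P1 /\ fin_gen P0, projective_module P1, projective_module P0 & short_exact d e].

Definition injdim_le1 M :=
  exists (Q0 Q1 : lmodType A) (e : {linear M -> Q0}) (d : {linear Q0 -> Q1}),
  [/\ fin_gen Q0 /\ fin_gen Q1, injective_module Q0, injective_module Q1 &
      short_exact e d].

End ModuleTheory.

Section QuasiHereditary.
Context (k : fieldType) (A : algType k) (I : finType) (le : rel I).
Context (S P : I -> lmodType A).
Implicit Types (i j h : I) (M Q : lmodType A).

Definition complete_simples :=
  [/\ forall i, simple_module (S i),
      forall i j, isomorphic (S i) (S j) -> i = j &
      forall M, simple_module M -> exists i, isomorphic M (S i)].

Definition partial_order := [/\ reflexive le, antisymmetric le & transitive le].

Definition slt i j := (i != j) && le i j.

Definition adapted := forall M i j, fin_gen M ->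
  isomorphic (module_top M) (S i) -> isomorphic (subm (socle M)) (S j) ->
  ~~ le i j -> ~~ le j i ->
  exists h, (slt i h || slt j h) /\ composition_factor M (S h).

Definition factors_le i M := forall j, composition_factor M (S j) -> le j i.

(* A quotient P i / U with composition factors bounded by i is largest when U
   is smallest; that smallest U is the intersection of all such U. *)
Definition standard i :=
  quotm (smeet (fun U : submodClosed (P i) => factors_le i (quotm U))).

(* Q stands for an injective envelope of S i; the largest submodule with
   composition factors bounded by i is the sum of all of them. *)
Definition costandard i Q :=
  subm (sjoin (fun U : submodClosed Q => factors_le i (subm U))).

Definition standard_filtration M := exists n (U : nat -> submodClosed M),
  [/\ is_zero (U 0), is_full (U n) &
      forall m, (m < n)%N -> {subset U m <= U m.+1} /\
        exists (J : finType) (c : J -> I),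
          isomorphic (subquot (U m) (U m.+1)) (dsum (fun a => standard (c a)))].

Definition endo_trivial M :=
  exists2 f : {linear k^o -> endo M}, monoid_morphism f & bijective f.

Definition quasi_hereditary :=
  [/\ @fin_gen k A,
      [/\ complete_simples, forall i, projective_cover (P i) (S i),
          partial_order & adapted],
      forall i, endo_trivial (standard i) &
      standard_filtration A^o].

Definition left_strongly_quasi_hereditary :=
  quasi_hereditary /\ forall i, projdim_le1 (standard i).

(* Injective envelopes exist and are unique up to isomorphism, so the choice of
   Q does not matter. *)
Definition right_strongly_quasi_hereditary :=
  quasi_hereditary /\ forall i, exists2 Q,
    injective_envelope Q (S i) & injdim_le1 (costandard i Q).

End QuasiHereditary.

Record quiver := Quiver {
  vertex : finType;
  arrow : finType;
  source : arrow -> vertex;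
  target : arrow -> vertex
}.

Section PathAlgebra.
Context (Q : quiver).

(* A path is its starting vertex followed by the arrows in the order in which
   they are traversed. *)
Fixpoint walk (v : vertex Q) (s : seq (arrow Q)) :=
  if s is a :: s' then (source a == v) && walk (target a) s' else true.

Definition qpath := {w : vertex Q * seq (arrow Q) | walk w.1 w.2}.
HB.instance Definition _ := SubChoice.on qpath.

Implicit Types p q : qpath.
Definition pstart p := (val p).1.
Definition parrows p := (val p).2.
Definition pend p := last (pstart p) (map (@target Q) (parrows p)).

Definition lazy (v : vertex Q) : qpath := Sub (v, [::]) isT.

Lemma walk_cat v s t :
  walk v (s ++ t) = walk v s && walk (last v (map (@target Q) s)) t.
Proof. by elim: s v => //= a s IHs v; rewrite IHs andbA. Qed.

(* the path q followed by p *)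
Definition path_comp p q : option qpath :=
  if pend q == pstart p then insub (pstart q, parrows q ++ parrows p) else None.

Context (k : fieldType).

Definition path_alg := {malg k[qpath]}.
HB.instance Definition _ := GRing.Lmodule.on path_alg.

Definition omono (c : k) (o : option qpath) : path_alg :=
  if o is Some p then << c *g p >> else 0.

Definition path_one : path_alg := \sum_(v : vertex Q) << lazy v >>.

Definition path_mul (f g : path_alg) : path_alg :=
  \sum_(p <- msupp f) \sum_(q <- msupp g) omono (f@_p * g@_q) (path_comp p q).

Fact path_comp_some p q : pend q = pstart p ->
  exists2 r, path_comp p q = Some r &
    [/\ pstart r = pstart q, parrows r = parrows q ++ parrows p & pend r = pend p].
Proof.
move=> qp; rewrite /path_comp qp eqxx.
have w : walk (pstart q) (parrows q ++ parrows p).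
  by rewrite walk_cat [walk _ _](valP q) -/(pend q) qp; exact: (valP p).
exists (exist _ (pstart q, parrows q ++ parrows p) w : qpath).
  by rewrite (insubT (fun w => walk w.1 w.2) (x := (_, _)) w).
by split=> //; rewrite {1}/pend /= map_cat last_cat -/(pend q) qp.
Qed.

Fact path_comp_none p q : pend q <> pstart p -> path_comp p q = None.
Proof. by rewrite /path_comp; case: eqP. Qed.

Fact path_comp_assoc p q r :
  obind (path_comp p) (path_comp q r) = obind (path_comp^~ r) (path_comp p q).
Proof.
have [rq|rq] := eqVneq (pend r) (pstart q); last first.
  rewrite [path_comp q r]path_comp_none; last exact/eqP.
  have [qp|qp] := eqVneq (pend q) (pstart p); last first.
    by rewrite path_comp_none //; apply/eqP.
  have [u -> [su _ _]] := path_comp_some qp.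
  by rewrite /= path_comp_none // su; apply/eqP.
have [u -> [su au eu]] := path_comp_some rq.
have [qp|qp] := eqVneq (pend q) (pstart p); last first.
  by rewrite /= !path_comp_none // ?eu; apply/eqP.
have [v -> [sv av ev]] := path_comp_some qp.
have [x /= -> [sx ax _]] := path_comp_some (etrans eu qp).
have [y /= -> [sy ay _]] := path_comp_some (etrans rq (esym sv)).
congr Some; apply/val_inj; rewrite [val x]surjective_pairing [RHS]surjective_pairing.
rewrite -![(val _).1]/(pstart _) -![(val _).2]/(parrows _) sx sy ax ay su au av.
by rewrite catA.
Qed.

Fact omono0 o : omono 0 o = 0.
Proof. by case: o => //= p; rewrite monalgU0. Qed.
Fact omonoD o : {morph omono^~ o : c d / c + d}.
Proof. by move=> c d; case: o => /= [p|]; rewrite ?monalgUD ?addr0. Qed.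

Fact path_mulw (d1 d2 : {fset qpath}) f g :
  (msupp f `<=` d1)%fset -> (msupp g `<=` d2)%fset ->
  path_mul f g =
    \sum_(p <- d1) \sum_(q <- d2) omono (f@_p * g@_q) (path_comp p q).
Proof.
move=> le_d1 le_d2; rewrite /path_mul (big_fset_incl _ le_d1) /=.
  apply/eq_bigr=> p _; apply/big_fset_incl => // q _ /mcoeff_outdom ->.
  by rewrite mulr0 omono0.
move=> p _ /mcoeff_outdom fp.
by rewrite big1 => // q _; rewrite fp mul0r omono0.
Qed.

Fact path_mulDl : left_distributive path_mul +%R.
Proof.
move=> f g h.
rewrite (path_mulw (msuppD_le f g) (fsubset_refl _)).
rewrite (path_mulw (fsubsetUl _ (msupp g)) (fsubset_refl (msupp h))).
rewrite (path_mulw (fsubsetUr (msupp f) _) (fsubset_refl (msupp h))).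
rewrite -big_split /=; apply/eq_bigr=> p _.
rewrite -big_split /=; apply/eq_bigr=> q _.
by rewrite mcoeffD mulrDl omonoD.
Qed.

Fact path_mulDr : right_distributive path_mul +%R.
Proof.
move=> h f g.
rewrite (path_mulw (fsubset_refl _) (msuppD_le f g)).
rewrite (path_mulw (fsubset_refl (msupp h)) (fsubsetUl _ (msupp g))).
rewrite (path_mulw (fsubset_refl (msupp h)) (fsubsetUr (msupp f) _)).
rewrite -big_split /=; apply/eq_bigr=> p _.
rewrite -big_split /=; apply/eq_bigr=> q _.
by rewrite mcoeffD mulrDr omonoD.
Qed.

Fact path_algE (f : path_alg) : f = \sum_(p <- msupp f) << f@_p *g p >>.
Proof. exact: monalgE. Qed.

Fact path_mul0l : left_zero 0 path_mul.
Proof. by move=> g; rewrite /path_mul msupp0 big_seq_fset0. Qed.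
Fact path_mul0r : right_zero 0 path_mul.
Proof.
by move=> g; rewrite /path_mul big1 // => p _; rewrite msupp0 big_seq_fset0.
Qed.

Fact path_mul_suml I (s : seq I) (C : pred I) (F : I -> path_alg) g :
  path_mul (\sum_(i <- s | C i) F i) g = \sum_(i <- s | C i) path_mul (F i) g.
Proof.
exact: (big_morph (path_mul^~ g) (fun a b => path_mulDl a b g) (path_mul0l g)).
Qed.
Fact path_mul_sumr I (s : seq I) (C : pred I) (F : I -> path_alg) g :
  path_mul g (\sum_(i <- s | C i) F i) = \sum_(i <- s | C i) path_mul g (F i).
Proof. exact: (big_morph (path_mul g) (path_mulDr g) (path_mul0r g)). Qed.

Fact path_mulUU c d p q :
  path_mul << c *g p >> << d *g q >> = omono (c * d) (path_comp p q).
Proof. by rewrite (path_mulw msuppU_le msuppU_le) !big_seq_fset1 !mcoeffUU. Qed.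

Fact path_mulEl f g : path_mul f g = \sum_(p <- msupp f) path_mul << f@_p *g p >> g.
Proof. by rewrite [in LHS](path_algE f) path_mul_suml. Qed.
Fact path_mulEr f g : path_mul f g = \sum_(q <- msupp g) path_mul f << g@_q *g q >>.
Proof. by rewrite [in LHS](path_algE g) path_mul_sumr. Qed.

Fact path_mulA : associative path_mul.
Proof.
move=> f g h; rewrite (path_mulEl f (path_mul g h)) (path_mulEl f g).
rewrite path_mul_suml; apply: eq_bigr => p _.
rewrite (path_mulEl g h) (path_mulEr _ g) path_mul_suml path_mul_sumr.
apply: eq_bigr => q _.
rewrite [RHS]path_mulEr (path_mulEr _ h) path_mul_sumr; apply: eq_bigr => r _.
rewrite !path_mulUU.
have ml c o x (y : qpath) : path_mul (omono c o) << x *g y >> =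
    omono (c * x) (obind (path_comp^~ y) o).
  by case: o => [z|] /=; rewrite ?path_mul0l ?path_mulUU.
have mr c o x (y : qpath) : path_mul << x *g y >> (omono c o) =
    omono (x * c) (obind (path_comp y) o).
  by case: o => [z|] /=; rewrite ?path_mul0r ?path_mulUU.
by rewrite ml mr path_comp_assoc mulrA.
Qed.

Fact path_comp_lazyl v p : path_comp (lazy v) p = if pend p == v then Some p else None.
Proof.
by rewrite /path_comp /=; case: ifP => // _; rewrite cats0 -surjective_pairing valK.
Qed.
Fact path_comp_lazyr v p : path_comp p (lazy v) = if v == pstart p then Some p else None.
Proof.
rewrite /path_comp /pend /=; case: eqP => // ->.
by rewrite /pstart /parrows -surjective_pairing valK.
Qed.

Fact path_mul1l : left_id path_one path_mul.
Proof.
move=> f; rewrite path_mulEr [RHS]path_algE; apply: eq_bigr => p _.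
rewrite path_mul_suml (bigD1 (pend p)) //= path_mulUU path_comp_lazyl eqxx mul1r.
rewrite big1 ?addr0 // => v /negPf v_p.
by rewrite path_mulUU path_comp_lazyl eq_sym v_p.
Qed.
Fact path_mul1r : right_id path_one path_mul.
Proof.
move=> f; rewrite path_mulEl [RHS]path_algE; apply: eq_bigr => p _.
rewrite path_mul_sumr (bigD1 (pstart p)) //= path_mulUU path_comp_lazyr eqxx mulr1.
rewrite big1 ?addr0 // => v /negPf v_p.
by rewrite path_mulUU path_comp_lazyr v_p.
Qed.
HB.instance Definition _ := GRing.Zmodule_isPzRing.Build path_alg
  path_mulA path_mul1l path_mul1r path_mulDl path_mulDr.

End PathAlgebra.

Definition two_sided_span (B : pzRingType) (T : Type) (F : T -> B) (C : T -> Prop)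
    (x : B) :=
  exists n (a b : 'I_n -> B) (t : 'I_n -> T),
    (forall i, C (t i)) /\ x = \sum_(i < n) a i * F (t i) * b i.

Record monomial_presentation (k : fieldType) (R : falgType k) := {
  quiv : quiver;
  relation : qpath quiv -> Prop;
  proj : {linear path_alg quiv k -> R};
  proj_morph : monoid_morphism proj;
  proj_surj : surj_map proj;
  proj_ker : forall x : path_alg quiv k, proj x = 0 <->
    two_sided_span (fun p : qpath quiv => << p >> : path_alg quiv k) relation x
}.

Section Ideals.
Context (k : fieldType) (R : falgType k).
Implicit Types (e p m n : R).

Definition is_idempotent e := e * e = e.

Definition primitive_idempotent e :=
  [/\ e != 0, is_idempotent e &
    forall f g, is_idempotent f -> is_idempotent g -> f * g = 0 -> g * f = 0 ->
      e = f + g -> f = 0 \/ g = 0].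

Definition right_ideal e : {vspace R} := limg (amull e).
Definition left_ideal p : {vspace R} := limg (amulr p).

Definition left_ideal_pred p : R^o -> bool := fun x => (x : R) \in left_ideal p.
Fact left_ideal_closed p : submod_closed (left_ideal_pred p).
Proof.
split=> [|a x y]; first exact: (mem0v (left_ideal p)).
move=> /memv_imgP[u _ ->] /memv_imgP[v _ ->].
apply/memv_imgP; exists (a * u + v); rewrite ?memvf // !lfunE /=.
by rewrite mulrDl -mulrA.
Qed.
HB.instance Definition _ p :=
  GRing.isSubmodClosed.Build R R^o (left_ideal_pred p) (left_ideal_closed p).
Definition left_submod p := GRing.SubmodClosed.clone R R^o (left_ideal_pred p) _.

Definition left_ideal_mod p : lmodType R := subm (left_submod p).

Definition principal_gen p :=
  p != 0 /\ exists2 e, primitive_idempotent e & p \in right_ideal e.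

Definition is_monomial (X : monomial_presentation R) m :=
  exists p : qpath (quiv X), m = proj X << p >>.

Definition epimorphic m n :=
  exists f : {linear left_ideal_mod m -> left_ideal_mod n}, surj_map f.

Definition ideally_ordered (X : monomial_presentation R) :=
  forall e, primitive_idempotent e ->
  forall m n, is_monomial X m -> is_monomial X n ->
    m \in right_ideal e -> n \in right_ideal e ->
    epimorphic m n \/ epimorphic n m.

Fact primitive_idempotent_exists : exists e, primitive_idempotent e.
Proof.
suff H d e : e != 0 -> is_idempotent e -> (\dim (left_ideal e) <= d)%N ->
    exists e', primitive_idempotent e'.
  by apply: (H _ 1 (oner_neq0 R) (mulr1 1) (leqnn _)).
elim: d e => [|d IHd] e e0 ee dim_e.
  have: e \in left_ideal e by apply/memv_imgP; exists 1; rewrite ?memvf // lfunE /= mul1r.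
  move: dim_e; rewrite leqn0 dimv_eq0 => /eqP->; rewrite memv0 => /eqP e0'.
  by rewrite e0' eqxx in e0.
have [pe|npe] := pselect (primitive_idempotent e); first by exists e.
have [f [g [[ff gg fg gf efg] f0 g0]]] : exists f g,
    [/\ [/\ is_idempotent f, is_idempotent g, f * g = 0, g * f = 0 & e = f + g],
        f != 0 & g != 0].
  apply: contrapT => nfg; apply: npe; split=> // f g ff gg fg gf efg.
  have [->|f0] := eqVneq f 0; first by left.
  have [->|g0] := eqVneq g 0; first by right.
  by case: nfg; exists f, g.
apply: (IHd f f0 ff); rewrite -ltnS; apply: leq_trans dim_e.
have sub : (left_ideal f <= left_ideal e)%VS.
  apply/subvP=> _ /memv_imgP[u _ ->]; rewrite lfunE /=.
  apply/memv_imgP; exists (u * f); rewrite ?memvf // lfunE /= efg mulrDr.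
  by rewrite -!mulrA ff fg mulr0 addr0.
rewrite ltn_neqAle dimvS // andbT; apply/negP => /eqP dim_fe.
have : e \in left_ideal f.
  rewrite (eqP (_ : left_ideal f == left_ideal e)); last by rewrite eqEdim sub dim_fe leqnn.
  by apply/memv_imgP; exists 1; rewrite ?memvf // lfunE /= mul1r.
move=> /memv_imgP[u _]; rewrite lfunE /= => /(congr1 (fun x => x * g)).
rewrite -mulrA fg mulr0 efg mulrDl fg gg add0r => g_eq0.
by rewrite g_eq0 eqxx in g0.
Qed.

(* A choice of representatives of the isomorphism classes of nonzero principal
   left ideals; there are finitely many classes when R is ideally ordered. *)
Record principal_system := {
  pidx : finType;
  pgen : pidx -> R;
  pgen_principal : forall i, principal_gen (pgen i);
  pgen_inj : forall i j,
    isomorphic (left_ideal_mod (pgen i)) (left_ideal_mod (pgen j)) -> i = j;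
  pgen_complete : forall p, principal_gen p ->
    exists i, isomorphic (left_ideal_mod p) (left_ideal_mod (pgen i))
}.

Context (L : principal_system).

Definition Lambda (i : pidx L) := left_ideal_mod (pgen i).

Definition PI : lmodType R := dsum Lambda.

Definition E_PI := endo PI.
HB.instance Definition _ := GRing.PzRing.on E_PI.
HB.instance Definition _ := GRing.Lmodule.on E_PI.

Fact E_PI_nonzero : (1 : E_PI) != 0.
Proof.
have [e ep] := primitive_idempotent_exists.
have [i _] : exists i, isomorphic (left_ideal_mod e) (Lambda i).
  apply: pgen_complete; case: (ep) => e0 ee _; split=> //; exists e => //.
  by apply/memv_imgP; exists 1; rewrite ?memvf // lfunE /= mulr1.
have gen_mem (j : pidx L) : (pgen j : R^o) \in left_submod (pgen j).
  by apply/memv_imgP; exists 1; rewrite ?memvf // lfunE /= mul1r.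
pose x : PI := [ffun j => exist _ (pgen j) (gen_mem j) : Lambda j] : dsum Lambda.
apply/eqP => /(congr1 (fun f : E_PI => (f : lhom _ _) x)) /= /ffunP/(_ i).
rewrite !ffunE => /(congr1 val) /= gen0.
by have [] := pgen_principal i; rewrite gen0 eqxx.
Qed.
HB.instance Definition _ := GRing.PzSemiRing_isNonZero.Build E_PI E_PI_nonzero.
HB.instance Definition _ := GRing.Lmodule_isLalgebra.Build k E_PI
  (@endo_scaleAl k R PI).
HB.instance Definition _ := GRing.Lalgebra_isAlgebra.Build k E_PI
  (@endo_scaleAr k R PI).

Definition P_mod (i : pidx L) : lmodType E_PI := ehom (Lambda i) PI.
Definition S_mod (i : pidx L) : lmodType E_PI := module_top (P_mod i).

Definition ideal_layer (i : pidx L) : nat :=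
  (\dim {:R} - \dim (left_ideal (pgen i)))%N.

Definition layer_le : rel (pidx L) :=
  fun i j => (i == j) || (ideal_layer i < ideal_layer j)%N.

End Ideals.

Arguments P_mod {k R} L i.
Arguments S_mod {k R} L i.
Arguments layer_le {k R} L.

(* Main.v *)
(* A principal left ideal [R p] of an ideally ordered monomial algebra is isomorphic to
   [R m] for a single path [m] of the support of [p]: among the paths of [p] with smallest
   left annihilator take a shortest one.  Hence the principal left ideals with a given top
   form a chain of epimorphisms, and every non-injective map out of [Lambda] factors through
   the next one, [Lambda'].  The radical of [R m] is the direct sum of the ideals [R a m]
   over the arrows [a], and every non-surjective map into [R m] lands in it.

   In the endomorphism algebra [A], with idempotents [e_i], the first fact says that the trace
   in [P_i = A e_i] of the projectives [P_j] with [j] in a higher layer is zero or isomorphic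
   to one [P_j], so the standard module is [P_i / P_j]; iterating it filters [A].  The second
   says that the analogous right ideal of [e_i A] is a direct sum of modules [e_j A];
   dualizing over [k] gives the injective resolution of the costandard module. *)
Require Import Defs.
From HB Require Import structures.
From mathcomp Require Import all_boot all_algebra falgebra finmap.
From mathcomp.multinomials Require Import monalg.
From mathcomp Require Import boolp.

Set Implicit Arguments.
Unset Strict Implicit.
Unset Printing Implicit Defensive.

Import GRing.Theory.
Local Open Scope ring_scope.
Local Open Scope quotient_scope.

(** * Modules, submodules and duality *)

(** Cancellation is the obstacle in passing from [p] to one path [m]. Smallness of the annihilator
    of [m] gives [ann m <= ann p] at once; conversely, when [z p = 0], a nonzero term [q m] might
    cancel against a term [q' p'] for another path [p'] of [p]. Comparing lengths, either [q'] is
    shorter than [q], or [m] is [p'] followed by a cycle. A shortest bad [q] excludes the former. A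
    shortest [m] excludes the latter, because composing with a cycle can only enlarge annihilators
    in an ideally ordered algebra. The module theory is kept apart from paths: it sees orthogonal
    idempotents [e i], characters [chi i] through which the algebra acts on its one-dimensional
    simples, and the elements [t i] and [w a]. Composition factors are read off from [e j] acting
    nontrivially, so the extremal quotients and submodules of the definitions become explicit. The
    characters are coefficients at tops, ultimately at lazy paths, and are well defined because the
    nonzero paths form a basis of [R]. *)

Section LinearMaps.
Context (A : pzRingType).
Implicit Types (M N L : lmodType A).

(** Bundles a function built inside a proof; afterwards the map is known only through the returned
    equation and never unfolds. *)
Lemma linear_of M N (f : M -> N) : linear f -> {g : {linear M -> N} | g =1 f}.
Proof.
move=> lf; pose F : M -> N := f.
pose m := GRing.isLinear.Build A M N *:%R F lf.
pose G : {linear M -> N} := HB.pack F m.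
by exists G.
Qed.

Section PropSubmodule.
Context M (C : M -> Prop).
Definition prop_submod_closed :=
  C 0 /\ forall a x y, C x -> C y -> C (a *: x + y).
Context (hC : prop_submod_closed).
Definition psub_pred of prop_submod_closed : M -> bool := fun x => `[< C x >].
Fact psub_closed : submod_closed (psub_pred hC).
Proof.
case: hC => C0 CD; split=> [|a x y /asboolP Cx /asboolP Cy]; first exact/asboolP.
exact/asboolP/CD.
Qed.
HB.instance Definition _ :=
  GRing.isSubmodClosed.Build A M (psub_pred hC) psub_closed.
Definition psub := GRing.SubmodClosed.clone A M (psub_pred hC) _.
Lemma psubP x : reflect (C x) (x \in psub).
Proof. exact: asboolP. Qed.
End PropSubmodule.

Lemma factor_surj L M N (f : {linear L -> M}) (g : {linear L -> N}) :
  surj_map f -> (forall x, f x = 0 -> g x = 0) ->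
  exists h : {linear M -> N}, forall x, h (f x) = g x.
Proof.
move=> sf fg; pose s y := projT1 (cid (sf y)).
have sK y : f (s y) = y by rewrite /s; case: cid.
have gE x y : f x = f y -> g x = g y.
  move=> fxy; apply/eqP; rewrite -subr_eq0 -linearB; apply/eqP/fg.
  by rewrite linearB fxy subrr.
have lin : linear (g \o s).
  move=> a x y /=; rewrite -linearP; apply: gE.
  by rewrite sK linearP !sK.
have [h hE] := linear_of lin; exists h => x.
by rewrite hE /=; apply: gE; rewrite sK.
Qed.

Lemma isomorphic_of M N (f : {linear M -> N}) :
  injective f -> surj_map f -> isomorphic M N.
Proof.
move=> fi fs; exists f; pose s y := projT1 (cid (fs y)).
have sK y : f (s y) = y by rewrite /s; case: cid.
by exists s => // x; apply: fi; rewrite sK.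
Qed.

Lemma bij_surj (X Y : Type) (f : X -> Y) : bijective f -> surj_map f.
Proof. by case=> g _ gK y; exists (g y). Qed.

Lemma lin_inj M N (f : {linear M -> N}) :
  (forall x, f x = 0 -> x = 0) -> injective f.
Proof.
move=> f0 x y fxy; apply/eqP; rewrite -subr_eq0; apply/eqP/f0.
by rewrite linearB fxy subrr.
Qed.

(** Form of the first isomorphism theorem used below: two modules are compared by covering both from
    a third one. *)
Lemma isomorphic_same_ker L M N (f : {linear L -> M}) (g : {linear L -> N}) :
  surj_map f -> surj_map g -> (forall x, f x = 0 <-> g x = 0) ->
  isomorphic M N.
Proof.
move=> sf sg fg; have [h hE] := factor_surj sf (fun x => (fg x).1).
apply: (@isomorphic_of _ _ h).
  apply: lin_inj => y; have [x <-] := sf y; rewrite hE => gx.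
  exact/(fg x).2.
by move=> z; have [x <-] := sg z; exists (f x).
Qed.

Lemma isomorphic_sym M N : isomorphic M N -> isomorphic N M.
Proof.
case=> f fb; have fi := bij_inj fb.
apply: (@isomorphic_same_ker M N M f idfun); first exact: bij_surj.
- by move=> y; exists y.
- move=> x; split=> [|/= ->]; last by rewrite linear0.
  by rewrite -(linear0 f) => /fi.
Qed.

Lemma isomorphic_trans L M N :
  isomorphic L M -> isomorphic M N -> isomorphic L N.
Proof.
case=> f fb [g gb]; exists (g \o f : {linear L -> N}); exact: bij_comp.
Qed.

Section QuotientMap.
Context M (U : submodClosed M).
Fact quot_map_exists : {g : {linear M -> quotm U} | g =1 \pi_(quotm U)}.
Proof.
apply: linear_of => a x y.
by rewrite -quotm_piD -quotm_scale_pi.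
Qed.
Definition quot_map := sval quot_map_exists.
Lemma quot_mapE x : quot_map x = \pi_(quotm U) x.
Proof. by rewrite /quot_map; case: quot_map_exists. Qed.
Lemma quot_map_surj : surj_map quot_map.
Proof. by move=> y; have [x ->] := quotm_surj y; exists x; rewrite quot_mapE. Qed.
Lemma quot_map_eq0 x : quot_map x = 0 <-> x \in U.
Proof.
rewrite -(linear0 quot_map) !quot_mapE.
by rewrite -[X in X \in U]subr0 -quotm_piE; split=> [/eqP|/eqP].
Qed.
End QuotientMap.

Lemma fin_gen_fin (T : finType) M (x : T -> M) :
  (forall y, exists a : T -> A, y = \sum_t a t *: x t) -> fin_gen M.
Proof.
move=> gx; exists #|T|, (x \o enum_val) => y; have [a ->] := gx y.
exists (a \o enum_val) => /=.
by rewrite -(big_enum_val (fun t => a t *: x t)).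
Qed.

Lemma fin_gen_surj M N (f : {linear M -> N}) : surj_map f -> fin_gen M -> fin_gen N.
Proof.
move=> sf [n [x gx]]; exists n, (f \o x) => y; have [z <-] := sf y.
have [a ->] := gx z; exists a; rewrite linear_sum; apply: eq_bigr => i _.
by rewrite linearZ.
Qed.

End LinearMaps.

(** * Finite dimension and extension of functionals *)

Section FiniteDimension.
Context (k : fieldType).
Implicit Types (U V W : lmodType k).

(** Modules are bare [lmodType]s without a [vectType] structure, so finite dimension is an embedding
    into a row space. *)
Definition fdim V := exists n (s : {linear V -> 'rV[k]_n}), injective s.

(** A space of maximal dimension inside [C] absorbs every vector of [C]: adding its line stays
    inside [C] and cannot raise the dimension. *)
Lemma subspace_vspace (V : vectType k) (C : V -> Prop) : prop_submod_closed C ->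
  exists W : {vspace V}, forall x, x \in W <-> C x.
Proof.
move=> [C0 CD].
have [W0 [W0C W0max]] : exists W : {vspace V}, (forall x, x \in W -> C x) /\
    forall W' : {vspace V}, (forall x, x \in W' -> C x) -> (\dim W' <= \dim W)%N.
  pose D n := `[< exists W : {vspace V}, (forall x, x \in W -> C x) /\ \dim W = n >].
  have exD : exists n, D n.
    exists 0%N; apply/asboolP; exists 0%VS; split; last exact: dimv0.
    by move=> x; rewrite memv0 => /eqP ->.
  have bD n : D n -> (n <= \dim (fullv : {vspace V}))%N.
    by case/asboolP => W [_ <-]; exact/dimvS/subvf.
  case: (ex_maxnP exD bD) => n /asboolP[W [WC <-]] max.
  by exists W; split=> // W' W'C; apply: max; apply/asboolP; exists W'.
exists W0 => x; split; first exact: W0C.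
move=> Cx; have /W0max le_dim : forall y, y \in (W0 + <[x]>)%VS -> C y.
  move=> y /memv_addP[u /W0C Cu [v /vlineP[c ->] ->]].
  by rewrite addrC; exact: CD.
have /eqP -> : W0 == (W0 + <[x]>)%VS by rewrite eqEdim addvSl.
by rewrite memvE addvSr.
Qed.

Lemma fdim_fin_gen V : fdim V -> fin_gen V.
Proof.
move=> [n [s si]].
have cl : prop_submod_closed (fun w : 'rV[k]_n => exists x, w = s x).
  split; first by exists 0; rewrite linear0.
  by move=> a _ _ [x ->] [y ->]; exists (a *: x + y); rewrite linearP.
have [W WE] := subspace_vspace cl.
have Wb (i : 'I_(\dim W)) : exists x, (vbasis W)`_i = s x.
  by apply/WE/vbasis_mem/mem_nth; rewrite size_tuple.
exists (\dim W), (fun i => sval (cid (Wb i))) => y.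
have sy : s y \in W by apply/WE; exists y.
exists (fun i => coord (vbasis W) i (s y)); apply: si.
rewrite linear_sum [LHS](coord_vbasis sy); apply: eq_bigr => i _.
by rewrite linearZ; case: cid => /= x ->.
Qed.

Lemma fin_gen_fdim V : fin_gen V -> fdim V.
Proof.
move=> [n [x gx]].
have lf : linear (fun c : 'rV[k]_n => \sum_i c 0 i *: x i).
  move=> a u v; rewrite scaler_sumr -big_split; apply: eq_bigr => i _ /=.
  by rewrite !mxE scalerDl scalerA.
have [f fE] := linear_of lf.
have sf : surj_map f.
  move=> y; have [a ->] := gx y; exists (\row_i a i); rewrite fE.
  by apply: eq_bigr => i _; rewrite mxE.
have cl : prop_submod_closed (fun c => f c = 0).
  by split=> [|a u v fu fv]; rewrite ?linear0 // linearP fu fv scaler0 addr0.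
have [K KE] := subspace_vspace cl.
(* This projection has kernel [K], the kernel of [f], so it descends to an embedding of [V] into the
   row space. *)
have lg : linear (fun c : 'rV[k]_n => c - projv K c).
  by move=> a u v; rewrite linearP /= opprD scalerBr addrACA.
have [g gE] := linear_of lg.
have [|s sE] := @factor_surj _ _ _ _ f g sf.
  by move=> c /KE cK; rewrite gE projv_id ?subrr.
exists n, s; apply: lin_inj => y; have [c <-] := sf y; rewrite sE gE => /eqP.
by rewrite subr_eq0 => /eqP ->; apply/KE/memv_proj.
Qed.

Lemma fdim_inj U V (g : {linear U -> V}) : injective g -> fdim V -> fdim U.
Proof.
move=> gi [n [s si]]; exists n, (s \o g : {linear U -> 'rV[k]_n}).
exact: inj_comp.
Qed.

Lemma fdim_surj U V (g : {linear U -> V}) : surj_map g -> fdim U -> fdim V.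
Proof. by move=> sg /fdim_fin_gen/(fin_gen_surj sg)/fin_gen_fdim. Qed.

Lemma fdim_vect (V : vectType k) : fdim V.
Proof.
apply: fin_gen_fdim; exists (\dim (fullv : {vspace V})), (fun i => (vbasis fullv)`_i) => y.
exists (fun i => coord (vbasis fullv) i y); exact/coord_vbasis/memvf.
Qed.

(** The functional is extended by zero on the complement chosen by [projv]. All injectivity
    statements below reduce to this one over the field. *)
Lemma functional_extension U V (g : {linear U -> V}) (m : {linear U -> k^o}) :
  fdim V -> injective g -> exists h : {linear V -> k^o}, forall x, h (g x) = m x.
Proof.
move=> [n [s si]] gi.
have cl : prop_submod_closed (fun w : 'rV[k]_n => exists x, w = s (g x)).
  split; first by exists 0; rewrite !linear0.
  by move=> a _ _ [x ->] [y ->]; exists (a *: x + y); rewrite !linearP.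
have [W WE] := subspace_vspace cl.
have Wb (i : 'I_(\dim W)) : exists x, (vbasis W)`_i = s (g x).
  by apply/WE/vbasis_mem/mem_nth; rewrite size_tuple.
pose b i := sval (cid (Wb i)).
have bE i : s (g (b i)) = (vbasis W)`_i by rewrite /b; case: cid.
have lh : linear (fun v : V =>
    \sum_i coord (vbasis W) i (projv W (s v)) * m (b i) : k^o).
  move=> a x y; rewrite scaler_sumr -big_split; apply: eq_bigr => i _ /=.
  by rewrite !linearP mulrDl [a *: (_ : k^o)]mulrA.
have [h hE] := linear_of lh; exists h => x; rewrite hE.
have sx : s (g x) \in W by apply/WE; exists x.
rewrite projv_id //.
have {2}-> : x = \sum_i coord (vbasis W) i (s (g x)) *: b i.
  apply/gi/si; rewrite [LHS](coord_vbasis sx) !linear_sum.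
  by apply: eq_bigr => i _; rewrite !linearZ bE.
by rewrite linear_sum; apply: eq_bigr => i _; rewrite linearZ.
Qed.

End FiniteDimension.

Section Submodules.
Context (A : pzRingType) (M : lmodType A).
Implicit Types (U V : submodClosed M).

Fact subm_map_exists U : {g : {linear subm U -> M} | g =1 val}.
Proof. by apply: linear_of => a x y. Qed.
Definition subm_map U := sval (subm_map_exists U).
Lemma subm_mapE U x : subm_map U x = val x.
Proof. by rewrite /subm_map; case: subm_map_exists. Qed.
Lemma subm_map_inj U : injective (subm_map U).
Proof. by move=> x y; rewrite !subm_mapE; exact: val_inj. Qed.

Definition insubm U x (Ux : x \in U) : subm U := exist _ x Ux.

Lemma subquot_map_eq0 U V (x : subm V) :
  quot_map (trace_submod U V) x = 0 <-> val x \in U.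
Proof. exact: quot_map_eq0. Qed.

Fact zero_closed : @prop_submod_closed _ M (fun x => x = 0).
Proof. by split=> // a x y -> ->; rewrite scaler0 addr0. Qed.
Fact full_closed : @prop_submod_closed _ M (fun=> True).
Proof. by []. Qed.

Section Preimage.
Context U V (Y : submodClosed (subquot U V)).
Definition in_preimage (x : M) :=
  exists2 u : subm V, val u = x & quot_map (trace_submod U V) u \in Y.
Fact in_preimage_closed : prop_submod_closed in_preimage.
Proof.
split; first by exists 0; rewrite ?linear0 ?rpred0 //; exact: (linear0 val).
move=> a _ _ [u <- uY] [v <- vY]; exists (a *: u + v) => //.
by rewrite linearP rpredD ?rpredZ.
Qed.
End Preimage.

Lemma simple_subquot U V :
  {subset U <= V} -> ~ {subset V <= U} ->
  (forall Z : submodClosed M, {subset U <= Z} -> {subset Z <= V} ->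
     {subset Z <= U} \/ {subset V <= Z}) ->
  simple_module (subquot U V).
Proof.
move=> UV nVU sUV; split.
  have [x [xV xU]] : exists x, x \in V /\ ~ x \in U.
    apply: contrapT => nx; apply: nVU => x xV; apply: contrapT => xU.
    by apply: nx; exists x.
  exists (quot_map (trace_submod U V) (insubm xV)).
  by apply/eqP; rewrite subquot_map_eq0.
move=> Y; case: (sUV (psub (in_preimage_closed Y))).
- move=> x xU; apply/psubP; exists (insubm (UV _ xU)) => //.
  have /subquot_map_eq0 -> : val (insubm (UV _ xU)) \in U by [].
  exact: rpred0.
- by move=> x /psubP[u <- _]; exact: (valP u).
- move=> ZU; left => y; have [u <-] := quot_map_surj y => uY.
  by apply/subquot_map_eq0/ZU/psubP; exists u.
- move=> VZ; right => y; have [u <-] := quot_map_surj y.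
  have /VZ/psubP[u' u'u] := valP u.
  by have -> : u' = u by apply: val_inj.
Qed.

End Submodules.

(** * Restriction of scalars to the ground field *)

Section RestrictScalars.
Context (k : fieldType) (A : algType k).

(** An alias of the carrier, so that the scalings by [k] and by [A] live on different types. *)
Definition kres (M : lmodType A) : Type := M.

Section Kres.
Context (M : lmodType A).
HB.instance Definition _ := GRing.Zmodule.on (kres M).
Definition kres_scale (c : k) (x : kres M) : kres M := c%:A *: (x : M).
Fact kres_scaleA a b x : kres_scale a (kres_scale b x) = kres_scale (a * b) x.
Proof. by rewrite /kres_scale scalerA mulr_algl scalerA. Qed.
Fact kres_scale1 : left_id 1 kres_scale.
Proof. by move=> x; rewrite /kres_scale !scale1r. Qed.
Fact kres_scaleDr : right_distributive kres_scale +%R.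
Proof. by move=> a x y; rewrite /kres_scale scalerDr. Qed.
Fact kres_scaleDl x : {morph kres_scale^~ x : a b / a + b}.
Proof. by move=> a b; rewrite /kres_scale !scalerDl. Qed.
HB.instance Definition _ := GRing.Zmodule_isLmodule.Build k (kres M)
  kres_scaleA kres_scale1 kres_scaleDr kres_scaleDl.
End Kres.

Lemma kres_scaleE (M : lmodType A) (c : k) (x : kres M) :
  c *: x = (c%:A *: (x : M) : M).
Proof. by []. Qed.

Lemma kres_map (M N : lmodType A) (f : {linear M -> N}) :
  exists g : {linear kres M -> kres N}, forall x, g x = f x.
Proof.
have lf : linear (f : kres M -> kres N).
  by move=> c x y /=; rewrite !kres_scaleE linearP.
by have [g gE] := linear_of lf; exists g.
Qed.

Definition fdmod (M : lmodType A) := fdim (kres M).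

Lemma fdmod_inj (M N : lmodType A) (f : {linear M -> N}) :
  injective f -> fdmod N -> fdmod M.
Proof.
move=> fi; have [g gE] := kres_map f; apply: (@fdim_inj _ _ _ g) => x y.
by rewrite !gE; exact: fi.
Qed.

Lemma fdmod_surj (M N : lmodType A) (f : {linear M -> N}) :
  surj_map f -> fdmod M -> fdmod N.
Proof.
move=> sf; have [g gE] := kres_map f; apply: (@fdim_surj _ _ _ g) => y.
by have [x <-] := sf y; exists x; rewrite gE.
Qed.

Lemma fdmod_subm (M : lmodType A) (U : submodClosed M) : fdmod M -> fdmod (subm U).
Proof. exact/fdmod_inj/subm_map_inj. Qed.

Lemma fdmod_quotm (M : lmodType A) (U : submodClosed M) : fdmod M -> fdmod (quotm U).
Proof. exact/fdmod_surj/quot_map_surj. Qed.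

Lemma fdmod_fin_gen (M : lmodType A) : fdmod M -> fin_gen M.
Proof.
case/fdim_fin_gen => n [x gx]; exists n, x => y; have [a ->] := gx y.
by exists (fun i => (a i)%:A).
Qed.

Hypothesis fdA : @fin_gen k A.

Lemma fin_gen_fdmod (M : lmodType A) : fin_gen M -> fdmod M.
Proof.
case: fdA => d [b gb] [n [x gx]]; apply: fin_gen_fdim.
apply: (@fin_gen_fin _ ('I_n * 'I_d)%type (kres M) (fun ij => (b ij.2 *: x ij.1 : M))).
move=> y; have [a ->] := gx y.
pose c i := sval (cid (gb (a i))).
have cE i : a i = \sum_j c i j *: b j by rewrite /c; case: cid.
exists (fun ij => c ij.1 ij.2).
rewrite -(pair_bigA _ (fun i j => c i j *: ((b j *: x i : M) : kres M))) /=.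
apply: eq_bigr => i _; rewrite {1}cE scaler_suml; apply: eq_bigr => j _.
by rewrite kres_scaleE scalerA mulr_algl.
Qed.

End RestrictScalars.

(** * Composition series and extremal submodules *)

Section CompositionSeries.
Context (k : fieldType) (A : algType k) (M : lmodType A).
Implicit Types (U V : submodClosed M).

(** A strictly monotone rank on submodules serves for both chain conditions; its value is only ever
    compared. *)
Lemma submod_dimension : fdmod M -> exists d : submodClosed M -> nat,
  (forall U V, {subset U <= V} -> (d U <= d V)%N) /\
  (forall U V, {subset U <= V} -> (d V <= d U)%N -> {subset V <= U}).
Proof.
move=> [n [s si]].
have cl U : prop_submod_closed (fun w : 'rV[k]_n => exists2 x : kres M, x \in U & w = s x).
  split; first by exists 0; [exact: (rpred0 U) | rewrite linear0].
  move=> a _ _ [x Ux ->] [y Uy ->]; exists (a *: x + y); last by rewrite linearP.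
  by have : a%:A *: (x : M) + (y : M) \in U by rewrite rpredD ?rpredZ.
pose W U := sval (cid (subspace_vspace (cl U))).
have WE U w : w \in W U <-> exists2 x : kres M, x \in U & w = s x.
  by rewrite /W; case: cid.
have Wsub U V : {subset U <= V} -> (W U <= W V)%VS.
  move=> UV; apply/subvP => w /WE[x xU ->]; apply/WE; exists x => //; exact: UV.
exists (fun U => \dim (W U)); split=> [U V /Wsub|U V /Wsub sW dVU x xV].
  exact: dimvS.
have /WE[y yU /si->//] : s x \in W U.
  have /eqP -> : W U == W V by rewrite eqEdim sW.
  by apply/WE; exists x.
Qed.

Lemma composition_series_exists : fdmod M -> exists n (U : nat -> submodClosed M),
  composition_series n U.
Proof.
move=> /submod_dimension[d [dle dsub]].
suff H m V : (d V <= m)%N -> exists n (U : nat -> submodClosed M),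
    [/\ is_zero (U 0), U n = V & forall j, (j < n)%N ->
        {subset U j <= U j.+1} /\ simple_module (subquot (U j) (U j.+1))].
  have [n [U [U0 Un US]]] := H _ (psub (full_closed M)) (leqnn _).
  by exists n, U; split=> // x; rewrite Un; exact/psubP.
elim: m V => [|m IHm] V dV.
  exists 0%N, (fun=> V); split=> // x xV.
  suff /psubP : x \in psub (zero_closed M) by [].
  by apply: (dsub (psub (zero_closed M)) V) xV => [y /psubP->|]; 
    rewrite ?rpred0 // (leq_trans dV).
have [V0|nV0] := pselect (is_zero V); first by exists 0%N, (fun=> V).
pose D n := `[< exists U, [/\ {subset U <= V}, ~ {subset V <= U} & d U = n] >].
have exD : exists n, D n.
  exists (d (psub (zero_closed M))); apply/asboolP; exists (psub (zero_closed M)).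
  split=> // [x /psubP->|VU]; first exact: rpred0.
  by apply: nV0 => x /VU/psubP.
have bD n : D n -> (n <= d V)%N by case/asboolP => U [/dle UV _ <-].
(* A proper submodule of [V] of largest rank has a simple quotient in [V]. *)
case: (ex_maxnP exD bD) => _ /asboolP[U [UV nVU <-]] maxU.
have dU : (d U <= m)%N.
  rewrite -ltnS; apply: leq_trans dV; rewrite ltnNge; apply/negP => dVU.
  exact/nVU/dsub.
have [n [C [C0 Cn CS]]] := IHm U dU.
exists n.+1, (fun j => if (j <= n)%N then C j else V); split=> //=.
  by rewrite ltnn.
move=> j; rewrite ltnS => jn; rewrite jn.
case: (ltnP j n) => [|nj]; first exact: CS.
have -> : j = n by apply/eqP; rewrite eqn_leq jn nj.
rewrite Cn; split=> //; apply: simple_subquot => // Z UZ ZV.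
have [VZ|nVZ] := pselect {subset V <= Z}; [by right | left].
by apply: (dsub U Z UZ); apply: maxU; apply/asboolP; exists Z.
Qed.

(** Idempotents act exactly: at the first term of the series where [e] acts nontrivially, it also
    acts nontrivially modulo the previous term. *)
Lemma subquot_detect n (U : nat -> submodClosed M) (e : A) (x : M) :
  composition_series n U -> e * e = e -> e *: x != 0 ->
  exists2 j, (j < n)%N & exists y : subquot (U j) (U j.+1), e *: y != 0.
Proof.
case=> U0 Un US ee ex.
pose D m := `[< exists2 y, y \in U m & e *: y != 0 >].
have exD : exists m, D m by exists n; apply/asboolP; exists x.
case: (ex_minnP exD) => m /asboolP[y yU ey] mmin.
have mn : (m <= n)%N by apply: mmin; apply/asboolP; exists x.
case: m => [|m] in yU mn mmin *.
  by rewrite (U0 _ yU) scaler0 eqxx in ey.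
exists m => //; exists (quot_map (trace_submod (U m) (U m.+1)) (insubm yU)).
rewrite -linearZ; apply/eqP => /subquot_map_eq0 /= eyU.
suff : (m < m)%N by rewrite ltnn.
by apply: mmin; apply/asboolP; exists (e *: y); rewrite // scalerA ee.
Qed.

Lemma subquot_lift U V (e : A) (y : subquot U V) :
  e *: y != 0 -> exists2 x : M, x \in V & e *: x != 0.
Proof.
have [u <-] := quot_map_surj y; rewrite -linearZ => /eqP eu.
exists (val u); first exact: valP u.
by apply/eqP => eu0; apply/eu/subquot_map_eq0; rewrite linearZ /= eu0 rpred0.
Qed.

Lemma simple_submodule_exists : fdmod M -> (exists x : M, x != 0) ->
  exists U : submodClosed M, simple_module (subm U).
Proof.
move=> /submod_dimension[d [dle dsub]] [x x0].
pose D n := `[< exists U : submodClosed M, ~ is_zero U /\ d U = n >].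
have exD : exists n, D n.
  exists (d (psub (full_closed M))); apply/asboolP.
  exists (psub (full_closed M)); split=> // z0.
  by move/eqP: x0; apply; apply/z0/psubP.
case: (ex_minnP exD) => _ /asboolP[U [U0 <-]] minU.
exists U; split.
  apply: contrapT => nU; apply: U0 => y yU; apply: contrapT => y0.
  apply: nU; exists (insubm yU); apply/eqP => /(congr1 val) /=.
  exact: y0.
move=> V.
have cl : prop_submod_closed (fun y : M => exists2 u : subm U, val u = y & u \in V).
  split; first by exists 0; rewrite ?rpred0 //; exact: (linear0 val).
  by move=> a _ _ [u <- uV] [v <- vV]; exists (a *: u + v); rewrite ?rpredD ?rpredZ.
have [V0|nV0] := pselect (is_zero (psub cl)); [left|right].
  move=> u uV; apply: val_inj; apply: V0; apply/psubP; by exists u.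
move=> u; have sub : {subset psub cl <= U} by move=> _ /psubP[v <- _]; exact: valP v.
have /(dsub _ _ sub) VU : (d U <= d (psub cl))%N.
  by apply: minU; apply/asboolP; exists (psub cl).
have /VU/psubP[v vu] := valP u; by rewrite (val_inj vu).
Qed.

Lemma maximal_submodule_exists U : fdmod M -> ~ is_full U ->
  exists2 V : submodClosed M, maximal V & {subset U <= V}.
Proof.
move=> /submod_dimension[d [dle dsub]] nU.
pose D n := `[< exists V : submodClosed M,
  [/\ ~ is_full V, {subset U <= V} & d V = n] >].
have exD : exists n, D n by exists (d U); apply/asboolP; exists U; split.
have bD n : D n -> (n <= d (psub (full_closed M)))%N.
  by case/asboolP => V [_ _ <-]; apply: dle => x _; exact/psubP.
case: (ex_maxnP exD bD) => _ /asboolP[V [nV UV <-]] maxV.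
exists V => //; split=> // W VW.
have [fW|nW] := pselect (is_full W); [by right | left].
apply: (dsub V W VW); apply: maxV; apply/asboolP; exists W; split=> //.
by move=> x /UV/VW.
Qed.

End CompositionSeries.

(** * Injective modules as duals of right modules *)

Section Dual.
Context (k : fieldType) (A : algType k).

(** With the scaling [(a f)(x) = f(x a)] this is the left module dual to the right regular
    module. *)
Definition dual := @lhom k A k^o.
HB.instance Definition _ := GRing.Zmodule.on dual.
Definition ev (f : dual) (x : A) : k := (f : {linear A -> k^o}) x.

Lemma dual_ext (f g : dual) : (forall x, ev f x = ev g x) -> f = g.
Proof. by move=> fg; apply: (@homP k A k^o) => x; exact: fg. Qed.

Section Scale.
Context (a : A) (f : dual).
Definition dual_scale_fun (x : A) : k^o := ev f (x * a).
Fact dual_scale_linear : linear dual_scale_fun.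
Proof. by move=> c x y; rewrite /dual_scale_fun /ev mulrDl -scalerAl linearP. Qed.
HB.instance Definition _ :=
  GRing.isLinear.Build k A k^o *:%R dual_scale_fun dual_scale_linear.
Definition dual_scale : dual := dual_scale_fun.
End Scale.

Fact dual_scaleA a b f : dual_scale a (dual_scale b f) = dual_scale (a * b) f.
Proof. by apply: dual_ext => x; rewrite /ev /= /dual_scale_fun /ev /= /dual_scale_fun mulrA. Qed.
Fact dual_scale1 : left_id 1 dual_scale.
Proof. by move=> f; apply: dual_ext => x; rewrite /ev /= /dual_scale_fun mulr1. Qed.
Fact dual_scaleDr : right_distributive dual_scale +%R.
Proof. by move=> a f g; apply: dual_ext. Qed.
Fact dual_scaleDl f : {morph dual_scale^~ f : a b / a + b}.
Proof.
by move=> a b; apply: dual_ext => x; rewrite /ev /= /dual_scale_fun /ev mulrDr linearD.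
Qed.
HB.instance Definition _ := GRing.Zmodule_isLmodule.Build A dual
  dual_scaleA dual_scale1 dual_scaleDr dual_scaleDl.

Arguments ev : simpl never.

Lemma ev_scale (a : A) (f : dual) x : ev (a *: f) x = ev f (x * a).
Proof. by []. Qed.
Lemma ev_add (f g : dual) x : ev (f + g) x = ev f x + ev g x.
Proof. by []. Qed.
Lemma ev_0 x : ev 0 x = 0. Proof. by []. Qed.
Lemma ev_lin f c x y : ev f (c *: x + y) = c * ev f x + ev f y.
Proof. exact: linearP. Qed.
Lemma ev_sum (J : Type) (r : seq J) f (F : J -> A) :
  ev f (\sum_(j <- r) F j) = \sum_(j <- r) ev f (F j).
Proof. exact: linear_sum. Qed.
Lemma ev0 f : ev f 0 = 0. Proof. exact: linear0. Qed.

Lemma ev_algZ (c : k) f x : ev (c%:A *: f) x = c * ev f x.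
Proof. by rewrite ev_scale mulr_algr -[c *: x]addr0 ev_lin ev0 addr0. Qed.

Lemma dual_of (f : A -> k) :
  (forall c x y, f (c *: x + y) = c * f x + f y) -> exists g, forall x, ev g x = f x.
Proof.
move=> lf; have lf' : linear (f : A -> k^o) by [].
by have [g gE] := linear_of lf'; exists (g : dual).
Qed.

Lemma fdmod_dual : @fin_gen k A -> fdmod dual.
Proof.
move=> [n [b gb]]; exists n.
have lf : linear (fun f : kres dual => \row_(i < n) ev f (b i)).
  move=> c f g; apply/rowP => i; rewrite !mxE ev_add.
  by rewrite kres_scaleE ev_algZ.
have [s sE] := linear_of lf; exists s; apply: lin_inj => f.
rewrite sE => /rowP f0; apply: dual_ext => x; have [a ->] := gb x.
rewrite ev_sum ev_0 big1 // => i _.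
by rewrite -[_ *: _]addr0 ev_lin ev0 addr0; move: (f0 i); rewrite !mxE => ->; rewrite mulr0.
Qed.

Section Corner.
Context (e : A).
Hypothesis ee : e * e = e.

(** The condition says that [f] vanishes on [(1 - e) A], so these functionals form the [k]-dual of
    the right module [e A]. *)
Fact corner_closed : prop_submod_closed (fun f : dual => forall x, ev f (e * x) = ev f x).
Proof.
split=> // a f g fe ge x.
by rewrite !ev_add !ev_scale -mulrA fe ge.
Qed.
Definition corner_dual := subm (psub corner_closed).

Lemma corner_evE (f : corner_dual) x : ev (val f) (e * x) = ev (val f) x.
Proof. by have /psubP := valP f; apply. Qed.

Lemma corner_of (f : dual) : (forall x, ev f (e * x) = ev f x) ->
  exists g : corner_dual, val g = f.
Proof. by move=> fe; have fU : f \in psub corner_closed by [exact/psubP]; exists (insubm fU). Qed.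

Lemma fdmod_corner : @fin_gen k A -> fdmod corner_dual.
Proof. by move=> fdA; exact/fdmod_subm/fdmod_dual. Qed.

(** A map [f] into this module is determined by the functional [n |-> f(n)(1)], since
    [f(n)(a) = f(a n)(1)]. Extending [f] therefore amounts to extending a functional to some [h],
    and [x |-> h(e x n)] turns [h] back into a map whose values lie in the corner. *)
Lemma injective_corner : @fin_gen k A -> injective_module corner_dual.
Proof.
move=> fdA M N g f _ /(fin_gen_fdmod fdA) fN gi.
have [g' g'E] := kres_map g.
have lm : linear (fun m : kres M => ev (val (f m)) 1 : k^o).
  move=> c x y; rewrite kres_scaleE linearP linearP ev_add ev_scale.
  by rewrite mul1r -[c%:A]addr0 ev_lin ev0 addr0.
have [m mE] := linear_of lm.
have g'i : injective g' by move=> x y; rewrite !g'E => /gi.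
have [h hE] := functional_extension m fN g'i.
have phiP (n : N) : exists q : corner_dual, forall x, ev (val q) x = h ((e * x) *: n).
  have [|q qE] := @dual_of (fun x => h ((e * x) *: n)).
    move=> c x y; rewrite mulrDr scalerDl linearD -scalerAr.
    have -> : (c *: (e * x)) *: n = c *: ((e * x) *: n : kres N).
      by rewrite kres_scaleE scalerA mulr_algl.
    by rewrite linearZ.
  have [|r rE] := @corner_of q; first by move=> x; rewrite !qE mulrA ee.
  by exists r => x; rewrite rE.
pose phi n := sval (cid (phiP n)).
have phiE n x : ev (val (phi n)) x = h ((e * x) *: n) by rewrite /phi; case: cid.
have lphi : linear phi.
  move=> a x y; apply: val_inj; apply: dual_ext => z.
  rewrite linearP /= ev_add ev_scale !phiE mulrA scalerDr linearD.
  by rewrite !scalerA ?mulrA.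
have [l lE] := linear_of lphi; exists l => x; apply: val_inj; apply: dual_ext => z.
rewrite /= lE phiE -linearZ /= -g'E hE mE linearZ /= ev_scale mul1r.
exact: corner_evE.
Qed.
End Corner.

Lemma injective_dsum (J : finType) (D : J -> lmodType A) :
  (forall j, injective_module (D j)) -> injective_module (dsum D).
Proof.
move=> iD M N g f fM fN gi.
have lp j : linear (fun x : dsum D => x j) by move=> a x y; rewrite !ffunE.
pose pr j := sval (linear_of (lp j)).
have prE j x : pr j x = x j by rewrite /pr; case: linear_of.
have hP j : exists h : {linear N -> D j}, h \o g =1 (pr j \o f).
  exact: (iD j _ _ g (pr j \o f : {linear M -> D j})).
pose h j := sval (cid (hP j)).
have hE j x : h j (g x) = f x j.
  by rewrite /h; case: cid => /= u /(_ x) /=; rewrite prE.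
have lh : linear (fun n => [ffun j => h j n] : dsum D).
  by move=> a x y; apply/ffunP => j; rewrite !ffunE linearP.
have [l lE] := linear_of lh; exists l => x; apply/ffunP => j.
by rewrite /= lE ffunE hE.
Qed.

Lemma fdmod_dsum (J : finType) (D : J -> lmodType A) :
  (forall j, fdmod (D j)) -> fdmod (dsum D).
Proof.
move=> fD; pose n j := sval (cid (fD j)).
have sP j : {s : {linear kres (D j) -> 'rV[k]_(n j)} | injective s}.
  by apply: cid; rewrite /n; case: cid.
pose V := {ffun {j : J & 'I_(n j)} -> k^o}.
have lf : linear (fun x : kres (dsum D) =>
    [ffun u => sval (sP (tag u)) ((x : dsum D) (tag u)) 0 (tagged u)] : V).
  move=> c x y; apply/ffunP => -[j i]; rewrite !ffunE /=.
  have -> : c%:A *: (x : dsum D) j + (y : dsum D) j =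
    (c *: ((x : dsum D) j : kres (D j)) + ((y : dsum D) j : kres (D j))) :> D j by [].
  by rewrite linearP !mxE.
have [f fE] := linear_of lf; apply: (fdim_inj (g := f)) (fdim_vect V) => x y.
rewrite !fE => /ffunP xy; apply/ffunP => j; apply: (svalP (sP j)).
by apply/rowP => i; have := xy (Tagged (fun j => 'I_(n j)) i); rewrite !ffunE.
Qed.

End Dual.

(** * Split basic algebras *)

Lemma cyclic_map (A : pzRingType) (M N : lmodType A) (x : M) (y : N) :
  (forall z, exists a, z = a *: x) -> (forall a, a *: x = 0 -> a *: y = 0) ->
  exists h : {linear M -> N}, forall a, h (a *: x) = a *: y.
Proof.
move=> gx xy.
have lf (L : lmodType A) (z : L) : linear (fun a : A^o => (a : A) *: z).
  by move=> a b c; rewrite scalerDl scalerA.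
have [f fE] := linear_of (lf _ x); have [g gE] := linear_of (lf _ y).
have [||h hE] := @factor_surj _ _ _ _ f g.
- by move=> z; have [a ->] := gx z; exists a; rewrite fE.
- by move=> a; rewrite fE gE; exact: xy.
by exists h => a; rewrite -[a *: x]fE hE gE.
Qed.

Fact cyclic_closed (A : pzRingType) (M : lmodType A) (x : M) :
  prop_submod_closed (fun y : M => exists a, y = a *: x).
Proof.
split; first by exists 0; rewrite scale0r.
by move=> b _ _ [a ->] [c ->]; exists (b * a + c); rewrite scalerDl scalerA.
Qed.

Section BasicAlgebra.
Context (k : fieldType) (A : algType k) (I : finType).
Context (e : I -> A) (chi : I -> {linear A -> k^o}).
Hypothesis fdA : @fin_gen k A.
Hypothesis eM : forall i j, e i * e j = if i == j then e i else 0.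
Hypothesis e_sum : \sum_i e i = 1.
Hypothesis chiM : forall i (a b : A), chi i (a * b) = chi i a * chi i b.
Hypothesis chi_e : forall i j, chi i (e j) = (i == j)%:R.
Hypothesis chi_nil :
  forall i x, x = e i * x * e i -> chi i x = 0 -> exists n, x ^+ n = 0.
Context (P : I -> lmodType A) (p : forall i, P i).
Hypothesis p_gen : forall i y, exists a, y = a *: p i.
Hypothesis p_ann : forall i a, a *: p i = 0 <-> a * e i = 0.

Lemma idem_e i : e i * e i = e i. Proof. by rewrite eM eqxx. Qed.

Lemma chi1 i : chi i 1 = 1.
Proof.
rewrite -e_sum linear_sum (bigD1 i) //= chi_e eqxx big1 ?addr0 // => j /negPf ji.
by rewrite chi_e eq_sym ji.
Qed.

Lemma e_corner i j a : e i * a * e j = e i * (e i * a * e j) * e j.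
Proof. by rewrite !mulrA idem_e -!mulrA idem_e. Qed.

Lemma mul_e_p i : e i *: p i = p i.
Proof.
apply/eqP; rewrite -subr_eq0 -{2}[p i]scale1r -scalerBl; apply/eqP/p_ann.
by rewrite mulrBl idem_e mul1r subrr.
Qed.

Lemma chi_p i a b : a *: p i = b *: p i -> chi i a = chi i b.
Proof.
move=> /eqP; rewrite -subr_eq0 -scalerBl => /eqP/p_ann/(congr1 (chi i)).
by rewrite chiM chi_e eqxx mulr1 linear0 linearB => /eqP; rewrite subr_eq0 => /eqP.
Qed.

Lemma P_map i (M : lmodType A) (x : M) : e i *: x = x ->
  exists h : {linear P i -> M}, forall a, h (a *: p i) = a *: x.
Proof.
move=> ex; apply: cyclic_map; first exact: p_gen.
by move=> a /p_ann ae; rewrite -ex scalerA ae scale0r.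
Qed.

(* [e_i a e_i] is a nonzero scalar plus a nilpotent element, hence a unit of [e_i A e_i]. *)
Lemma P_gen_full i (U : submodClosed (P i)) a :
  a *: p i \in U -> chi i a != 0 -> is_full U.
Proof.
move=> aU ca; pose n := e i - (chi i a)^-1 *: (e i * a * e i).
have pn : p i - n *: p i \in U.
  rewrite scalerBl mul_e_p opprB addrC subrK -mulr_algl -scalerA -!scalerA mul_e_p.
  by do 2!apply: rpredZ.
have [||m nm] := @chi_nil i n.
- rewrite /n mulrBr mulrBl idem_e idem_e -scalerAr -scalerAl !mulrA idem_e.
  by rewrite -[_ * e i * e i]mulrA idem_e.
- rewrite linearB linearZ /= !chiM chi_e eqxx mulr1 mul1r.
  by rewrite /GRing.scale /= mulVf // subrr.
suff pU : p i - n ^+ m *: p i \in U.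
  move=> y; have [b ->] := p_gen y; apply: rpredZ.
  by move: pU; rewrite nm scale0r subr0.
elim: (m) => [|l IHl]; first by rewrite expr0 scale1r subrr rpred0.
have -> : p i - n ^+ l.+1 *: p i = n *: (p i - n ^+ l *: p i) + (p i - n *: p i).
  by rewrite scalerBr scalerA -exprS [RHS]addrC addrA subrK.
by rewrite rpredD ?rpredZ.
Qed.

Fact rad_closed i : prop_submod_closed
  (fun y : P i => forall a, y = a *: p i -> chi i a = 0).
Proof.
split=> [a /esym a0|c x y cx cy a].
  by rewrite (@chi_p i a 0) ?linear0 // scale0r.
have [x' xE] := p_gen x; have [y' yE] := p_gen y.
rewrite {1}xE {1}yE scalerA -scalerDl => /chi_p <-.
by rewrite linearD /= chiM (cx _ xE) (cy _ yE) mulr0 addr0.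
Qed.

(** By [P_gen_full] every proper submodule lies in the kernel of [chi i], which is thus the only
    maximal submodule. *)
Lemma radicalP i a : a *: p i \in radical (P i) <-> chi i a = 0.
Proof.
pose K := psub (rad_closed i).
have KE b : b *: p i \in K <-> chi i b = 0.
  split=> [/psubP|cb]; first exact.
  by apply/psubP => c /chi_p <-.
have mK : maximal K.
  split=> [/(_ (p i))|V KV].
    by rewrite -[p i]scale1r => /KE/eqP; rewrite chi1 oner_eq0.
  have [fV|nV] := pselect (is_full V); [by right | left].
  move=> y; have [b ->] := p_gen y => bV; apply/KE.
  apply/eqP; apply: contrapT => /negP cb; exact: nV (P_gen_full bV cb).
split=> [/asboolP/(_ K mK)/KE //|ca].
apply/asboolP => U [nU mU].
have UK : {subset U <= K}.
  move=> y; have [b ->] := p_gen y => bU; apply/KE.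
  apply/eqP; apply: contrapT => /negP cb; exact: nU (P_gen_full bU cb).
case: (mU K UK) => [|fK]; first by apply; exact/KE.
by case: mK => /(_ fK).
Qed.

Definition top_module i : lmodType A := module_top (P i).
Local Notation S := top_module.
Definition top_gen i : S i := quot_map (radical (P i)) (p i).
Local Notation s := top_gen.

Lemma s_gen i y : exists a, y = a *: s i.
Proof.
have [x <-] := quot_map_surj y; have [a ->] := p_gen x.
by exists a; rewrite linearZ.
Qed.

Lemma s_ann i a : a *: s i = 0 <-> chi i a = 0.
Proof. by rewrite -linearZ quot_map_eq0; exact: radicalP. Qed.

Lemma s_neq0 i : s i != 0.
Proof.
by apply/eqP; rewrite -[s i]scale1r s_ann chi1 => /eqP; rewrite oner_eq0.
Qed.

Lemma s_scale i a : a *: s i = (chi i a)%:A *: s i.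
Proof.
apply/eqP; rewrite -subr_eq0 -scalerBl; apply/eqP/s_ann.
by rewrite linearB linearZ /= chi1 [_ *: _]mulr1 subrr.
Qed.

Lemma S_scale i a (y : S i) : a *: y = (chi i a)%:A *: y.
Proof.
have [b ->] := s_gen y; rewrite !scalerA mulr_algl [LHS]s_scale [RHS]s_scale.
by rewrite linearZ /= chiM.
Qed.

Lemma simple_S i : simple_module (S i).
Proof.
split=> [|U]; first by exists (s i); exact: s_neq0.
have [U0|nU0] := pselect (is_zero U); [by left | right].
have [a [aU ca]] : exists a, a *: s i \in U /\ chi i a != 0.
  apply: contrapT => na; apply: nU0 => y; have [a ->] := s_gen y => aU.
  apply/s_ann/eqP; apply: contrapT => /negP ca; apply: na; by exists a.
have sU : s i \in U.
  have -> : s i = (chi i a)^-1%:A *: (a *: s i).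
    by rewrite s_scale scalerA mulr_algl scalerA mulVf ?scale1r.
  exact: rpredZ.
by move=> y; have [b ->] := s_gen y; exact: rpredZ.
Qed.

(** The vector [e i *: x] generates [M], so [p i |-> e i *: x] is onto. Its kernel is proper, hence
    killed by [chi i]; conversely, if [chi i a = 0] and [a *: p i] had nonzero image, some [1 - b a]
    of character 1 would send [p i] into the kernel. *)
Lemma simple_iso (M : lmodType A) i (x : M) :
  simple_module M -> e i *: x != 0 -> isomorphic M (S i).
Proof.
move=> [_ sM] ex0.
have eex : e i *: (e i *: x) = e i *: x by rewrite scalerA idem_e.
have [h hE] := P_map eex.
have hp : h (p i) = e i *: x by rewrite -[p i]scale1r hE scale1r.
have sub_full (z : M) : z != 0 -> forall y, exists a, y = a *: z.
  move=> z0.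
  have cl := cyclic_closed z.
  have [Z0|Zf] := sM (psub cl).
    have /eqP : z = 0 by apply: Z0; apply/psubP; exists 1; rewrite scale1r.
    by rewrite (negPf z0).
  by move=> y; have /psubP := Zf y.
have kcl : prop_submod_closed (fun y => h y = 0).
  by split=> [|b y z hy hz]; rewrite ?linear0 // linearP hy hz scaler0 addr0.
have kerE a : h (a *: p i) = 0 -> chi i a = 0.
  move=> ha; apply/eqP; apply: contrapT => /negP ca.
  have aK : a *: p i \in psub kcl by exact/psubP.
  have /psubP := P_gen_full aK ca (p i).
  by rewrite hp => /eqP; rewrite (negPf ex0).
apply: (isomorphic_same_ker (f := h) (g := quot_map (radical (P i)))).
- move=> y; have [a ->] := sub_full _ ex0 y.
  by exists (a *: p i); rewrite hE.
- exact: quot_map_surj.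
move=> y; have [a ->] := p_gen y; rewrite quot_map_eq0; split.
  by move=> /kerE; exact: (radicalP i a).2.
move=> /radicalP ca; apply/eqP; apply: contrapT => /negP ha.
have [b] := sub_full _ ha (h (p i)).
rewrite -linearZ scalerA => /eqP; rewrite -subr_eq0 -linearB /=.
rewrite -{1}[p i]scale1r -scalerBl => /eqP/kerE/eqP.
by rewrite linearB /= chi1 chiM ca mulr0 subr0 oner_eq0.
Qed.

Lemma e_neq0 (M : lmodType A) (x : M) : x != 0 -> exists i, e i *: x != 0.
Proof.
move=> x0; apply: contrapT => nx; move/eqP: x0; apply.
rewrite -[x]scale1r -e_sum scaler_suml big1 // => i _.
by apply/eqP; apply: contrapT => /negP exi; apply: nx; exists i.
Qed.

Lemma complete_S : complete_simples S.
Proof.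
split=> [i|i j [f fb]|M sM]; first exact: simple_S.
  have [a fs] := s_gen (f (s i)).
  have : f (e i *: s i) != 0.
    apply/eqP; rewrite -(linear0 f) => /(bij_inj fb)/s_ann.
    by rewrite chi_e eqxx => /eqP; rewrite oner_eq0.
  rewrite linearZ /= fs scalerA => /eqP; apply: contra_not_eq => ij.
  by apply/s_ann; rewrite chiM chi_e eq_sym (negPf ij) mul0r.
have [[x /e_neq0[i ex]] _] := sM.
by exists i; exact: simple_iso ex.
Qed.

Lemma projective_P i : projective_module (P i).
Proof.
move=> M N g f _ _ sg; have [m gm] := sg (f (p i)).
have eem : e i *: (e i *: m) = e i *: m by rewrite scalerA idem_e.
have [h hE] := P_map eem.
exists h => y; have [a ->] := p_gen y.
by rewrite /= hE !linearZ /= gm -linearZ /= mul_e_p.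
Qed.

Lemma fin_gen_P i : fin_gen (P i).
Proof.
exists 1%N, (fun=> p i) => y; have [a ->] := p_gen y.
by exists (fun=> a); rewrite big_ord1.
Qed.

Lemma projective_cover_P i : projective_cover (P i) (S i).
Proof.
split; [exact: fin_gen_P | exact: projective_P |].
exists (quot_map (radical (P i))); first exact: quot_map_surj.
move=> U /(_ (p i))[u uU].
have [a uE] := p_gen u; rewrite {}uE in uU *.
rewrite quot_map_eq0 -{1}[p i]scale1r -scalerBl => /radicalP.
rewrite linearB /= chi1 => /eqP; rewrite subr_eq0 => /eqP ca.
by apply: (P_gen_full uU); rewrite -ca oner_eq0.
Qed.

(** Replaces composition series by the action of [e j], which is how bounds on composition factors
    are checked from here on. *)
Lemma factor_S (M : lmodType A) j : fdmod M ->
  composition_factor M (S j) <-> exists x : M, e j *: x != 0.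
Proof.
move=> fM; split=> [[n [U [_ [m mn [f fb]]]]]|[x ex]].
  have : e j *: f (s j) != 0.
    rewrite -linearZ; apply/eqP; rewrite -(linear0 f) => /(bij_inj fb)/s_ann.
    by rewrite chi_e eqxx => /eqP; rewrite oner_eq0.
  by case/subquot_lift => x _ ex; exists x.
have [n [U US]] := composition_series_exists fM.
have [m mn [y ey]] := subquot_detect US (idem_e j) ex.
exists n, U; split=> //; exists m => //; apply: isomorphic_sym.
by apply: simple_iso ey; case: US => _ _ /(_ m mn)[].
Qed.


(** * Standard modules and the filtration of the algebra *)

Section Hereditary.
Context (ell : I -> nat).
Definition layer_order : rel I := fun i j => (i == j) || (ell i < ell j)%N.
Local Notation le := layer_order.

(* [A t_i] is the trace in [A e_i] of the projectives in layers above that of [i]. *)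
Context (nx : I -> I) (t : I -> A).
Hypothesis t_e : forall i, e (nx i) * t i * e i = t i.
Hypothesis t_inj : forall i, t i = 0 \/
  (ell i < ell (nx i))%N /\ forall a, a * t i = 0 -> a * e (nx i) = 0.
Hypothesis t_gen : forall i h x, x = e h * x * e i ->
  (exists b, x = b * t i) \/ le h i /\ (h = i -> chi i x != 0).

Lemma mul_e_t i : e (nx i) * t i = t i.
Proof. by rewrite -t_e !mulrA idem_e. Qed.
Lemma mul_t_e i : t i * e i = t i.
Proof. by rewrite -t_e -!mulrA idem_e. Qed.

Lemma lt_le i j : (ell i < ell j)%N -> ~~ le j i.
Proof.
move=> ij; rewrite /le negb_or -leqNgt (ltnW ij) andbT.
by apply/eqP => ji; rewrite ji ltnn in ij.
Qed.

Lemma chi_t i : chi i (t i) = 0.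
Proof.
have [->|[ij _]] := t_inj i; first by rewrite linear0.
rewrite -mul_e_t chiM chi_e; case: eqP => [E|_]; last by rewrite mul0r.
by rewrite -E ltnn in ij.
Qed.

Lemma fdP i : fdmod (P i).
Proof. exact: fin_gen_fdmod fdA _ (fin_gen_P i). Qed.

Fact trace_closed i : prop_submod_closed (fun y : P i => exists b, y = (b * t i) *: p i).
Proof.
split; first by exists 0; rewrite mul0r scale0r.
move=> a _ _ [b ->] [c ->]; exists (a * b + c).
by rewrite scalerA -scalerDl mulrDl mulrA.
Qed.
Definition higher_trace i := psub (trace_closed i).

Lemma higher_trace_p i b : (b * t i) *: p i \in higher_trace i.
Proof. by apply/psubP; exists b. Qed.

Definition std_ker i :=
  smeet (fun U : submodClosed (P i) => factors_le le S i (quotm U)).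

(** By [t_gen] the quotient by the multiples of [t i] has only allowed factors. Conversely an
    admissible [U] contains [t i *: p i], for otherwise [e (nx i)] would act nontrivially on the
    quotient and produce a factor in a higher layer. *)
Lemma std_kerP i y : y \in std_ker i <-> exists b, y = (b * t i) *: p i.
Proof.
split=> [/asboolP/(_ (higher_trace i)) yN|[b ->]].
  apply/(psubP (trace_closed i))/yN => j /(factor_S _ (fdmod_quotm _ (fdP i)))[z ez].
  have [w wE] := quot_map_surj z; have [a aE] := p_gen w.
  have [|[b bE]|[]//] := @t_gen i j (e j * a * e i).
    exact: e_corner.
  move/eqP: ez; case; rewrite -wE aE -linearZ; apply/quot_map_eq0.
  by rewrite -[p i]mul_e_p !scalerA bE higher_trace_p.
apply/asboolP => U Ui; rewrite -scalerA; apply: rpredZ.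
have [->|[ij _]] := t_inj i; first by rewrite scale0r rpred0.
apply: contrapT => nU; have := lt_le ij; rewrite Ui //.
apply/(factor_S _ (fdmod_quotm _ (fdP i))).
exists (quot_map U (t i *: p i)); apply/eqP.
by rewrite -linearZ scalerA mul_e_t => /quot_map_eq0.
Qed.

Local Notation std := (standard le S P).

Definition std_gen i : std i := quot_map (std_ker i) (p i).

Lemma std_gen_gen i y : exists a, y = a *: std_gen i.
Proof.
have [x <-] := quot_map_surj y; have [a ->] := p_gen x.
by exists a; rewrite linearZ.
Qed.

Lemma std_gen_ann i a : a *: std_gen i = 0 <-> exists b, a * e i = b * t i.
Proof.
rewrite -linearZ quot_map_eq0 std_kerP; split=> -[b E]; exists b.
  apply/eqP; rewrite -subr_eq0 -mul_t_e mulrA -mulrBl; apply/eqP/p_ann.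
  by rewrite scalerBl E subrr.
by rewrite -E -scalerA mul_e_p.
Qed.

Lemma e_std_gen i : e i *: std_gen i = std_gen i.
Proof. by rewrite -linearZ /= mul_e_p. Qed.

Lemma endo_trivial_std i : endo_trivial (std i).
Proof.
have lf : linear (fun c : k^o => (c : k) *: (1 : endo (std i))).
  by move=> a b c; rewrite scalerDl scalerA.
have [f fE] := linear_of lf.
have fd c : (f c : lhom _ _) (std_gen i) = c%:A *: std_gen i by rewrite fE.
have ext (g h : endo (std i)) : (g : lhom _ _) (std_gen i) = (h : lhom _ _) (std_gen i) -> g = h.
  move=> gh; apply/homP => y; have [a ->] := std_gen_gen y.
  by rewrite !linearZ /= gh.
exists f.
  split=> [|a b]; apply: ext; first by rewrite fd !scale1r.
  by rewrite fd /= [X in _ = f a X]fd linearZ /= fd scalerA mulr_algl scalerA mulrC.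
(* The inverse reads off the eigenvalue as [chi i] of any representative; this is well defined
   because [chi i] kills the multiples of [t i]. *)
pose g (h : endo (std i)) : k^o := chi i (sval (cid (std_gen_gen ((h : lhom _ _) (std_gen i))))).
have chi_dlt a b : a *: std_gen i = b *: std_gen i -> chi i a = chi i b.
  move/eqP; rewrite -subr_eq0 -scalerBl => /eqP/std_gen_ann[c /(congr1 (chi i))].
  rewrite !chiM chi_t mulr0 chi_e eqxx mulr1 linearB => /eqP.
  by rewrite subr_eq0 => /eqP.
have gE h a : (h : lhom _ _) (std_gen i) = a *: std_gen i -> g h = chi i a.
  by rewrite /g; case: cid => b /= -> /chi_dlt.
exists g => [c|h].
  by rewrite (gE _ c%:A) ?fd // linearZ /= chi1 // [_ *: _]mulr1.
have [a aE] := std_gen_gen ((h : lhom _ _) (std_gen i)).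
rewrite (gE _ _ aE); apply: ext; rewrite fd.
have -> : (h : lhom _ _) (std_gen i) = (e i * a * e i) *: std_gen i.
  by rewrite -!scalerA e_std_gen -aE -linearZ /= e_std_gen.
apply/esym/eqP; rewrite -subr_eq0 -scalerBl; apply/eqP/std_gen_ann.
rewrite mulrBl mulr_algl -[_ * e i * e i]mulrA idem_e.
(* Subtracting the scalar makes the character vanish, so only the first alternative of [t_gen]
   remains: the difference is a multiple of [t i] and acts as zero on the generator. *)
have [||[_ /(_ erefl)/negP]] := @t_gen i i (e i * a * e i - chi i a *: e i).
- by rewrite mulrBr mulrBl -scalerAr -scalerAl !idem_e -e_corner.
- by [].
case; rewrite linearB linearZ /= !chiM chi_e eqxx mulr1 mul1r [_ *: _]mulr1.
by rewrite subrr.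
Qed.

Lemma higher_trace_gen i (y : subm (higher_trace i)) :
  exists a, y = a *: insubm (higher_trace_p i 1).
Proof.
have /psubP[b yb] := valP y; exists b; apply: val_inj.
by rewrite linearZ /= yb mul1r scalerA.
Qed.

Lemma projective_higher_trace i : projective_module (subm (higher_trace i)).
Proof.
set n := insubm (higher_trace_p i 1).
have n_ann a : a *: n = 0 -> a * t i = 0.
  move=> /(congr1 val); rewrite linearZ /= mul1r scalerA => /p_ann.
  by rewrite -mulrA mul_t_e.
have n0 : t i = 0 -> n = 0.
  by move=> t0; apply: val_inj; rewrite /= t0 mulr0 scale0r.
have en : e (nx i) *: n = n.
  by apply: val_inj; rewrite linearZ /= mul1r scalerA mul_e_t.
move=> M N g f _ _ sg; have [m gm] := sg (f n).
(* If [t i = 0] then [n = 0] is annihilated by everything and must go to 0; otherwise every element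
   annihilating [n] also annihilates [e (nx i)]. *)
have [h hE] : exists h : {linear subm (higher_trace i) -> M},
    forall a, h (a *: n) = a *: (if t i == 0 then 0 else e (nx i) *: m).
  apply: cyclic_map; first exact: higher_trace_gen.
  move=> a /n_ann ta; case: eqP => [_|t0]; first by rewrite scaler0.
  have [//|[_ /(_ a ta) ae]] := t_inj i.
  by rewrite scalerA ae scale0r.
exists h => y; have [a ->] := higher_trace_gen y.
rewrite /= -/n hE !linearZ /=; case: eqP => [/n0 ->|_].
  by rewrite !linear0.
by rewrite linearZ /= gm -linearZ /= en.
Qed.

Lemma projdim_std i : projdim_le1 (std i).
Proof.
exists (subm (higher_trace i)), (P i), (subm_map (higher_trace i)), (quot_map (std_ker i)).
split.
- by split; apply/fdmod_fin_gen; [apply: fdmod_subm|]; exact: fdP.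
- exact: projective_higher_trace.
- exact: projective_P.
split; [exact: subm_map_inj | exact: quot_map_surj |].
move=> y; rewrite quot_map_eq0 std_kerP; split=> [[b ->]|[x <-]].
  by exists (insubm (higher_trace_p i b)); rewrite subm_mapE.
by have /psubP := valP x; rewrite subm_mapE.
Qed.

Definition std_filtered (V : submodClosed A^o) :=
  exists n (U : nat -> submodClosed A^o),
  [/\ is_zero (U 0), U n = V &
      forall m, (m < n)%N -> {subset U m <= U m.+1} /\
        exists i, isomorphic (subquot (U m) (U m.+1)) (std i)].

Lemma std_filtered_ext (U V : submodClosed A^o) i :
  std_filtered U -> {subset U <= V} -> isomorphic (subquot U V) (std i) ->
  std_filtered V.
Proof.
move=> [n [C [C0 Cn CS]]] UV iso.
exists n.+1, (fun m => if (m <= n)%N then C m else V); split=> //=.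
  by rewrite ltnn.
move=> m; rewrite ltnS => mn; rewrite mn.
case: (ltnP m n) => [|nm]; first exact: CS.
have -> : m = n by apply/eqP; rewrite eqn_leq mn nm.
by rewrite Cn; split=> //; exists i.
Qed.

Fact sum_closed (U : submodClosed A^o) (x : A) :
  prop_submod_closed (fun z : A^o => exists2 u : A, (u : A^o) \in U & exists a : A, z = u + a * x).
Proof.
split; first by exists 0; [exact: (rpred0 U) | exists 0; rewrite mul0r addr0].
move=> b _ _ [u uU [a ->]] [v vU [c ->]].
exists (b *: (u : A^o) + (v : A^o)); first by rewrite rpredD ?rpredZ.
exists (b * a + c); rewrite scalerDr addrACA mulrDl.
by rewrite [b *: (a * x : A^o)]mulrA.
Qed.

(** The ideal [A x] is a copy of [P i] meeting [U] trivially, so [V / W] is [P i] modulo its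
    multiples of [t i], the standard module. *)
Lemma std_filtered_step (U W V : submodClosed A^o) i (x : A) :
  std_filtered W -> (forall a, a * x = 0 -> a * e i = 0) -> e i * x = x ->
  (forall a, (a * x : A^o) \in U -> a * x = 0) ->
  (forall z, z \in W <-> exists2 u : A, (u : A^o) \in U & exists a : A, z = u + a * (t i * x)) ->
  (forall z, z \in V <-> exists2 u : A, (u : A^o) \in U & exists a : A, z = u + a * x) ->
  std_filtered V.
Proof.
move=> fW x_inj ex Ux WE VE.
have WV : {subset W <= V}.
  move=> z /WE[u uU [a ->]]; apply/VE; exists u => //.
  by exists (a * t i); rewrite mulrA.
apply: (std_filtered_ext fW WV (i := i)).
have axV a : (a * x : A^o) \in V.
  by apply/VE; exists 0; [exact: (rpred0 U) | exists a; rewrite add0r].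
pose v : subm V := insubm (axV 1).
have [|f fE] := @P_map i (subquot W V) (quot_map (trace_submod W V) v).
  by rewrite -linearZ; congr (quot_map _ _); apply: val_inj; rewrite linearZ /= mul1r; exact: ex.
apply: (isomorphic_same_ker (f := f) (g := quot_map (std_ker i))).
- move=> y; have [w <-] := quot_map_surj y.
  have /VE[u uU [a wE]] := valP w.
  exists (a *: p i); rewrite fE -linearZ; apply/eqP; rewrite -subr_eq0 -linearB.
  apply/eqP/subquot_map_eq0; apply/WE; exists (- u); first exact: (submod_opprC (U := U)).
  exists 0; rewrite linearB linearZ /= mul1r wE mul0r addr0.
  by rewrite opprD addrCA [X in _ + X](subrr (a * x)) addr0.
- exact: quot_map_surj.
move=> y; have [a ->] := p_gen y.
rewrite fE -linearZ subquot_map_eq0 quot_map_eq0 std_kerP linearZ /= mul1r WE.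
split=> [[u uU [b axE]]|[b ab]].
  have u0 : (a - b * t i) * x = u.
    by rewrite mulrBl -mulrA (axE : a * x = _) addrK.
  exists b; apply/eqP; rewrite -subr_eq0 -scalerBl; apply/eqP/p_ann/x_inj/Ux.
  by rewrite u0.
exists 0; first exact: (rpred0 U).
exists b; rewrite add0r mulrA; apply/eqP; rewrite -subr_eq0 -[_ *: _]/(a * x).
have ae : (a - b * t i) * e i = 0 by apply/p_ann; rewrite scalerBl ab subrr.
by rewrite -mulrBl -ex mulrA ae mul0r.
Qed.

(* Descending the chain [A x > A t_i x > ...] from layer to layer until it vanishes. *)
Lemma std_filtered_add (U V : submodClosed A^o) i (x : A) :
  std_filtered U -> (forall a, a * x = 0 -> a * e i = 0) -> e i * x = x ->
  (forall a, (a * x : A^o) \in U -> a * x = 0) ->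
  (forall z, z \in V <-> exists2 u : A, (u : A^o) \in U & exists a : A, z = u + a * x) ->
  std_filtered V.
Proof.
have [m] := ubnP (\max_j ell j - ell i)%N.
elim: m => // m IHm in i x V *; rewrite ltnS => le_m fU x_inj ex Ux VE.
have [t0|[ij ti_inj]] := t_inj i.
  apply: (std_filtered_step fU x_inj ex Ux) VE => z; rewrite t0.
  split=> [zU|[u uU [a ->]]]; last by rewrite mul0r mulr0 addr0.
  by exists z => //; exists 0; rewrite mul0r addr0.
pose W := psub (sum_closed U (t i * x)).
have WE z : z \in W <->
    exists2 u : A, (u : A^o) \in U & exists a : A, z = u + a * (t i * x).
  by case: (psubP (sum_closed U (t i * x)) z).
apply: (std_filtered_step _ x_inj ex Ux WE VE).
apply: (IHm (nx i) (t i * x) W) WE => //.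
- apply: leq_trans le_m; apply: ltn_sub2l => //.
  exact: leq_trans ij (leq_bigmax (nx i)).
- by move=> a; rewrite mulrA => /x_inj; rewrite -mulrA mul_t_e => /ti_inj.
- by rewrite mulrA mul_e_t.
- by move=> a; rewrite mulrA; exact: Ux.
Qed.

(** The sum of the [A e_j] with [j] in [r]; the regular module is filtered by adding one such
    summand at a time. *)
Fact support_closed (r : seq I) :
  prop_submod_closed (fun z : A^o => forall j, j \notin r -> (z : A) * e j = 0).
Proof.
split=> [j _|a x y x0 y0 j jr]; first by rewrite mul0r.
by rewrite mulrDl -[a *: x]/(a * (x : A)) -mulrA x0 // y0 // mulr0 addr0.
Qed.

Lemma standard_filtration_regular : standard_filtration le S P A^o.
Proof.
have H r : uniq r -> std_filtered (psub (support_closed r)).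
  elim: r => [|i r IHr] /=.
    exists 0%N, (fun=> psub (support_closed [::])); split=> // z /psubP z0.
    by rewrite -[z]mulr1 -e_sum mulr_sumr big1 // => j _; exact: z0.
  case/andP => ir /IHr fr; apply: (@std_filtered_add _ _ i (e i) fr) => //.
  - exact: idem_e.
  - by move=> a /psubP/(_ i ir); rewrite -mulrA idem_e.
  - move=> z; split=> [/psubP z0|[u /psubP u0 [a ->]]].
      exists (z * (1 - e i)); last by exists z; rewrite mulrBr mulr1 subrK.
      apply/psubP => j jr; have [->|ji] := eqVneq j i.
        by rewrite -mulrA mulrBl mul1r idem_e subrr mulr0.
      rewrite -mulrA mulrBl mul1r eM eq_sym (negPf ji) subr0 z0 //.
      by rewrite in_cons negb_or ji.
    apply/psubP => j; rewrite in_cons negb_or => /andP[ji jr].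
    by rewrite mulrDl u0 // add0r -mulrA eM eq_sym (negPf ji) mulr0.
have [n [U [U0 Un US]]] := H _ (enum_uniq I).
exists n, U; split=> // [x|m /US[sU [i iso]]].
  by rewrite Un; apply/psubP => j; rewrite mem_enum.
split=> //; exists unit, (fun=> i); apply: isomorphic_trans iso _.
have lf : linear (fun x : std i => [ffun=> x] : dsum (fun _ : unit => std i)).
  by move=> a x y; apply/ffunP => u; rewrite !ffunE.
have [f fE] := linear_of lf; apply: (isomorphic_of (f := f)).
  by move=> x y; rewrite !fE => /ffunP/(_ tt); rewrite !ffunE.
by move=> y; exists (y tt); rewrite fE; apply/ffunP => -[]; rewrite ffunE.
Qed.

Lemma partial_order_layer : partial_order le.
Proof.
split=> [i|i j|j i h]; rewrite /le ?eqxx //.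
  case: eqP => [-> //|_] /= /andP[ij]; case: eqP => [-> //|_] /= ji.
  by have := ltn_trans ij ji; rewrite ltnn.
case: eqP => [->|_] //= ij; case: eqP => [<-|_] /=; first by rewrite ij orbT.
by move=> jh; rewrite (ltn_trans ij jh) orbT.
Qed.

(** Nakayama: if [e i *: y] did not generate, it would lie in a maximal submodule; this one also
    contains the radical, modulo which [e i *: y] generates, so it would be everything. *)
Lemma top_generator (M : lmodType A) i : fdmod M ->
  isomorphic (module_top M) (S i) ->
  exists2 x : M, e i *: x = x & forall y, exists a, y = a *: x.
Proof.
move=> fM [f fb]; have [z fz] := bij_surj fb (s i).
have [y zE] := quot_map_surj z; exists (e i *: y); first by rewrite scalerA idem_e.
have cl := cyclic_closed (e i *: y).
have [fc|nfc] := pselect (is_full (psub cl)); first by move=> w; have /psubP := fc w.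
have [V mV sV] := maximal_submodule_exists fM nfc.
case: (mV) => -[]; move=> w.
have [a fa] := s_gen (f (quot_map (radical M) w)).
have : quot_map (radical M) (w - (a * e i) *: y) = 0.
  apply: (bij_inj fb); rewrite !linearB !linearZ /= zE fz linear0 fa.
  by rewrite scalerN -scalerBl; apply/s_ann; rewrite linearB chiM chi_e eqxx mulr1 /= subrr.
move=> /quot_map_eq0/asboolP/(_ V mV) wV.
rewrite -[w](subrK ((a * e i) *: y)) rpredD // -scalerA; apply/sV/psubP.
by exists a.
Qed.

(** A generator of the socle is [a *: x] for a generator [x] of [M]. Incomparability of [i] and [j]
    leaves only the first alternative of [t_gen] for [e j * a * e i], so [t i *: x] is nonzero and
    exhibits the factor [nx i], which lies above [i]. *)
Lemma adapted_layer : adapted le S.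
Proof.
move=> M i j /(fin_gen_fdmod fdA) fM topM [f fb] nij nji.
have [x ex xM] := top_generator fM topM.
have [w fw] := bij_surj fb (s j).
have mul_e_w : e j *: w = w.
  by apply: (bij_inj fb); rewrite linearZ /= fw s_scale chi_e eqxx !scale1r.
have [a aE] := xM (val w).
have ax0 : (e j * a * e i) *: x != 0.
  rewrite -!scalerA ex -aE -[_ *: _]/(val (e j *: w)) mul_e_w; apply/eqP => w0.
  have : s j != 0 by exact: s_neq0.
  have w00 : w = 0 by apply: val_inj; rewrite w0.
  by rewrite -fw w00 linear0 eqxx.
have [||[]] := @t_gen i j (e j * a * e i); first exact: e_corner.
  case=> b bE; rewrite bE -scalerA in ax0.
  have tx0 : t i *: x != 0 by apply: contra_neq ax0 => ->; rewrite scaler0.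
  have [t0|[ij _]] := t_inj i; first by rewrite t0 scale0r eqxx in tx0.
  exists (nx i); split.
    rewrite /slt /le ij orbT andbT; apply/orP; left.
    by apply/eqP => E; rewrite -E ltnn in ij.
  by apply/(factor_S _ fM); exists (t i *: x); rewrite scalerA mul_e_t.
by rewrite (negPf nji).
Qed.

Lemma quasi_hereditary_layer : quasi_hereditary le S P.
Proof.
split=> //.
- split; [exact: complete_S | exact: projective_cover_P |
          exact: partial_order_layer | exact: adapted_layer].
- exact: endo_trivial_std.
- exact: standard_filtration_regular.
Qed.

(* The right ideal [\sum_a w_a A] is the trace in [e_i A] of the right projectives in layers
   above that of [i]. *)
Context (J : I -> finType) (c : forall i, J i -> I) (w : forall i, J i -> A).
Hypothesis w_lt : forall i a, (ell i < ell (@c i a))%N.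
Hypothesis w_e : forall i a, e i * @w i a * e (@c i a) = w a.
Hypothesis w_inj : forall i (x : J i -> A),
  \sum_a w a * x a = 0 -> forall a, e (c a) * x a = 0.
Hypothesis w_gen : forall i h x, x = e i * x * e h ->
  (exists y : J i -> A, x = \sum_a w a * y a) \/ le h i.

(** * Injective envelopes and costandard modules *)

Lemma mul_e_w i a : e i * @w i a = w a.
Proof. by rewrite -w_e !mulrA idem_e. Qed.
Lemma mul_w_e i a : @w i a * e (c a) = w a.
Proof. by rewrite -w_e -!mulrA idem_e. Qed.

(* The dual of the right module [e_i A]. *)
Definition dual_module i : lmodType A := corner_dual (e i).
Local Notation Q := dual_module.

(** This functional spans the copy of [S i] inside [Q i]. *)
Lemma chi_in_Q i : exists q : Q i, forall x, ev (val q) x = chi i x.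
Proof.
have [|f fE] := @dual_of k A (chi i); first by move=> b x y; rewrite linearP.
have [|q qE] := @corner_of k A (e i) f.
  by move=> x; rewrite !fE chiM chi_e eqxx mul1r.
by exists q => x; rewrite qE.
Qed.

Lemma injective_envelope_Q i : injective_envelope (Q i) (S i).
Proof.
split; first exact/fdmod_fin_gen/(fdmod_corner _ fdA).
  exact: injective_corner (idem_e i) fdA.
have [q qE] := chi_in_Q i.
have [||f fE] := @cyclic_map A (S i) (Q i) (s i) q; first exact: s_gen.
  move=> a /s_ann ca; apply: val_inj; apply: dual_ext => x.
  by rewrite linearZ ev_scale qE chiM ca mulr0.
exists f.
  apply: lin_inj => y; have [a ->] := s_gen y; rewrite fE => aq0.
  apply/s_ann; have := congr1 (fun u : Q i => ev (val u) 1) aq0.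
  by rewrite linearZ ev_scale qE mul1r linear0 ev_0.
have fs : f (s i) = q by rewrite -[s i]scale1r fE scale1r.
move=> U U0 u uU; apply: contrapT => u0.
have fU : fdmod (subm U) by apply/fdmod_subm/(fdmod_corner _ fdA).
have [|W sW] := simple_submodule_exists fU.
  exists (insubm uU); apply/eqP => /(congr1 val); exact: u0.
have [z /eqP z0] := sW.1.
have [_ _ /(_ _ sW)[j [g gb]]] := complete_S.
have zE a : a *: z = (chi j a)%:A *: z.
  by apply: (bij_inj gb); rewrite !linearZ /= S_scale.
pose v : Q i := val (val z).
have vU : v \in U by exact: valP (val z).
have vE a : a *: v = (chi j a)%:A *: v.
  by have := congr1 (fun y : subm W => val (val y)) (zE a); rewrite !linearZ.
(* A functional on which the algebra acts through [chi j] is a multiple of [chi j]. Being nonzero at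
   [e i] it forces [j = i], so every nonzero submodule contains [q]. *)
have phiE a : ev (val v) a = chi j a * ev (val v) (e i).
  rewrite -corner_evE -ev_scale -[_ *: _]/(val (a *: v)) vE linearZ.
  exact: ev_algZ.
have v0 : ev (val v) (e i) != 0.
  apply/eqP => v0; apply: z0; do 3!apply: val_inj.
  by apply: dual_ext => x; rewrite -/v phiE v0 mulr0 !linear0 ev_0.
have ji : j = i.
  apply/eqP; apply: contraNT v0 => /negPf ji.
  by rewrite phiE chi_e ji mul0r.
have qU : q \in U.
  have -> : q = (ev (val v) (e i))^-1%:A *: v.
    apply: val_inj; apply: dual_ext => x.
    by rewrite qE linearZ [RHS]ev_algZ (phiE x) mulrCA mulVf // mulr1 ji.
  exact: rpredZ.
have := U0 (s i); rewrite fs => /(_ qU) q0.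
have := qE (e i); rewrite q0 linear0 ev_0 chi_e eqxx => /esym/eqP.
by rewrite oner_eq0.
Qed.

Definition vanishing_pred i (q : Q i) := forall a x, ev (val q) (@w i a * x) = 0.
Fact vanishing_closed i : prop_submod_closed (@vanishing_pred i).
Proof.
split=> [a x|b f g f0 g0 a x]; first by rewrite linear0 ev_0.
by rewrite linearP ev_add ev_scale -mulrA f0 g0 addr0.
Qed.

Definition costd_submod i :=
  sjoin (fun U : submodClosed (Q i) => factors_le le S i (subm U)).

(** Dual to [std_kerP]: a nonzero value of [f] at [w a * x] lets [e (c a)] act nontrivially on
    [x *: f], giving a factor in a higher layer, while by [w_gen] functionals killing all [w a] see
    no forbidden idempotent. *)
Lemma costd_submodP i q : q \in costd_submod i <-> vanishing_pred q.
Proof.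
have fQ (U : submodClosed (Q i)) : fdmod (subm U).
  by apply/fdmod_subm/(fdmod_corner _ fdA).
split=> [/asboolP/(_ (psub (@vanishing_closed i))) qV|q0].
  apply/(psubP (@vanishing_closed i))/qV => U Ui f fU.
  apply/psubP => a x; apply/eqP; apply: contrapT => /negP fx.
  have := lt_le (w_lt a); rewrite Ui //; apply/(factor_S _ (fQ U)).
  exists (x *: insubm fU); apply/eqP => /(congr1 (fun y : subm U => ev (val (val y)) (w a))).
  rewrite !linearZ !ev_scale mul_w_e !linear0 ev_0.
  exact/eqP.
apply/asboolP => V; apply; last exact/(psubP (@vanishing_closed i)).
move=> j /(factor_S _ (fQ _))[f fj].
have [x fx] : exists x, ev (val (val f)) (x * e j) != 0.
  apply: contrapT => nfx; move/eqP: fj; apply; do 2!apply: val_inj.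
  apply: dual_ext => x; rewrite !linearZ ev_scale !linear0 ev_0.
  by apply/eqP; apply: contrapT => /negP fx; apply: nfx; exists x.
have [||//] := @w_gen i j (e i * x * e j); first exact: e_corner.
case=> y yE; move: fx; rewrite -corner_evE mulrA yE ev_sum big1 ?eqxx // => a _.
by have /psubP := valP f; apply.
Qed.

(** The resolution is dual to the inclusion of right modules given by [x |-> \sum_a w a * x a]; the
    second map restricts [q] to [x |-> q (w a * x)]. *)
Lemma injdim_costd i : injdim_le1 (costandard le S i (Q i)).
Proof.
have fQ j : fdmod (Q j) by apply/(fdmod_corner _ fdA).
have dP a (q : Q i) : exists r : Q (@c i a), forall x, ev (val r) x = ev (val q) (w a * x).
  have [|f fE] := @dual_of k A (fun x => ev (val q) (w a * x)).
    by move=> b x y; rewrite mulrDr -scalerAr ev_lin.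
  have [|r rE] := @corner_of k A (e (c a)) f; last by exists r => x; rewrite rE.
  by move=> x; rewrite !fE mulrA mul_w_e.
pose dd a q := sval (cid (dP a q)).
have ddE a q x : ev (val (dd a q)) x = ev (val q) (w a * x) by rewrite /dd; case: cid.
have ld : linear (fun q => [ffun a => dd a q] : dsum (fun a => Q (@c i a))).
  move=> b f g; apply/ffunP => a; rewrite !ffunE.
  apply: val_inj; apply: dual_ext => x.
  by rewrite linearP ev_add ev_scale !ddE linearP ev_add ev_scale mulrA.
have [d dE] := linear_of ld.
exists (Q i), (dsum (fun a => Q (@c i a))), (subm_map (costd_submod i)), d; split.
- by split; apply/fdmod_fin_gen => //; apply: fdmod_dsum.
- exact: injective_corner (idem_e i) fdA.
- apply: injective_dsum => a; exact: injective_corner (idem_e _) fdA.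
split; first exact: subm_map_inj.
  move=> q.
  (* Surjectivity: [X] is the sum of the right modules [e (c a) A], embedded into [A] by [w_inj].
     The family [q] is a functional on [X]; it is extended to [A] and then cut down to [e i A]. *)
  pose D := dsum (fun _ : J i => A : lmodType k).
  have cl : prop_submod_closed (fun x : D => forall a, e (@c i a) * x a = x a).
    split=> [a|b x y xe ye a]; rewrite !ffunE ?mulr0 //.
    by rewrite mulrDr -scalerAr xe ye.
  pose X := subm (psub cl).
  have Xe (x : X) a : e (c a) * val x a = val x a by have /psubP := valP x; apply.
  have lg : linear (fun x : X => \sum_a @w i a * val x a : (A : lmodType k)).
    move=> b x y; rewrite scaler_sumr -big_split; apply: eq_bigr => a _ /=.
    by rewrite !ffunE mulrDr -scalerAr.
  have [g gE] := linear_of lg.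
  have gi : injective g.
    apply: lin_inj => x; rewrite gE => x0; apply: val_inj; apply/ffunP => a.
    by rewrite -Xe (w_inj x0) ffunE.
  have lm : linear (fun x : X => \sum_a ev (val (q a)) (val x a) : k^o).
    move=> b x y; rewrite scaler_sumr -big_split; apply: eq_bigr => a _ /=.
    by rewrite !ffunE ev_lin.
  have [m mE] := linear_of lm.
  have [h hE] := functional_extension m (fin_gen_fdim fdA) gi.
  have [|f fE] := @dual_of k A (fun x => h (e i * x)).
    by move=> b x y; rewrite mulrDr -scalerAr linearP.
  have [|r rE] := @corner_of k A (e i) f; first by move=> x; rewrite !fE mulrA idem_e.
  exists r; rewrite dE; apply/ffunP => a; rewrite ffunE.
  apply: val_inj; apply: dual_ext => x; rewrite ddE rE fE mulrA mul_e_w.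
  pose y : D := [ffun b => if b == a then e (c a) * x else 0].
  have yX : y \in psub cl.
    apply/psubP => b; rewrite ffunE; case: eqP => [->|_]; last by rewrite mulr0.
    by rewrite mulrA idem_e.
  have -> : w a * x = g (insubm yX).
    rewrite gE (bigD1 a) //= ffunE eqxx big1 ?addr0 ?mulrA ?mul_w_e // => b /negPf ba.
    by rewrite ffunE ba mulr0.
  rewrite hE mE (bigD1 a) //= ffunE eqxx corner_evE big1 ?addr0 // => b /negPf ba.
  by rewrite ffunE ba ev0.
move=> q; rewrite dE; split=> [/ffunP q0|[x <-]].
  have /costd_submodP qV : vanishing_pred q.
    by move=> a x; rewrite -ddE; have := q0 a; rewrite !ffunE => ->; rewrite linear0 ev_0.
  by exists (insubm qV); rewrite subm_mapE.
apply/ffunP => a; rewrite !ffunE subm_mapE; apply: val_inj; apply: dual_ext => y.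
rewrite ddE linear0 ev_0; have /costd_submodP := valP x; exact.
Qed.

Lemma strongly_quasi_hereditary_layer :
  left_strongly_quasi_hereditary le S P /\ right_strongly_quasi_hereditary le S P.
Proof.
split; split; try exact: quasi_hereditary_layer; first exact: projdim_std.
by move=> i; exists (Q i); [exact: injective_envelope_Q | exact: injdim_costd].
Qed.

End Hereditary.

End BasicAlgebra.

(** * Monomial algebras *)

Section Paths.
Context (Q : quiver).
Implicit Types p q r m : qpath Q.

Definition plen p := size (parrows p).

Lemma path_eqP p q : pstart p = pstart q -> parrows p = parrows q -> p = q.
Proof.
by case: p q => [[v s] ?] [[w t] ?]; rewrite /pstart /parrows /= => vw st;
  apply: val_inj; rewrite /= vw st.
Qed.

Lemma path_compP p q r : path_comp p q = Some r ->
  [/\ pend q = pstart p, pstart r = pstart q, parrows r = parrows q ++ parrows p &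
      pend r = pend p].
Proof.
have [qp|/eqP/path_comp_none->//] := eqVneq (pend q) (pstart p).
by have [u -> [? ? ?] [<-]] := path_comp_some qp.
Qed.

Lemma path_comp_len p q r : path_comp p q = Some r -> plen r = (plen p + plen q)%N.
Proof. by move=> /path_compP[_ _ ar _]; rewrite /plen ar size_cat addnC. Qed.

Lemma path_comp_injl p p' q r :
  path_comp p q = Some r -> path_comp p' q = Some r -> p = p'.
Proof.
move=> /path_compP[e1 _ a1 _] /path_compP[e2 _ a2 _].
apply: path_eqP; first by rewrite -e1 -e2.
by move/eqP: a2; rewrite a1 eqseq_cat // eqxx => /eqP.
Qed.

Lemma path_comp_lazy p q v :
  (path_comp p q == Some (lazy v)) = (p == lazy v) && (q == lazy v).
Proof.
apply/eqP/andP => [E|[/eqP-> /eqP->]]; last by rewrite path_comp_lazyl /pend /= eqxx.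
have [e s a _] := path_compP E.
have [q0 p0] : parrows q = [::] /\ parrows p = [::].
  by move: a; rewrite [parrows (lazy v)]/=; case: (parrows q) => // <-.
have qv : q = lazy v by apply: path_eqP => //; rewrite -s.
split; last by rewrite qv.
by apply/eqP/path_eqP => //; rewrite -e qv.
Qed.

(* If [p q = p' q'] with [q'] the shorter of the two right factors, then [q]
   factors through [q']. *)
Lemma path_comp_factor p q p' q' r :
  path_comp p q = Some r -> path_comp p' q' = Some r -> (plen q' <= plen q)%N ->
  exists u, path_comp u q' = Some q.
Proof.
move=> /path_compP[_ s1 a1 _] /path_compP[e2 s2 a2 _] le_q.
have aq : parrows q = parrows q' ++ drop (plen q') (parrows q).
  have := congr1 (take (plen q')) a1; rewrite {1}a2 take_size_cat //.
  rewrite takel_cat // => tq.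
  by rewrite -[LHS](cat_take_drop (plen q')) -tq.
set d := drop _ _ in aq.
have wd : walk (pend q') d.
  have := valP q; rewrite /= -/(pstart q) -/(parrows q) aq walk_cat => /andP[_].
  by rewrite -s1 s2.
pose u : qpath Q := exist _ (pend q', d) wd.
have [v vE [vs va _]] := @path_comp_some _ u q' erefl.
exists u; rewrite vE; congr Some; apply: path_eqP; first by rewrite vs -s1 s2.
by rewrite va aq.
Qed.

End Paths.

(** * Coefficients along nonzero paths *)

Section Monomial.
Context (k : fieldType) (R : falgType k) (X : monomial_presentation R).
Local Notation Q := (quiv X).
Local Notation KQ := (path_alg Q k).
Implicit Types (p q r m : qpath Q) (x y z : R) (v : vertex Q).

(* [mono], [path_lift] and [pcoef] are sealed: unification must not unfold them. *)
Fact mono_key : {f : qpath Q -> R | forall p, f p = proj X (<< p >> : KQ)}.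
Proof. by exists (fun p => proj X (<< p >> : KQ)). Qed.
Definition mono := sval mono_key.
Lemma monoE p : mono p = proj X (<< p >> : KQ).
Proof. exact: (svalP mono_key). Qed.
Definition nz p := mono p != 0.

Lemma projM (f g : KQ) : proj X (f * g) = proj X f * proj X g.
Proof. by case: (proj_morph X) => _ ->. Qed.

Lemma proj1 : proj X 1 = 1.
Proof. by case: (proj_morph X). Qed.

Lemma monoM p q : mono p * mono q = if path_comp p q is Some r then mono r else 0.
Proof.
rewrite !monoE -projM [_ * _]path_mulUU mulr1 /omono.
by case: path_comp => [r|]; rewrite ?monoE ?linear0.
Qed.

Lemma monoM_some p q r : path_comp p q = Some r -> mono p * mono q = mono r.
Proof. by rewrite monoM => ->. Qed.

Lemma malgU_scale (K : choiceType) (c : k) (p : K) :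
  << c *g p >> = c *: << p >> :> {malg k[K]}.
Proof. by apply/malgP => q; rewrite mcoeffZ !mcoeffU mulr_natr. Qed.

Lemma proj_monalgU (c : k) p : proj X (<< c *g p >> : KQ) = c *: mono p.
Proof.
have -> : (<< c *g p >> : KQ) = c *: (<< p >> : KQ).
  exact: malgU_scale.
by rewrite monoE; exact: linearZ.
Qed.

Lemma proj_expand (f : KQ) : proj X f = \sum_(p <- msupp f) f@_p *: mono p.
Proof.
by rewrite {1}(path_algE f) linear_sum; apply: eq_bigr => p _; exact: proj_monalgU.
Qed.

Lemma nz_comp p q r : path_comp p q = Some r -> nz r -> nz p /\ nz q.
Proof.
move=> /monoM_some pq; rewrite /nz -pq => pq0.
by split; apply: contraNneq pq0 => ->; rewrite ?mul0r ?mulr0.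
Qed.

Lemma mcoeff_omono (c : k) (o : option (qpath Q)) q :
  (omono c o : KQ)@_q = c *+ (o == Some q).
Proof. by case: o => [p|]; rewrite /omono ?mcoeffU ?mcoeff0. Qed.

Lemma mcoeff_path_mul (f g : KQ) q : (f * g)@_q =
  \sum_(p <- msupp f) \sum_(p' <- msupp g)
     (f@_p * g@_p') *+ (path_comp p p' == Some q).
Proof.
rewrite [f * g]/(path_mul f g) /path_mul raddf_sum; apply: eq_bigr => p _.
by rewrite raddf_sum; apply: eq_bigr => p' _; rewrite /= mcoeff_omono.
Qed.

(* This two-sided ideal contains the relations, hence the kernel of [proj X]. *)
Let vanish (f : KQ) := forall q, nz q -> f@_q = 0.

Let vanish_mulr f g : vanish f -> vanish (f * g).
Proof.
move=> f0 q nq; rewrite mcoeff_path_mul big1 // => p _; rewrite big1 // => p' _.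
by case: eqP => // /nz_comp/(_ nq)[/f0 -> _]; rewrite mul0r mul0rn.
Qed.

Let vanish_mull f g : vanish g -> vanish (f * g).
Proof.
move=> g0 q nq; rewrite mcoeff_path_mul big1 // => p _; rewrite big1 // => p' _.
by case: eqP => // /nz_comp/(_ nq)[_ /g0 ->]; rewrite mulr0 mul0rn.
Qed.

(** Here the relations being paths is used: it makes the nonzero paths linearly independent in
    [R]. *)
Lemma proj_ker_coef (f : KQ) q : proj X f = 0 -> nz q -> f@_q = 0.
Proof.
move=> /proj_ker[n [a [b [t [tC ->]]]]] nq; rewrite raddf_sum big1 // => i _ /=.
have tv : vanish (<< t i >> : KQ); last exact: (vanish_mulr _ (vanish_mull _ tv)).
move=> p np; rewrite mcoeffU.
case: eqP => // tp; case/eqP: np; rewrite -tp monoE; apply/proj_ker.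
exists 1%N, (fun=> 1), (fun=> 1), (fun=> t i); split=> //.
by rewrite big_ord1 mul1r mulr1.
Qed.

Fact path_lift_key : {f : R -> KQ | cancel f (proj X)}.
Proof.
by exists (fun x => sval (cid (proj_surj X x))) => x; case: cid.
Qed.
Definition path_lift := sval path_lift_key.
Lemma path_liftK x : proj X (path_lift x) = x. Proof. exact: (svalP path_lift_key). Qed.
Fact pcoef_key : {c : qpath Q -> R -> k | forall q x, c q x = (path_lift x)@_q}.
Proof. by exists (fun q x => (path_lift x)@_q). Qed.
Definition pcoef := sval pcoef_key.
Lemma pcoef_lift q x : pcoef q x = (path_lift x)@_q.
Proof. exact: (svalP pcoef_key). Qed.

(** The choice of lift affects only the coefficients at paths that vanish in [R]; hence the side
    condition [nz q] from here on. *)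
Lemma pcoefE q (f : KQ) : nz q -> pcoef q (proj X f) = f@_q.
Proof.
move=> nq; apply/eqP; rewrite pcoef_lift -subr_eq0 -mcoeffB; apply/eqP/(proj_ker_coef _ nq).
by rewrite linearB /= path_liftK subrr.
Qed.

Lemma pcoef_lin q c x y : nz q -> pcoef q (c *: x + y) = c * pcoef q x + pcoef q y.
Proof.
move=> nq; rewrite -{1}(path_liftK x) -{1}(path_liftK y) -linearP.
by rewrite pcoefE // mcoeffD mcoeffZ !pcoef_lift.
Qed.

Lemma pcoefD q x y : nz q -> pcoef q (x + y) = pcoef q x + pcoef q y.
Proof. by move=> nq; rewrite -{1}[x]scale1r pcoef_lin // mul1r. Qed.

Lemma pcoef0 q : nz q -> pcoef q 0 = 0.
Proof. by move=> nq; rewrite -(linear0 (proj X)) pcoefE // mcoeff0. Qed.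

Lemma pcoefZ q c x : nz q -> pcoef q (c *: x) = c * pcoef q x.
Proof. by move=> nq; rewrite -[c *: x]addr0 pcoef_lin // pcoef0 // addr0. Qed.

Lemma pcoef_sum q (I : Type) (s : seq I) (F : I -> R) : nz q ->
  pcoef q (\sum_(i <- s) F i) = \sum_(i <- s) pcoef q (F i).
Proof.
move=> nq; apply: (big_morph (pcoef q)) => [x y|]; [exact: pcoefD | exact: pcoef0].
Qed.

Lemma pcoef_mono p q : nz q -> pcoef q (mono p) = (p == q)%:R.
Proof. by move=> nq; rewrite monoE pcoefE // mcoeffU. Qed.

Lemma expand_msupp x : x = \sum_(p <- msupp (path_lift x)) pcoef p x *: mono p.
Proof. by rewrite -{1}(path_liftK x) proj_expand; apply: eq_bigr => p _; rewrite pcoef_lift. Qed.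

Lemma pcoef_ext x y : (forall q, nz q -> pcoef q x = pcoef q y) -> x = y.
Proof.
move=> xy; apply/eqP; rewrite -subr_eq0 (expand_msupp (x - y)) big1 // => p _.
have [p0|np] := eqVneq (mono p) 0; first by rewrite p0 scaler0.
by rewrite -scaleN1r addrC pcoef_lin // xy // mulN1r addNr scale0r.
Qed.

Lemma size_nz (s : seq (qpath Q)) : uniq s -> all nz s -> (size s <= \dim {:R})%N.
Proof.
move=> us /allP ns; pose u := tnth (in_tuple s).
pose t : (size s).-tuple R := [tuple mono (u i) | i < size s].
suff ft : free t by rewrite -(size_tuple t) -(eqP ft) dimvS ?subvf.
apply/freeP => c c0 i; have nu : nz (u i) by apply/ns/mem_tnth.
have := congr1 (pcoef (u i)) c0; rewrite pcoef0 // pcoef_sum // (bigD1 i) //=.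
rewrite pcoefZ // nth_mktuple pcoef_mono // eqxx mulr1 big1 ?addr0 // => j ji.
rewrite pcoefZ // nth_mktuple pcoef_mono //.
by rewrite (inj_eq (elimT (tuple_uniqP (in_tuple s)) us)) (negPf ji) mulr0.
Qed.

Lemma nz_finite : exists s : seq (qpath Q), uniq s /\ forall p, (p \in s) = nz p.
Proof.
pose D n := `[< exists s : seq (qpath Q), [/\ uniq s, all nz s & size s = n] >].
have exD : exists n, D n by exists 0%N; apply/asboolP; exists [::].
have bD n : D n -> (n <= \dim {:R})%N by case/asboolP => s [us ns <-]; exact: size_nz.
case: (ex_maxnP exD bD) => _ /asboolP[s [us ns <-]] maxs.
exists s; split=> // p; apply/idP/idP => [|np]; first exact: (allP ns).
apply/negPn/negP => ps; suff : (size s < size s)%N by rewrite ltnn.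
by apply: maxs; apply/asboolP; exists (p :: s); rewrite /= ps np.
Qed.

Definition nzpaths := sval (cid nz_finite).
Lemma nzpaths_uniq : uniq nzpaths. Proof. by rewrite /nzpaths; case: cid => s []. Qed.
Lemma mem_nzpaths p : (p \in nzpaths) = nz p.
Proof. by rewrite /nzpaths; case: cid => s []. Qed.

Lemma pcoefZ_mono q c p : nz q -> pcoef q (c *: mono p) = c * (p == q)%:R.
Proof. by move=> nq; exact: etrans (pcoefZ _ _ nq) (congr1 _ (pcoef_mono p nq)). Qed.

Lemma expand x : x = \sum_(p <- nzpaths) pcoef p x *: mono p.
Proof.
apply: pcoef_ext => q nq; apply/esym; rewrite (pcoef_sum _ _ nq).
rewrite (eq_bigr _ (fun p _ => pcoefZ_mono (pcoef p x) p nq)).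
rewrite (bigD1_seq q) ?mem_nzpaths ?nzpaths_uniq //= eqxx mulr1.
by rewrite big1 ?addr0 // => p /negPf ->; rewrite mulr0.
Qed.

Lemma pcoef_monoM p q r : nz r -> pcoef r (mono p * mono q) = (path_comp p q == Some r)%:R.
Proof.
move=> nr; rewrite monoM; case: path_comp => [u|]; last exact: pcoef0.
exact: pcoef_mono.
Qed.

Lemma pcoefZ_monoM r a b p q : nz r ->
  pcoef r ((a *: mono p) * (b *: mono q)) = a * b * (path_comp p q == Some r)%:R.
Proof.
move=> nr; have -> : (a *: mono p) * (b *: mono q) = (a * b) *: (mono p * mono q).
  by rewrite -scalerAl -scalerAr scalerA.
exact: etrans (pcoefZ _ _ nr) (congr1 _ (pcoef_monoM p q nr)).
Qed.

Lemma pcoefM r x y : nz r -> pcoef r (x * y) =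
  \sum_(p <- nzpaths) \sum_(q <- nzpaths)
     pcoef p x * pcoef q y * (path_comp p q == Some r)%:R.
Proof.
move=> nr; have -> : x * y = \sum_(p <- nzpaths) \sum_(q <- nzpaths)
    (pcoef p x *: mono p) * (pcoef q y *: mono q).
  by rewrite [in LHS](expand x) [in LHS](expand y) mulr_suml; apply: eq_bigr => p _;
    rewrite mulr_sumr.
rewrite (pcoef_sum _ _ nr); apply: eq_bigr => p _.
rewrite (pcoef_sum _ _ nr); apply: eq_bigr => q _; exact: pcoefZ_monoM.
Qed.

Lemma pcoef_mul_monoE m r x : nz r -> pcoef r (x * mono m) =
  \sum_(p <- nzpaths) pcoef p x * (path_comp p m == Some r)%:R.
Proof.
move=> nr; have -> : x * mono m = \sum_(p <- nzpaths) (pcoef p x *: mono p) * (1 *: mono m).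
  by rewrite -mulr_suml -expand scale1r.
rewrite (pcoef_sum _ _ nr); apply: eq_bigr => p _.
by rewrite pcoefZ_monoM // mulr1.
Qed.

Lemma pcoef_mul_mono q m r x : path_comp q m = Some r -> nz r ->
  pcoef r (x * mono m) = pcoef q x.
Proof.
move=> qm nr; have [nq nm] := nz_comp qm nr; rewrite (pcoef_mul_monoE _ _ nr).
rewrite (bigD1_seq q) ?mem_nzpaths ?nzpaths_uniq //= qm eqxx mulr1.
rewrite big1 ?addr0 // => p /eqP pq.
case: eqP => [pm|]; last by rewrite mulr0.
by case: pq; exact: path_comp_injl pm qm.
Qed.

Lemma pcoef_mul_mono0 m r x : nz r -> (forall q, path_comp q m <> Some r) ->
  pcoef r (x * mono m) = 0.
Proof.
move=> nr nqm; rewrite (pcoef_mul_monoE _ _ nr) big1 // => p _.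
by case: eqP => [/nqm|]; rewrite ?mulr0.
Qed.

Lemma path_comp_self q p : (path_comp q p == Some q) = (p == lazy (pstart q)).
Proof.
apply/eqP/eqP => [E|->]; last by rewrite path_comp_lazyr eqxx.
have := path_comp_len E; rewrite -[LHS]addn0 => /addnI/esym/size0nil p0.
have [pe ps _ _] := path_compP E.
exact: path_eqP.
Qed.

(** Left annihilators of paths are spanned by paths: distinct left factors give distinct products
    with [m], so nothing cancels. *)
Lemma mul_mono_eq0 m x : x * mono m = 0 <->
  forall q r, path_comp q m = Some r -> nz r -> pcoef q x = 0.
Proof.
split=> [xm q r qm nr|x0]; first by rewrite -(pcoef_mul_mono x qm nr) xm pcoef0.
apply: pcoef_ext => r nr; rewrite pcoef0 //.
have [[q qm]|nqm] := pselect (exists q, path_comp q m = Some r).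
  by rewrite (pcoef_mul_mono x qm nr) (x0 q r).
by apply: pcoef_mul_mono0 => // q qm; apply: nqm; exists q.
Qed.

Definition vtx v := mono (lazy v).

Lemma vtx_mono v p : vtx v * mono p = if pend p == v then mono p else 0.
Proof. by rewrite monoM path_comp_lazyl; case: ifP. Qed.

Lemma vtx_sum : \sum_v vtx v = 1.
Proof.
rewrite -proj1 [1 in RHS]/(path_one Q k) linear_sum.
by apply: eq_bigr => v _; rewrite -monoE.
Qed.

Lemma vtx_idem v : vtx v * vtx v = vtx v.
Proof. by rewrite vtx_mono /pend /= eqxx. Qed.

Lemma nz_start p : nz p -> nz (lazy (pstart p)).
Proof.
have E : path_comp p (lazy (pstart p)) = Some p by rewrite path_comp_lazyr eqxx.
by case/(nz_comp E).
Qed.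

Lemma nz_end p : nz p -> nz (lazy (pend p)).
Proof.
have E : path_comp (lazy (pend p)) p = Some p by rewrite path_comp_lazyl eqxx.
by case/(nz_comp E).
Qed.

Lemma pcoef_mono_mul q x : nz q -> pcoef q (mono q * x) = pcoef (lazy (pstart q)) x.
Proof.
move=> nq; have nl := nz_start nq.
have -> : mono q * x = \sum_(p <- nzpaths) (1 *: mono q) * (pcoef p x *: mono p).
  by rewrite -mulr_sumr -expand scale1r.
rewrite (pcoef_sum _ _ nq) (eq_bigr _ (fun p _ => pcoefZ_monoM 1 (pcoef p x) q p nq)).
rewrite (bigD1_seq (lazy (pstart q))) ?mem_nzpaths ?nzpaths_uniq //=.
rewrite path_comp_self eqxx mul1r mulr1 big1 ?addr0 // => p /negPf pq.
by rewrite path_comp_self pq mulr0.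
Qed.

Definition chiv v x : k := pcoef (lazy v) x.

Lemma chivM v x y : nz (lazy v) -> chiv v (x * y) = chiv v x * chiv v y.
Proof.
move=> nv; rewrite /chiv pcoefM // (bigD1_seq (lazy v)) ?mem_nzpaths ?nzpaths_uniq //=.
rewrite (bigD1_seq (lazy v)) ?mem_nzpaths ?nzpaths_uniq //= path_comp_lazy eqxx mulr1.
rewrite big1 ?addr0 => [|q /negPf qv]; last by rewrite path_comp_lazy qv andbF mulr0.
rewrite big1 ?addr0 // => p /negPf pv; rewrite big1 // => q _.
by rewrite path_comp_lazy pv mulr0.
Qed.

Lemma chiv_vtx v u : nz (lazy v) -> chiv v (vtx u) = (u == v)%:R.
Proof.
move=> nv; rewrite /chiv pcoef_mono //; congr (_%:R); congr nat_of_bool.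
by apply/eqP/eqP => [/(congr1 (@pstart _))|->].
Qed.

(** Membership in the [d]-th power of the arrow ideal. *)
Definition rad_power d x := forall q, nz q -> (plen q < d)%N -> pcoef q x = 0.

Lemma rad_powerM d x y : rad_power 1 x -> rad_power d y -> rad_power d.+1 (x * y).
Proof.
move=> x1 yd q nq lq; rewrite pcoefM // big_seq big1 // => p; rewrite mem_nzpaths => np.
rewrite big_seq big1 // => p'; rewrite mem_nzpaths => np'.
case: eqP => [E|_]; last by rewrite mulr0.
have l := path_comp_len E; case: (posnP (plen p)) => [p0|lp].
  by rewrite (x1 p) ?p0 // !mul0r.
rewrite (yd p') ?mulr0 ?mul0r // -ltnS; apply: leq_ltn_trans lq.
by rewrite l -add1n leq_add2r.
Qed.

Lemma rad_nilpotent x : (forall v, nz (lazy v) -> chiv v x = 0) -> exists n, x ^+ n = 0.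
Proof.
move=> x0; have x1 : rad_power 1 x.
  move=> q nq; rewrite ltnS leqn0 size_eq0 => /eqP q0.
  have qv : q = lazy (pstart q) by exact: path_eqP.
  by rewrite qv; apply: x0; rewrite -qv.
have xn n : rad_power n (x ^+ n).
  by elim: n => [|n IHn]; rewrite ?expr0 // exprS; exact: rad_powerM.
exists (\max_(q <- nzpaths) plen q).+1; apply: pcoef_ext => q nq.
rewrite pcoef0 // (xn _ q nq) // ltnS.
by apply: (@leq_bigmax_seq _ nzpaths xpredT (@plen _)); rewrite ?mem_nzpaths.
Qed.

Lemma corner_nilpotent v x : nz (lazy v) -> vtx v * x * vtx v = x -> chiv v x = 0 ->
  exists n, x ^+ n = 0.
Proof.
move=> nv ex cx; apply: rad_nilpotent => u nu.
have [->//|uv] := eqVneq u v.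
by rewrite -ex chivM // chivM // chiv_vtx // eq_sym (negPf uv) mulr0.
Qed.

(** Up to the scalar [c], the element is the vertex idempotent minus a nilpotent [n], inverted by
    the geometric series. *)
Lemma corner_inv v x : nz (lazy v) -> vtx v * x * vtx v = x -> chiv v x != 0 ->
  exists b, x * b = vtx v.
Proof.
move=> nv ex cx; pose c := chiv v x; pose n := vtx v - c^-1 *: x.
have vx : vtx v * x = x by rewrite -ex !mulrA vtx_idem.
have xv : x * vtx v = x by rewrite -ex -mulrA vtx_idem.
have en : vtx v * n = n by rewrite /n mulrBr vtx_idem -scalerAr vx.
have ne : n * vtx v = n by rewrite /n mulrBl vtx_idem -scalerAl xv.
have [|||d nd] := @corner_nilpotent v n => //; first by rewrite en ne.
  rewrite /n addrC -scaleNr /chiv pcoef_lin // -!/(chiv _ _) chiv_vtx // eqxx.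
  by rewrite mulNr mulVf // addNr.
exists (c^-1 *: ((\sum_(i < d) n ^+ i) * vtx v)).
have -> : x = c *: (vtx v * (1 - n)).
  by rewrite mulrBr mulr1 en /n opprB addrC subrK scalerA mulfV ?scale1r.
rewrite -scalerAl -scalerAr scalerA mulfV // scale1r mulrA -[_ * _ * \sum_(i < d) _]mulrA.
have -> : (1 - n) * (\sum_(i < d) n ^+ i) = 1.
  by rewrite -[LHS]opprK -mulNr opprB -subrX1 nd sub0r opprK.
by rewrite mulr1 vtx_idem.
Qed.

Lemma chiv_idem v (e : R) : nz (lazy v) -> e * e = e -> chiv v e = 0 \/ chiv v e = 1.
Proof.
move=> nv ee; have /eqP : chiv v e * (chiv v e - 1) = 0.
  by rewrite mulrBr mulr1 -chivM // ee subrr.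
by rewrite mulf_eq0 subr_eq0 => /orP[] /eqP; [left|right].
Qed.

Lemma idem_nilpotent (e : R) n : e * e = e -> e ^+ n = 0 -> e = 0.
Proof.
move=> ee; case: n => [/(congr1 ( *%R e))|n]; first by rewrite expr0 mulr1 mulr0.
suff -> : e ^+ n.+1 = e by [].
by elim: n => // n IHn; rewrite exprS IHn.
Qed.

Lemma vtx_primitive v : nz (lazy v) -> primitive_idempotent (vtx v).
Proof.
move=> nv; split=> //; first exact: vtx_idem.
move=> f g ff gg fg gf vE.
have fv : vtx v * f * vtx v = f.
  by rewrite vE mulrDl ff gf addr0 mulrDr ff fg addr0.
have gv : vtx v * g * vtx v = g.
  by rewrite vE mulrDl gg fg add0r mulrDr gg gf add0r.
case: (chiv_idem nv ff) => [cf|cf].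
  by have [n fn] := corner_nilpotent nv fv cf; left; exact: idem_nilpotent ff fn.
have cg : chiv v g = 0.
  by rewrite -[chiv v g]mul1r -cf -chivM // fg /chiv pcoef0.
by have [n gn] := corner_nilpotent nv gv cg; right; exact: idem_nilpotent gg gn.
Qed.

(** A nonzero idempotent is not nilpotent, so some vertex character sees [e], and [v e v] is
    invertible in the corner at [v]. The resulting [y * x] is a nonzero idempotent below [e], hence
    [e] itself. *)
Lemma primitive_vtx e : primitive_idempotent e ->
  exists v x y, [/\ nz (lazy v), vtx v * x = x & y * x = e].
Proof.
move=> [e0 ee pe].
have [v [nv cv]] : exists v, nz (lazy v) /\ chiv v e != 0.
  apply: contrapT => nve; have [|n en] := @rad_nilpotent e.
    by move=> v nv; apply/eqP; apply: contrapT => /negP cv; apply: nve; exists v.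
  by case/eqP: e0; exact: idem_nilpotent ee en.
have [||b bE] := @corner_inv v (vtx v * e * vtx v) nv.
- by rewrite !mulrA vtx_idem -mulrA vtx_idem.
- by rewrite !chivM // chiv_vtx // eqxx mul1r mulr1.
pose x := vtx v * e; pose y := e * vtx v * b.
have xy : x * y = vtx v by rewrite /x /y !mulrA -[_ * e * e]mulrA ee.
have vx : vtx v * x = x by rewrite /x mulrA vtx_idem.
have f_idem : (y * x) * (y * x) = y * x by rewrite -mulrA [x * _]mulrA xy vx.
have ef : e * (y * x) = y * x by rewrite /y !mulrA ee.
have fe : (y * x) * e = y * x by rewrite /x -!mulrA ee.
exists v, x, y; split=> //.
have [||||/eqP|/eqP] := pe (y * x) (e - y * x) f_idem.
- by rewrite /is_idempotent mulrBr mulrBl ee fe mulrBl ef f_idem subrr subr0.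
- by rewrite mulrBr fe f_idem subrr.
- by rewrite mulrBl ef f_idem subrr.
- by rewrite addrC subrK.
- move=> /eqP yx0; case/eqP: nv; rewrite -/(vtx v) -[vtx v]vtx_idem -{1}xy -mulrA.
  by rewrite -[X in y * X]xy [y * _]mulrA yx0 mul0r mulr0.
- by rewrite subr_eq0 => /eqP.
Qed.

End Monomial.

Lemma total_minimum (T : eqType) (le : T -> T -> Prop) (s : seq T) :
  {in s &, forall x y, le x y \/ le y x} ->
  {in s & &, forall x y z, le x y -> le y z -> le x z} ->
  s != [::] -> exists2 x, x \in s & {in s, forall y, le x y}.
Proof.
elim: s => // a s IHs tot tr _.
have aa : le a a by case: (tot a a (mem_head _ _) (mem_head _ _)).
have [s0|s0] := eqVneq s [::].
  by exists a; rewrite ?mem_head // => y; rewrite s0 inE => /eqP ->.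
have sub x : x \in s -> x \in a :: s by rewrite in_cons orbC => ->.
have [||x xs xmin] := IHs _ _ s0.
- by move=> x y /sub xs /sub; exact: tot.
- by move=> x y z /sub xs /sub ys /sub; exact: tr.
have [ax|xa] := tot a x (mem_head _ _) (sub _ xs).
  exists a => [|y]; first exact: mem_head.
  rewrite in_cons => /predU1P[->//|ys].
  by apply: (tr _ _ _ (mem_head _ _) (sub _ xs) (sub _ ys)) => //; exact: xmin.
exists x; first exact: sub.
by move=> y; rewrite in_cons => /predU1P[->//|]; exact: xmin.
Qed.

(** * Left ideals and inclusion of annihilators *)

Section LeftIdeals.
Context (k : fieldType) (R : falgType k).
Implicit Types (p x y z : R).

Lemma left_idealP p x : reflect (exists u, x = u * p) (x \in left_ideal p).
Proof.
apply: (iffP memv_imgP) => [[u _ ->]|[u ->]]; first by exists u; rewrite lfunE.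
by exists u; rewrite ?memvf // lfunE.
Qed.

Lemma right_idealP p x : reflect (exists u, x = p * u) (x \in right_ideal p).
Proof.
apply: (iffP memv_imgP) => [[u _ ->]|[u ->]]; first by exists u; rewrite lfunE.
by exists u; rewrite ?memvf // lfunE.
Qed.

Definition lgen p : left_ideal_mod p :=
  insubm (introT (left_idealP p p) (ex_intro _ 1 (esym (mul1r p)))).

Lemma lgen_gen p (z : left_ideal_mod p) : exists a, z = a *: lgen p.
Proof. by have /left_idealP[u uE] := valP z; exists u; apply: val_inj; rewrite uE. Qed.

(** Equivalently, [y |-> z] extends to an epimorphism from [R y] onto [R z]; larger annihilators
    belong to smaller ideals. *)
Definition annle y z := forall x, x * y = 0 -> x * z = 0.
Lemma annle_trans y z x : annle x y -> annle y z -> annle x z.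
Proof. by move=> xy yz u /xy/yz. Qed.

Lemma annle_lker p q : annle p q -> (lker (amulr p) <= lker (amulr q))%VS.
Proof.
move=> pq; apply/subvP => x; rewrite !memv_ker !lfunE /= => /eqP/pq ->.
exact: eqxx.
Qed.

Lemma dim_left_ideal p : (\dim (lker (amulr p)) + \dim (left_ideal p))%N = \dim {:R}.
Proof. by rewrite -(limg_ker_dim (amulr p) fullv) capfv. Qed.

Lemma annle_dim p q : annle p q -> (\dim (left_ideal q) <= \dim (left_ideal p))%N.
Proof.
move=> /annle_lker/dimvS kpq; rewrite -(leq_add2l (\dim (lker (amulr p)))).
by rewrite dim_left_ideal -(dim_left_ideal q) leq_add2r.
Qed.

Lemma annle_dim_eq p q : annle p q ->
  (\dim (left_ideal p) <= \dim (left_ideal q))%N -> annle q p.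
Proof.
move=> /annle_lker kpq le x xq.
have /eqP E : lker (amulr p) == lker (amulr q).
  rewrite eqEdim kpq -(leq_add2r (\dim (left_ideal p))) dim_left_ideal.
  by rewrite -(dim_left_ideal q) leq_add2l.
have : x \in lker (amulr p) by rewrite E memv_ker lfunE /= xq.
by rewrite memv_ker lfunE /= => /eqP.
Qed.

End LeftIdeals.

Section Monomial.
Context (k : fieldType) (R : falgType k) (X : monomial_presentation R).
Local Notation Q := (quiv X).
Implicit Types (p q r m n : qpath Q) (x y z : R) (v : vertex Q).
Local Notation mono := (@mono _ _ X).
Local Notation nz := (@nz _ _ X).

Lemma annle_paths m n :
  (forall q, mono q * mono m = 0 -> mono q * mono n = 0) -> annle (mono m) (mono n).
Proof.
move=> mn x /mul_mono_eq0 xm; apply/mul_mono_eq0 => q r qn nr.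
have : mono q * mono m != 0.
  by apply: contra_neq nr => /mn; rewrite (monoM_some qn).
rewrite monoM; case E: (path_comp q m) => [u|]; last by rewrite eqxx.
by move=> nu; exact: xm E nu.
Qed.

(* If [q n] is a nonzero path then it occurs in [q a n] with coefficient [chiv (pend n) a]. *)
Lemma annle_chiv m n a : nz n -> chiv (X := X) (pend n) a != 0 ->
  annle (mono m) (a * mono n) -> annle (mono m) (mono n).
Proof.
move=> nn ca mn; apply: annle_paths => q /mn; rewrite mulrA => qan.
rewrite monoM; case E: (path_comp q n) => [r|] //; apply: contraNeq ca => nr.
have := pcoef_mul_mono (mono q * a) E nr; rewrite qan pcoef0 // => c0.
have [nq _] := nz_comp E nr.
by rewrite /chiv; have [-> _ _ _] := path_compP E; rewrite -pcoef_mono_mul // -c0.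
Qed.

End Monomial.

Section DirectSumMaps.
Context (A : pzRingType) (J : finType) (D : J -> lmodType A).

Definition dinj_fun j (z : D j) : dsum D := [ffun j' =>
  if j =P j' is ReflectT E then eq_rect j (fun i => D i : Type) z j' E else 0].

Lemma dinj_funE j z : dinj_fun z j = z :> D j.
Proof. by rewrite ffunE; case: eqP => // E; rewrite eq_axiomK. Qed.
Lemma dinj_fun0 j j' (z : D j) : j != j' -> dinj_fun z j' = 0.
Proof. by rewrite ffunE; case: eqP. Qed.

Fact dinj_linear j : linear (@dinj_fun j).
Proof.
move=> a x y; apply/ffunP => i; rewrite [RHS]ffunE [in RHS]ffunE.
have [<-|ji] := eqVneq j i; first by rewrite !dinj_funE.
by rewrite !dinj_fun0 // scaler0 addr0.
Qed.
Definition dinj j : {linear D j -> dsum D} := sval (linear_of (@dinj_linear j)).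

Lemma dinjE j (z : D j) : dinj j z j = z.
Proof. by rewrite /dinj; case: linear_of => f /= ->; exact: dinj_funE. Qed.
Lemma dinj0 j j' (z : D j) : j != j' -> dinj j z j' = 0.
Proof. by move=> jj; rewrite /dinj; case: linear_of => f /= ->; exact: dinj_fun0. Qed.

Fact dpr_linear j : linear (fun x : dsum D => x j).
Proof. by move=> a x y; rewrite !ffunE. Qed.
Definition dpr j : {linear dsum D -> D j} := sval (linear_of (@dpr_linear j)).
Lemma dprE j x : dpr j x = x j.
Proof. by rewrite /dpr; case: linear_of. Qed.

Lemma dsum_decomp (x : dsum D) : x = \sum_j dinj j (x j).
Proof.
apply/ffunP => i; rewrite -[RHS]dprE linear_sum (bigD1 i) //= dprE dinjE.
by rewrite big1 ?addr0 // => j ji; rewrite dprE dinj0.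
Qed.

End DirectSumMaps.

(** * Maps between path ideals and their radicals *)

Section PathModules.
Context (k : fieldType) (R : falgType k) (X : monomial_presentation R).
Local Notation Q := (quiv X).
Implicit Types (p q r m n : qpath Q) (x y z : R) (v : vertex Q).
Local Notation mono := (@mono _ _ X).
Local Notation nz := (@nz _ _ X).

(** A marked generator making [M] a copy of [R m]; it allows a principal ideal not generated by a
    path to be treated as [R m] without transport along an isomorphism. *)
Definition path_module (M : lmodType R) (g : M) m :=
  (forall z : M, exists a, z = a *: g) /\ (forall x, x *: g = 0 <-> x * mono m = 0).

Lemma corner_linv v x : nz (lazy v) -> vtx v * x * vtx v = x -> chiv v x != 0 ->
  exists b, b * x = vtx v.
Proof.
move=> nv ex cx; have [b xb] := corner_inv nv ex cx.
pose b' := vtx v * b * vtx v.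
have xv : x * vtx v = x by rewrite -ex -mulrA vtx_idem.
have vx : vtx v * x = x by rewrite -ex !mulrA vtx_idem.
have xb' : x * b' = vtx v by rewrite /b' !mulrA xv xb vtx_idem.
have [||c bc] := @corner_inv _ _ X v b' nv.
- by rewrite /b' !mulrA vtx_idem -mulrA vtx_idem.
- have := chivM x b' nv; rewrite xb' chiv_vtx // eqxx => /esym c1.
  by apply/eqP => c0; move/eqP: c1; rewrite c0 mulr0 eq_sym oner_eq0.
have b'v : b' * vtx v = b' by rewrite /b' -mulrA vtx_idem.
exists b'; suff -> : x = vtx v * c by rewrite mulrA b'v bc.
by rewrite -xb' -mulrA bc xv.
Qed.

Section Hom.
Context (M N : lmodType R) (g : M) (h : N) (m n : qpath Q).
Hypotheses (gm : path_module g m) (hn : path_module h n) (nn : nz n).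

Lemma path_module_vtx : vtx (pend m) *: g = g.
Proof.
apply/eqP; rewrite -subr_eq0 -{2}[g]scale1r -scalerBl; apply/eqP/gm.2.
by rewrite mulrBl mul1r vtx_mono eqxx subrr.
Qed.

Lemma path_module_chi a b : a *: h = b *: h -> chiv (pend n) a = chiv (pend n) b.
Proof.
move/eqP; rewrite -subr_eq0 -scalerBl => /eqP/hn.2 ab.
have nE : path_comp (lazy (pend n)) n = Some n by rewrite path_comp_lazyl eqxx.
apply/eqP; rewrite -subr_eq0; apply/eqP.
have := pcoef_mul_mono (a - b) nE nn; rewrite ab (pcoef0 nn) => ->.
by rewrite /chiv -[a - b]addrC -scaleN1r (pcoef_lin _ _ _ (nz_end nn)) mulN1r addrC.
Qed.

(** Since [g] is fixed by the idempotent at [pend m], a nonzero top coefficient forces equal end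
    vertices. It also makes [a] left invertible in the corner, whence surjectivity, and [annle_chiv]
    strips [a] from the inclusion of annihilators. *)
Lemma hom_top (f : {linear M -> N}) a : f g = a *: h -> chiv (pend n) a != 0 ->
  [/\ pend m = pend n, annle (mono m) (mono n) & surj_map f].
Proof.
move=> fg ca; have nv := nz_end nn.
have va : a *: h = (vtx (pend m) * a) *: h.
  by rewrite -scalerA -fg -linearZ /= path_module_vtx.
have mn : pend m = pend n.
  move/path_module_chi: va; rewrite chivM // chiv_vtx //.
  by case: eqP => // _; rewrite mul0r => c0; rewrite c0 eqxx in ca.
split=> //.
  apply: (@annle_chiv _ _ X m n a) => // x /gm.2 xg.
  by rewrite mulrA; apply/hn.2; rewrite -scalerA -fg -linearZ /= xg linear0.
have hv : vtx (pend n) *: h = h.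
  apply/eqP; rewrite -subr_eq0 -{2}[h]scale1r -scalerBl; apply/eqP/hn.2.
  by rewrite mulrBl mul1r vtx_mono eqxx subrr.
have [||b bE] := @corner_linv (pend n) (vtx (pend n) * a * vtx (pend n)) nv.
- by rewrite !mulrA vtx_idem -mulrA vtx_idem.
- by rewrite !chivM // chiv_vtx // eqxx mul1r mulr1.
move=> y; have [c ->] := hn.1 y; exists ((c * b) *: g).
have -> : f ((c * b) *: g) = c *: (b *: f g) by rewrite scalerA -linearZ.
have av : (vtx (pend n) * a) *: h = (vtx (pend n) * a * vtx (pend n)) *: h.
  by rewrite -[in RHS]scalerA hv.
by rewrite fg va mn av [b *: _]scalerA bE hv.
Qed.

Lemma surj_top (f : {linear M -> N}) a : f g = a *: h -> surj_map f ->
  chiv (pend n) a != 0.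
Proof.
move=> fg sf; have [z fz] := sf h; have [b zE] := gm.1 z.
have : (b * a) *: h = 1 *: h by rewrite -scalerA -fg -linearZ /= -zE fz scale1r.
move=> /path_module_chi; rewrite chivM ?nz_end // => c1.
apply/eqP => a0; move: c1; rewrite a0 mulr0 => /esym/eqP.
rewrite -(vtx_sum X) /chiv (pcoef_sum _ _ (nz_end nn)) (bigD1 (pend n)) //=.
rewrite -/(chiv _ _) (chiv_vtx _ (nz_end nn)) eqxx big1 ?addr0 ?oner_eq0 // => u un.
by rewrite -/(chiv _ _) (chiv_vtx _ (nz_end nn)) (negPf un).
Qed.

End Hom.

Section Radical.
Context (m : qpath Q).

Definition arrow_path (a : arrow Q) : qpath Q :=
  exist _ (source a, [:: a]) (introT andP (conj (eqxx (source a)) isT)).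
Definition amono (a : arrow Q) : R := mono (arrow_path a) * mono m.
Definition out_arrow := {a : arrow Q | amono a != 0}.

Lemma out_arrow_path (a : out_arrow) : exists r, [/\ nz r, amono (val a) = mono r,
  pend r = target (val a), parrows r = parrows m ++ [:: val a] &
  path_comp (arrow_path (val a)) m = Some r].
Proof.
have := valP a; rewrite /amono monoM.
case E: (path_comp (arrow_path (val a)) m) => [r|]; last by rewrite eqxx.
by exists r; have [_ _ ar er] := path_compP E.
Qed.

(** A nonzero path [q a m] determines the arrow following [m], so the summands are supported on
    disjoint sets of paths. *)
Lemma amono_direct (x : out_arrow -> R) : \sum_a x a * amono (val a) = 0 ->
  forall a, x a * amono (val a) = 0.
Proof.
move=> sx0 a; have [r [nr arE _ ra _]] := out_arrow_path a; rewrite arE.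
apply/mul_mono_eq0 => q u qu nu; have := pcoef0 nu.
rewrite -sx0 (pcoef_sum _ _ nu) (bigD1 a) //= arE (pcoef_mul_mono _ qu nu).
rewrite big1 ?addr0 // => b ba; have [t [nt -> _ rb _]] := out_arrow_path b.
apply: pcoef_mul_mono0 => // q' qt; case/eqP: ba; apply: val_inj.
have [_ _ e1 _] := path_compP qu; have [_ _ e2 _] := path_compP qt.
move: e1; rewrite e2 ra rb -!catA => /eqP; rewrite eqseq_cat // eqxx /=.
by case/andP => /eqP.
Qed.

Fact amono_closed :
  @prop_submod_closed _ R^o
    (fun y => exists x : out_arrow -> R, (y : R) = \sum_a x a * amono (val a)).
Proof.
split; first by exists (fun=> 0); rewrite big1 // => a _; rewrite mul0r.
move=> b _ _ [x ->] [y ->]; exists (fun a => b * x a + y a).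
rewrite [b *: _]mulr_sumr -big_split; apply: eq_bigr => a _.
by rewrite /= mulrDl mulrA.
Qed.

(** The lazy path at the end of [m] has coefficient 0 in [b]; every other path that composes with
    [m] is sorted by its first arrow. *)
Lemma radical_decomp b : chiv (pend m) b = 0 ->
  exists x : out_arrow -> R, b * mono m = \sum_a x a * amono (val a).
Proof.
move=> cb; suff /psubP : (b * mono m : R^o) \in psub amono_closed by [].
rewrite (expand X b) mulr_suml; apply: rpred_sum => q _.
apply/psubP; rewrite -scalerAl.
have [->|cq] := eqVneq (pcoef q b) 0.
  by exists (fun=> 0); rewrite scale0r big1 // => a _; rewrite mul0r.
rewrite monoM; case E: (path_comp q m) => [r|]; last first.
  by exists (fun=> 0); rewrite scaler0 big1 // => a _; rewrite mul0r.
have [r0|nr] := eqVneq (mono r) 0.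
  by exists (fun=> 0); rewrite r0 scaler0 big1 // => a _; rewrite mul0r.
have [mq _ _ _] := path_compP E.
have [a [u uq]] : exists a u, path_comp u (arrow_path a) = Some q.
  case aq: (parrows q) => [|a s].
    case/eqP: cq; rewrite -cb /chiv; congr pcoef; exact: path_eqP.
  have := valP q; rewrite /= -/(parrows q) -/(pstart q) aq /= => /andP[/eqP sa ws].
  exists a, (exist _ (target a, s) ws).
  have [v vE [vs va _]] := @path_comp_some _ (exist _ (target a, s) ws) (arrow_path a) erefl.
  rewrite vE; congr Some; apply: path_eqP; first exact: etrans vs sa.
  by rewrite va aq.
have qE : mono r = mono u * amono a by rewrite /amono mulrA (monoM_some uq) (monoM_some E).
have na : amono a != 0 by apply: contra_neq nr => a0; rewrite qE a0 mulr0.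
pose a' : out_arrow := exist _ a na.
exists (fun c => if c == a' then pcoef q b *: mono u else 0).
rewrite (bigD1 a') //= eqxx big1 ?addr0 => [|c /negPf ->]; last by rewrite mul0r.
by rewrite -scalerAl -qE.
Qed.

End Radical.

Lemma path_module_mono m : nz m -> path_module (lgen (mono m)) m.
Proof.
move=> nm; split=> [z|x]; first exact: lgen_gen.
by split=> [/(congr1 val)|xm] //; apply: val_inj.
Qed.

(** The epimorphism need not send [m] to [n], only to some [a n] with nonzero top coefficient, which
    suffices by [hom_top]. *)
Lemma epimorphic_annle m n : nz m -> nz n ->
  epimorphic (mono m) (mono n) -> annle (mono m) (mono n).
Proof.
move=> nm nn [f sf]; have [pm pn] := (path_module_mono nm, path_module_mono nn).
have [a fa] := lgen_gen (f (lgen (mono m))).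
have ca := surj_top pm pn nn fa sf.
by have [] := hom_top pm pn nn fa ca.
Qed.

Hypothesis hX : ideally_ordered X.

Lemma annle_total m n : nz m -> nz n -> pend m = pend n ->
  annle (mono m) (mono n) \/ annle (mono n) (mono m).
Proof.
move=> nm nn mn; have pv := vtx_primitive (nz_end nn).
have mono_in p : pend p = pend n -> mono p \in right_ideal (vtx (pend n)).
  by move=> pn; apply/right_idealP; exists (mono p); rewrite vtx_mono pn eqxx.
have [||||/(epimorphic_annle nm nn)|/(epimorphic_annle nn nm)] := hX pv (m := mono m) (n := mono n).
- by exists m; rewrite monoE.
- by exists n; rewrite monoE.
- exact: mono_in.
- exact: mono_in.
- by left.
- by right.
Qed.

(* A nonzero path [u m] with [u] a cycle satisfies [ann m <= ann (u m)], since [u] is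
   nilpotent. *)
Lemma annle_cycle u m n : path_comp u m = Some n -> pend m = pend n -> nz n ->
  (0 < plen u)%N -> annle (mono m) (mono n).
Proof.
move=> um mn nn lu; have [nu nm] := nz_comp um nn.
have [//|nm_le] := annle_total nm nn mn.
have [d ud] : exists d, mono u ^+ d = 0.
  apply: (@rad_nilpotent _ _ X) => v nv; rewrite /chiv pcoef_mono //.
  by case: eqP lu => // ->.
suff n0 : mono n = 0 by case/eqP: nn.
suff : mono u ^+ 0 * mono n = 0 by rewrite expr0 mul1r.
have : mono u ^+ d * mono n = 0 by rewrite ud mul0r.
elim: d {ud} => // d IHd udn; apply: IHd.
by rewrite -(monoM_some um) mulrA -exprSr; exact: nm_le.
Qed.

Lemma annihilator_path v x : nz (lazy v) -> vtx v * x = x -> x != 0 ->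
  exists m, [/\ nz m, pend m = v & forall z, z * x = 0 <-> z * mono m = 0].
Proof.
move=> nv vx x0.
pose s := [seq p <- nzpaths X | pcoef p x != 0].
have sP p : p \in s -> [/\ nz p, pend p = v & pcoef p x != 0].
  rewrite mem_filter mem_nzpaths => /andP[cp np]; split=> //.
  apply: contraNeq cp => pv; rewrite -vx /vtx.
  have -> : mono (lazy v) * x = \sum_(q <- nzpaths X) (1 *: mono (lazy v)) * (pcoef q x *: mono q).
    by rewrite -mulr_sumr -expand scale1r.
  rewrite (pcoef_sum _ _ np) (eq_bigr _ (fun q _ => pcoefZ_monoM 1 (pcoef q x) (lazy v) q np)).
  rewrite big1 // => q _; rewrite path_comp_lazyl.
  case: (pend q =P v) => [qv|_]; last by rewrite mulr0.
  have [[qp]|_] := Some q =P Some p; last by rewrite mulr0.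
  by rewrite -qp qv eqxx in pv.
have s0 : s != [::].
  apply: contraNneq x0 => s0; rewrite (expand X x) big_seq big1 // => p.
  case: (eqVneq (pcoef p x) 0) => [-> _|cp ps]; first by rewrite scale0r.
  by have : p \in s by [rewrite mem_filter cp]; rewrite s0.
(* Length breaks ties between equal annihilators, so a least element has a smallest annihilator and
   is shortest among those. *)
pose le m n := annle (mono m) (mono n) /\
  (annle (mono n) (mono m) -> (plen m <= plen n)%N).
have [||m /sP[nm mv cm] mmin] := @total_minimum _ le s _ _ s0.
- move=> p q /sP[np pv _] /sP[nq qv _]; rewrite /le.
  have [pq|npq] := pselect (annle (mono p) (mono q)); last first.
    have [//|qp] := annle_total np nq (etrans pv (esym qv)).
    by right; split.
  have [qp|nqp] := pselect (annle (mono q) (mono p)).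
    have /orP[l|l] := leq_total (plen p) (plen q); last first.
      by right; split; [exact: qp | move=> _; exact: l].
    by left; split; [exact: pq | move=> _; exact: l].
  by left; split; [exact: pq | move/nqp].
- move=> p q r _ _ _ [pq lpq] [qr lqr]; split; first exact: annle_trans pq qr.
  move=> rp; apply: leq_trans (lpq (annle_trans qr rp)) (lqr (annle_trans rp pq)).
exists m; split=> // z; split; last first.
  move=> zm; rewrite (expand X x) mulr_sumr big_seq big1 // => p.
  have [-> _|cp pn] := eqVneq (pcoef p x) 0; first by rewrite scale0r mulr0.
  have [|/(_ z zm) zp _] := mmin p; first by rewrite mem_filter cp.
  by rewrite -scalerAr zp scaler0.
move=> zx; apply/mul_mono_eq0; apply: contrapT => nz0.
(* A path [q] of [z] with [q m] nonzero is taken shortest; the coefficient of [z * x] at [r = q m]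
   will be shown to come from [m] alone. *)
pose D d := `[< exists q r, [/\ path_comp q m = Some r, nz r, pcoef q z != 0 & plen q = d] >].
have exD : exists d, D d.
  apply: contrapT => nD; apply: nz0 => q r qm nr; apply/eqP; apply: contrapT => /negP cq.
  by apply: nD; exists (plen q); apply/asboolP; exists q, r.
case: (ex_minnP exD) => _ /asboolP[q [r [qm nr cq <-]]] qmin.
have := pcoef0 nr; rewrite -zx (expand X x) mulr_sumr (pcoef_sum _ _ nr).
have E p : pcoef r (z * (pcoef p x *: mono p)) = pcoef p x * pcoef r (z * mono p).
  by rewrite -scalerAr; exact: pcoefZ.
rewrite (eq_bigr _ (fun p _ => E p)).
rewrite (bigD1_seq m) ?mem_nzpaths ?nzpaths_uniq //=.
rewrite (pcoef_mul_mono z qm nr) big_seq_cond big1 ?addr0.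
  by move/eqP; rewrite mulf_eq0 (negPf cm) (negPf cq).
move=> p /andP[pn pm]; have [->|cp] := eqVneq (pcoef p x) 0; first by rewrite mul0r.
have ps : p \in s by rewrite mem_filter cp.
have [_ pv _] := sP p ps; have [mp lmp] := mmin p ps.
apply/eqP; rewrite mulf_eq0 (negPf cp) /=; apply/eqP.
have [[q' qp]|nqp] := pselect (exists q', path_comp q' p = Some r); last first.
  by apply: pcoef_mul_mono0 => // q' qp; apply: nqp; exists q'.
rewrite (pcoef_mul_mono z qp nr); apply/eqP; apply: contraTT isT => cq'.
have lE : (plen q' + plen p = plen q + plen m)%N.
  by rewrite -(path_comp_len qp) -(path_comp_len qm).
have [lpm|lmp'] := leqP (plen p) (plen m).
  (* Both [p] and [m] end at [v], so [u] is a cycle; if nontrivial, it makes [m] longer than [p]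
     although [m] is least. *)
  have [u um] := path_comp_factor qm qp lpm.
  have [lu|lu] := posnP (plen u).
    case/eqP: pm; have [up ms ma _] := path_compP um; apply: path_eqP => //.
    by rewrite ma (size0nil lu) cats0.
  have := lmp (annle_cycle um (etrans pv (esym mv)) nm lu).
  by rewrite (path_comp_len um) -{2}[plen p]add0n leq_add2r leqNgt lu.
(* Here [q'] is shorter than [q], and [q' m] is nonzero because the annihilator of [m] is contained
   in that of [p]: this contradicts the choice of [q]. *)
have : mono q' * mono m != 0.
  apply/eqP => /mp; rewrite (monoM_some qp); exact/eqP.
rewrite monoM; case Eq : (path_comp q' m) => [r'|]; last by rewrite eqxx.
move=> nr'; have : (plen q <= plen q')%N.
  by apply: qmin; apply/asboolP; exists q', r'.
by move=> lq; move: lE; move/eqP; rewrite eqn_leq => /andP[+ _]; rewrite leqNgt -addnS leq_add.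
Qed.

End PathModules.

(** * Principal left ideals *)

Section PrincipalSystem.
Context (k : fieldType) (R : falgType k) (X : monomial_presentation R).
Hypothesis hX : ideally_ordered X.
Context (L : principal_system R).
Local Notation Q := (quiv X).
Local Notation I := (pidx L).
Implicit Types (p q r m n : qpath Q) (x y z : R) (v : vertex Q) (i j h : I).
Local Notation mono := (@mono _ _ X).
Local Notation nz := (@nz _ _ X).

Lemma Lambda_path i : exists m (g : Lambda i), nz m /\ path_module g m.
Proof.
have [p0 [e prim_e /right_idealP[u pE]]] := pgen_principal i.
have [v [x [y [nv vx yx]]]] := primitive_vtx X prim_e.
have ep : e * pgen i = pgen i by case: prim_e => _ ee _; rewrite pE mulrA ee.
have yxp : y * (x * pgen i) = pgen i by rewrite mulrA yx.
(* As [y * x] fixes the generator, [x * pgen i] generates the same left ideal and starts from a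
   vertex idempotent. *)
have [||m [nm _ mE]] := @annihilator_path _ _ X hX v (x * pgen i) nv.
- by rewrite mulrA vx.
- by apply: contra_neq p0 => xp; rewrite -yxp xp mulr0.
exists m, (x *: lgen (pgen i)); split=> //; split=> [z|w].
  have [a ->] := lgen_gen z; exists (a * y); apply: val_inj.
  by have : a * pgen i = a * y * (x * pgen i) by rewrite -mulrA yxp.
apply: iff_trans (mE w); split=> [/(congr1 val)|xm] //; exact: val_inj.
Qed.

Lemma path_module_iso (M N : lmodType R) (g : M) (g' : N) m n :
  path_module g m -> path_module g' n -> nz n -> isomorphic M N ->
  pend m = pend n /\ annle (mono m) (mono n).
Proof.
move=> gm gn nn [f fb]; have [a fa] := gn.1 (f g).
have ca := surj_top gm gn nn fa (bij_surj fb).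
by have [] := hom_top gm gn nn fa ca.
Qed.

Definition mpath i : qpath Q := sval (cid (Lambda_path i)).
Fact gvec_key i : {g : Lambda i | path_module g (mpath i)}.
Proof. by apply: cid; have [g [_ gm]] := svalP (cid (Lambda_path i)); exists g. Qed.
Definition gvec i : Lambda i := sval (gvec_key i).
Lemma gvecP i : path_module (gvec i) (mpath i).
Proof. exact: (svalP (gvec_key i)). Qed.
Lemma nz_mpath i : nz (mpath i).
Proof. by have [g []] := svalP (cid (Lambda_path i)). Qed.

Definition tvertex i : vertex Q := pend (mpath i).
Lemma nz_tvertex i : nz (lazy (tvertex i)). Proof. exact/nz_end/nz_mpath. Qed.

Lemma gvec_gen i (z : Lambda i) : exists a, z = a *: gvec i.
Proof. exact: (gvecP i).1. Qed.
Lemma gvec_ann i x : x *: gvec i = 0 <-> x * mono (mpath i) = 0.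
Proof. exact: (gvecP i).2. Qed.
Lemma gvec_vtx i : vtx (tvertex i) *: gvec i = gvec i.
Proof. exact: path_module_vtx (gvecP i). Qed.

Lemma same_annihilator i j : annle (mono (mpath i)) (mono (mpath j)) ->
  annle (mono (mpath j)) (mono (mpath i)) -> i = j.
Proof.
move=> ij ji; apply: pgen_inj.
have [||f fE] := @cyclic_map R (Lambda i) (Lambda j) (gvec i) (gvec j).
- exact: gvec_gen.
- by move=> a /gvec_ann/ij/gvec_ann.
apply: (@isomorphic_of _ _ _ f).
  by apply: lin_inj => z; have [a ->] := gvec_gen z; rewrite fE => /gvec_ann/ji/gvec_ann.
by move=> z; have [a ->] := gvec_gen z; exists (a *: gvec i); rewrite fE.
Qed.

Lemma path_class m : nz m -> exists i,
  tvertex i = pend m /\ forall x, x * mono m = 0 <-> x * mono (mpath i) = 0.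
Proof.
move=> nm; have [|i [f fb]] := @pgen_complete _ _ L (mono m).
  split=> //; exists (vtx (pend m)); first exact/vtx_primitive/nz_end.
  by apply/right_idealP; exists (mono m); rewrite vtx_mono eqxx.
have pm := path_module_mono nm; exists i.
have iso : isomorphic (left_ideal_mod (mono m)) (Lambda i) by exists f.
have [mi mle] := path_module_iso pm (gvecP i) (nz_mpath i) iso.
have [_ ile] := path_module_iso (gvecP i) pm nm (isomorphic_sym iso).
by split=> [|x]; [rewrite /tvertex mi | split=> [/mle|/ile]].
Qed.

Lemma elt_class v i (z : Lambda i) : nz (lazy v) -> vtx v *: z = z -> z != 0 ->
  exists j, tvertex j = v /\ forall x, x *: z = 0 <-> x * mono (mpath j) = 0.
Proof.
move=> nv vz z0; have [||m [nm mv mE]] := @annihilator_path _ _ X hX v (val z : R) nv.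
- exact: (congr1 val vz).
- by apply: contra_neq z0 => z0; apply: val_inj.
have [j [jm jE]] := path_class nm; exists j; split; first by rewrite jm.
move=> x; apply: iff_trans (jE x); apply: iff_trans (mE x).
split=> [xz|xz]; first exact: (congr1 val xz).
exact: val_inj.
Qed.

Lemma left_ideal_gvec i : left_ideal (val (gvec i) : R) = left_ideal (pgen i).
Proof.
apply/eqP; rewrite eqEsubv; apply/andP; split; apply/subvP => x /left_idealP[u ->].
  have /left_idealP[w wE] := valP (gvec i).
  by apply/left_idealP; exists (u * w); rewrite [val _]wE mulrA.
have [a aE] := gvec_gen (u *: lgen (pgen i)).
by apply/left_idealP; exists a; exact: (congr1 val aE).
Qed.

Definition ldim i := \dim (left_ideal (pgen i)).

Lemma gvec_annle i : annle (val (gvec i) : R) (mono (mpath i)).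
Proof. by move=> x xg; apply/gvec_ann/val_inj. Qed.
Lemma annle_gvec i : annle (mono (mpath i)) (val (gvec i) : R).
Proof. by move=> x /gvec_ann/(congr1 val). Qed.

Lemma ldimE i : ldim i = \dim (left_ideal (mono (mpath i))).
Proof.
rewrite /ldim -left_ideal_gvec; apply/eqP; rewrite eqn_leq.
by rewrite !annle_dim //; [exact: gvec_annle | exact: annle_gvec].
Qed.

Lemma ell_ldim i j : (ideal_layer i < ideal_layer j)%N = (ldim j < ldim i)%N.
Proof.
by rewrite /ideal_layer ltn_sub2lE //; exact/dimvS/subvf.
Qed.

Lemma ldim_lt i j : annle (mono (mpath i)) (mono (mpath j)) ->
  ~ annle (mono (mpath j)) (mono (mpath i)) -> (ldim j < ldim i)%N.
Proof.
move=> ij nji; rewrite !ldimE ltnNge; apply/negP => le; apply: nji.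
exact: annle_dim_eq.
Qed.

(* The coordinate of [z] along [gvec i] modulo the radical of [Lambda i]. *)
Definition top_coef i (z : Lambda i) : k := chiv (tvertex i) (sval (cid (gvec_gen z))).
Lemma top_coefE i a : top_coef (a *: gvec i) = chiv (tvertex i) a.
Proof.
rewrite /top_coef; case: cid => b /= ab; apply/esym.
exact: (path_module_chi (gvecP i) (nz_mpath i) ab).
Qed.

Lemma chiv_lin v c x y : nz (lazy v) -> chiv v (c *: x + y) = c * chiv v x + chiv v y.
Proof. by move=> nv; rewrite /chiv pcoef_lin. Qed.

Lemma top_coefD i (x y : Lambda i) : top_coef (x + y) = top_coef x + top_coef y.
Proof.
have [a ->] := gvec_gen x; have [b ->] := gvec_gen y.
by rewrite -scalerDl !top_coefE /chiv (pcoefD _ _ (nz_tvertex i)).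
Qed.

Lemma top_coefZ i (a : R) (x : Lambda i) : top_coef (a *: x) = chiv (tvertex i) a * top_coef x.
Proof.
have [b ->] := gvec_gen x.
by rewrite scalerA !top_coefE (chivM _ _ (nz_tvertex i)).
Qed.

Lemma top_coef0 i : top_coef (0 : Lambda i) = 0.
Proof. by rewrite -(scale0r (gvec i)) top_coefE /chiv (pcoef0 (nz_tvertex i)). Qed.

Lemma chiv1 v : nz (lazy v) -> chiv v 1 = 1.
Proof.
move=> nv; rewrite -(vtx_sum X) /chiv (pcoef_sum _ _ nv) (bigD1 v) //=.
rewrite -/(chiv _ _) (chiv_vtx _ nv) eqxx big1 ?addr0 // => u uv.
by rewrite -/(chiv _ _) (chiv_vtx _ nv) (negPf uv).
Qed.

Lemma top_alg i c (x : Lambda i) : top_coef (c%:A *: x) = c * top_coef x.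
Proof.
rewrite top_coefZ -[c%:A]addr0 (chiv_lin _ _ _ (nz_tvertex i)) (chiv1 (nz_tvertex i)).
by rewrite /chiv (pcoef0 (nz_tvertex i)) addr0 mulr1.
Qed.

Lemma top_hom i j (f : {linear Lambda i -> Lambda j}) : top_coef (f (gvec i)) != 0 ->
  [/\ tvertex i = tvertex j, annle (mono (mpath i)) (mono (mpath j)) & surj_map f].
Proof.
have [a fa] := gvec_gen (f (gvec i)); rewrite fa top_coefE => ca.
exact: (hom_top (gvecP i) (gvecP j) (nz_mpath j) fa ca).
Qed.

Lemma surj_top_neq0 i j (f : {linear Lambda i -> Lambda j}) :
  surj_map f -> top_coef (f (gvec i)) != 0.
Proof.
have [a fa] := gvec_gen (f (gvec i)); rewrite fa top_coefE => sf.
exact: (surj_top (gvecP i) (gvecP j) (nz_mpath j) fa sf).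
Qed.

(** Nonzero top coefficients in both directions would give equal annihilators, hence [i = j]. This
    makes the characters of the endomorphism algebra multiplicative. *)
Lemma top_comp0 i j (f : {linear Lambda i -> Lambda j}) (h : {linear Lambda j -> Lambda i}) :
  i != j -> top_coef (h (f (gvec i))) = 0.
Proof.
move=> /eqP ij; apply/eqP; apply: contrapT => /negP tn; apply: ij.
have [b fb] := gvec_gen (f (gvec i)); move: tn; rewrite fb linearZ top_coefZ mulf_eq0 negb_or.
case/andP => cb /top_hom[ji mji _].
suff /top_hom[_ mij _] : top_coef (f (gvec i)) != 0 by exact: same_annihilator.
by rewrite fb top_coefE ji.
Qed.

Lemma hom_nilpotent i (f : {linear Lambda i -> Lambda i}) : top_coef (f (gvec i)) = 0 ->
  exists a d, f (gvec i) = a *: gvec i /\ a ^+ d = 0.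
Proof.
have [b fb] := gvec_gen (f (gvec i)); rewrite fb top_coefE => cb.
pose a := vtx (tvertex i) * b * vtx (tvertex i).
have [||d ad] := @corner_nilpotent _ _ X (tvertex i) a (nz_tvertex i).
- by rewrite /a !mulrA vtx_idem -mulrA vtx_idem.
- by rewrite /a !(chivM _ _ (nz_tvertex i)) cb mulr0 mul0r.
exists a, d; split=> //.
by rewrite /a -!scalerA gvec_vtx -fb -linearZ /= gvec_vtx.
Qed.

Lemma hom_of i (M : lmodType R) (z : M) : (forall x, x * mono (mpath i) = 0 -> x *: z = 0) ->
  {f : {linear Lambda i -> M} | forall a, f (a *: gvec i) = a *: z}.
Proof.
move=> iz; apply: cid; apply: cyclic_map; first exact: gvec_gen.
by move=> a /gvec_ann/iz.
Qed.

(** The image of [gvec i] generates an ideal of dimension [ldim i] inside [Lambda j]; equality of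
    dimensions makes [f] an isomorphism. *)
Lemma injective_layer i j (f : {linear Lambda i -> Lambda j}) : injective f ->
  layer_le L j i /\ (j = i -> surj_map f).
Proof.
move=> fi; pose z : R := val (f (gvec i)).
have zE : annle z (mono (mpath i)).
  move=> x xz; apply/gvec_ann/fi; rewrite linear0 linearZ; exact: val_inj.
have Ez : annle (mono (mpath i)) z.
  move=> x /gvec_ann xg; have := congr1 f xg.
  by rewrite linear0 linearZ => /(congr1 val).
have zdim : \dim (left_ideal z) = ldim i.
  by rewrite ldimE; apply/eqP; rewrite eqn_leq !annle_dim.
have sub : (left_ideal z <= left_ideal (pgen j))%VS.
  have /left_idealP[w wE] := valP (f (gvec i)).
  apply/subvP => _ /left_idealP[u ->]; apply/left_idealP.
  by exists (u * w); rewrite /z [val _]wE mulrA.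
have full : ldim i = ldim j -> surj_map f.
  move=> ij y; have : val y \in left_ideal (pgen j) by exact: (valP y).
  have /eqP <- : left_ideal z == left_ideal (pgen j) by rewrite eqEdim sub zdim ij leqnn.
  case/left_idealP => u uE; exists (u *: gvec i); rewrite linearZ.
  by apply: val_inj; rewrite uE.
split; last by move=> ji; apply: full; rewrite ji.
rewrite /layer_le ell_ldim; have := dimvS sub; rewrite zdim -/(ldim j).
rewrite leq_eqVlt => /predU1P[ij|->]; last by rewrite orbT.
have iso : isomorphic (Lambda i) (Lambda j) by exact: isomorphic_of fi (full ij).
by rewrite (pgen_inj iso) eqxx.
Qed.

Lemma surjective_layer i j (f : {linear Lambda i -> Lambda j}) : surj_map f ->
  layer_le L i j.
Proof.
move=> /surj_top_neq0/top_hom[_ mij _]; rewrite /layer_le ell_ldim.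
have [mji|nji] := pselect (annle (mono (mpath j)) (mono (mpath i))).
  by rewrite (same_annihilator mij mji) eqxx.
by rewrite (ldim_lt mij nji) orbT.
Qed.

End PrincipalSystem.

(** * The endomorphism algebra *)

Section EndPI.
Context (k : fieldType) (R : falgType k) (X : monomial_presentation R).
Hypothesis hX : ideally_ordered X.
Context (L : principal_system R).
Local Notation Q := (quiv X).
Local Notation I := (pidx L).
Local Notation E := (E_PI L).
Local Notation Lam := (@Lambda k R L).
Implicit Types (v : vertex Q) (i j h : I).
Local Notation mono := (@mono _ _ X).
Local Notation nz := (@nz _ _ X).
Local Notation mpath i := (mpath hX i).
Local Notation gvec i := (gvec hX i).
Local Notation top_coef z := (top_coef hX z).

Definition ap (a : E) (y : PI L) : PI L := (a : lhom (PI L) (PI L)) y.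

Arguments ap : simpl never.

Lemma ap_ext (a b : E) : (forall y, ap a y = ap b y) -> a = b.
Proof. exact: homP. Qed.
Lemma apM (a b : E) y : ap (a * b) y = ap a (ap b y). Proof. by []. Qed.
Lemma ap1 y : ap 1 y = y. Proof. by []. Qed.
Lemma ap_0 y : ap 0 y = 0. Proof. by []. Qed.
Lemma ap_D (a b : E) y : ap (a + b) y = ap a y + ap b y. Proof. by []. Qed.
Lemma ap_Z (c : k) (a : E) y : ap (c *: a) y = c%:A *: ap a y. Proof. by []. Qed.
Lemma ap_sum (T : finType) (a : T -> E) y :
  ap (\sum_t a t) y = \sum_t ap (a t) y.
Proof. exact: (big_morph (ap^~ y) (fun a b => ap_D a b y) (ap_0 y)). Qed.
Lemma apZ (a : E) (x : R) y : ap a (x *: y) = x *: ap a y. Proof. exact: linearZ. Qed.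
Lemma apS (a : E) (T : finType) (F : T -> PI L) :
  ap a (\sum_t F t) = \sum_t ap a (F t).
Proof. exact: linear_sum. Qed.

Definition PI_inj i : {linear Lam i -> PI L} := dinj Lam i.
Definition PI_proj i : {linear PI L -> Lam i} := dpr Lam i.
Lemma PI_projE i (y : PI L) : PI_proj i y = y i. Proof. exact: dprE. Qed.
Lemma PI_proj_inj i (z : Lam i) : PI_proj i (PI_inj i z) = z.
Proof. by rewrite PI_projE; exact: dinjE. Qed.
Lemma PI_proj_inj0 i j (z : Lam i) : i != j -> PI_proj j (PI_inj i z) = 0.
Proof. by rewrite PI_projE; exact: dinj0. Qed.
Lemma PI_decomp (y : PI L) : y = \sum_i PI_inj i (PI_proj i y).
Proof.
by rewrite {1}(dsum_decomp (y : dsum Lam)); apply: eq_bigr => i _; rewrite PI_projE.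
Qed.

Definition elem_endo i j (f : {linear Lam i -> Lam j}) : E :=
  (PI_inj j \o f \o PI_proj i : {linear PI L -> PI L}).
Lemma ap_elem_endo i j (f : {linear Lam i -> Lam j}) y :
  ap (elem_endo f) y = PI_inj j (f (PI_proj i y)).
Proof. by []. Qed.

Definition eE i : E := elem_endo (idfun : {linear Lam i -> Lam i}).
Lemma ap_eE i y : ap (eE i) y = PI_inj i (PI_proj i y). Proof. by []. Qed.

Definition entry j i (a : E) : {linear Lam i -> Lam j} :=
  (PI_proj j \o (a : lhom (PI L) (PI L)) \o PI_inj i : {linear Lam i -> Lam j}).
Lemma entryE j i a z : entry j i a z = PI_proj j (ap a (PI_inj i z)). Proof. by []. Qed.

Lemma corner_elem_endo i h (x : E) : x = eE h * x * eE i -> x = elem_endo (entry h i x).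
Proof.
by move=> xE; apply: ap_ext => y; rewrite {1}xE !apM !ap_eE ap_elem_endo entryE.
Qed.

Lemma eEM i j : eE i * eE j = if i == j then eE i else 0.
Proof.
apply: ap_ext => y; rewrite apM !ap_eE.
have [<-|ij] := eqVneq i j; first by rewrite PI_proj_inj ap_eE.
by rewrite PI_proj_inj0 1?eq_sym // linear0 ap_0.
Qed.

Lemma eE_sum : \sum_i eE i = 1.
Proof. by apply: ap_ext => y; rewrite ap_sum ap1 [RHS]PI_decomp. Qed.

(** An endomorphism is determined by the components of the images of the generators [gvec i], a
    finite matrix over [R]. *)
Lemma fin_gen_E : @fin_gen k E.
Proof.
pose V := {ffun I * I -> R}.
pose F (a : E) : V := [ffun ij => val (PI_proj ij.2 (ap a (PI_inj ij.1 (gvec ij.1))))].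
have lF : linear F.
  move=> c a b; apply/ffunP => ij; rewrite !ffunE ap_D ap_Z linearP.
  exact: (congr1 (+%R^~ _) (mulr_algl c _)).
have [f fE] := linear_of lF; apply: fdim_fin_gen.
apply: (fdim_inj (g := f)) (fdim_vect V); apply: lin_inj => a; rewrite fE => /ffunP a0.
apply: ap_ext => y; rewrite (PI_decomp y) apS ap_0 big1 // => i _.
have [b ->] := gvec_gen hX (PI_proj i y); rewrite linearZ apZ.
suff -> : ap a (PI_inj i (gvec i)) = 0 by rewrite scaler0.
rewrite (PI_decomp (ap _ _)) big1 // => j _.
have -> : PI_proj j (ap a (PI_inj i (gvec i))) = 0; last by rewrite linear0.
by apply: val_inj; have := a0 (i, j); rewrite !ffunE.
Qed.

Definition chi_fun i (a : E) : k^o := top_coef (PI_proj i (ap a (PI_inj i (gvec i)))).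
Lemma chi_linear i : linear (chi_fun i).
Proof.
by move=> c a b; rewrite /chi_fun ap_D ap_Z linearP top_coefD top_alg.
Qed.
Definition chiE i : {linear E -> k^o} := sval (linear_of (chi_linear i)).
Lemma chiEE i a : chiE i a = top_coef (PI_proj i (ap a (PI_inj i (gvec i)))).
Proof. by rewrite /chiE; case: linear_of. Qed.

(** In the matrix product the terms passing through another summand vanish by [top_comp0]. *)
Lemma chiEM i a b : chiE i (a * b) = chiE i a * chiE i b.
Proof.
rewrite !chiEE apM {1}(PI_decomp (ap b _)) apS linear_sum.
have tS : {morph (fun z : Lam i => top_coef z) : x y / x + y} by move=> x y; exact: top_coefD.
rewrite (big_morph _ tS (top_coef0 hX i)) (bigD1 i) //= big1 ?addr0 => [|j ji].
  have [c cE] := gvec_gen hX (PI_proj i (ap b (PI_inj i (gvec i)))); rewrite cE.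
  rewrite linearZ apZ linearZ top_coefZ top_coefE; exact: mulrC.
rewrite eq_sym in ji; exact: (top_comp0 hX (entry j i b) (entry i j a) ji).
Qed.

Lemma chiE_e i j : chiE i (eE j) = (i == j)%:R.
Proof.
rewrite chiEE ap_eE; have [->|ij] := eqVneq i j.
  by rewrite !PI_proj_inj -[gvec j]scale1r top_coefE chiv1 // nz_tvertex.
by rewrite (PI_proj_inj0 _ ij) !linear0 top_coef0.
Qed.

Lemma chiE_nil i (x : E) : x = eE i * x * eE i -> chiE i x = 0 -> exists d, x ^+ d = 0.
Proof.
move=> /corner_elem_endo xE; rewrite chiEE => t0.
have [a [d [fa ad]]] := hom_nilpotent (f := entry i i x) t0.
have xd l : ap (x ^+ l) (PI_inj i (gvec i)) = a ^+ l *: PI_inj i (gvec i).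
  elim: l => [|l IHl]; first by rewrite !expr0 scale1r.
  rewrite exprSr apM xE ap_elem_endo PI_proj_inj -xE fa linearZ /= apZ IHl scalerA -exprS.
  by rewrite -linearZ.
(* The extra factor first moves [y] into the summand [Lambda i], where [x ^+ d] vanishes. *)
exists d.+1; apply: ap_ext => y; rewrite exprSr apM {2}xE ap_elem_endo.
have [b ->] := gvec_gen hX (entry i i x (PI_proj i y)).
by rewrite linearZ apZ xd ad scale0r scaler0.
Qed.

Definition pE i : P_mod L i := PI_inj i.
Lemma pE_gen i (y : P_mod L i) : exists a : E, y = a *: pE i.
Proof.
pose f : {linear Lam i -> PI L} := y.
exists ((f \o PI_proj i : {linear PI L -> PI L}) : E).
by apply: homP => z; rewrite /= -[RHS]/(f (PI_proj i (PI_inj i z))) PI_proj_inj.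
Qed.
Lemma pE_ann i (a : E) : a *: pE i = 0 <-> a * eE i = 0.
Proof.
split=> [ap|ae].
  apply: ap_ext => y; rewrite apM ap_eE.
  exact: (congr1 (fun f : lhom (Lam i) (PI L) => f (PI_proj i y)) ap).
apply: homP => z; have := congr1 (ap^~ (PI_inj i z)) ae.
by rewrite apM ap_eE PI_proj_inj.
Qed.

Lemma injective_entry i h (f : {linear Lam i -> Lam h}) : injective f ->
  layer_le L h i /\ (h = i -> chiE i (elem_endo f) != 0).
Proof.
move=> fi; have [le sf] := injective_layer hX fi; split=> // hi.
move: (sf hi) => {le sf fi}; case: i / hi f => f /(surj_top_neq0 hX).
by rewrite chiEE ap_elem_endo !PI_proj_inj.
Qed.

(* [jt.1] indexes the largest proper quotient of [Lambda i] that is again a principal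
   left ideal; every non-injective map out of [Lambda i] factors through it. *)
Lemma next_quotient i : exists jt : I * E,
  [/\ eE jt.1 * jt.2 * eE i = jt.2,
      jt.2 = 0 \/ (ideal_layer i < ideal_layer jt.1)%N /\
        (forall a, a * jt.2 = 0 -> a * eE jt.1 = 0) &
      forall h x, x = eE h * x * eE i ->
        (exists b, x = b * jt.2) \/ layer_le L h i /\ (h = i -> chiE i x != 0)].
Proof.
pose ann i j := annle (mono (mpath i)) (mono (mpath j)).
pose cand j := [/\ tvertex hX j = tvertex hX i, ann i j & ~ ann j i].
(* The image of [gvec i] has the annihilator of some [mpath j]. If it equals that of [mpath i] the
   map is injective; otherwise [j] is a candidate. *)
have split_x h x : x = eE h * x * eE i ->
    x = 0 \/ (exists2 j, cand j & forall y, y * mono (mpath j) = 0 ->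
                y *: entry h i x (gvec i) = 0) \/
    layer_le L h i /\ (h = i -> chiE i x != 0).
  move=> /corner_elem_endo; move: (entry h i x) => f xE.
  have [f0|f0] := eqVneq (f (gvec i)) 0.
    left; rewrite xE; apply: ap_ext => y; rewrite ap_elem_endo ap_0.
    have [a ->] := gvec_gen hX (PI_proj i y).
    by rewrite linearZ /= f0 scaler0 linear0.
  right; have vf : vtx (tvertex hX i) *: f (gvec i) = f (gvec i).
    by rewrite -linearZ /= gvec_vtx.
  have [j [ji jE]] := elt_class hX (nz_tvertex hX i) vf f0.
  have ij : ann i j.
    by move=> y /(gvec_ann hX) yg; apply/jE; rewrite -linearZ /= yg linear0.
  have [aji|nji] := pselect (ann j i); [right | left].
    rewrite xE; apply: injective_entry; apply: lin_inj => z.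
    have [a ->] := gvec_gen hX z; rewrite linearZ => /jE/aji aji0.
    exact/(gvec_ann hX).
  by exists j => // y /jE.
pose s := [seq j <- enum I | `[< cand j >]].
have sP j : reflect (cand j) (j \in s).
  by rewrite mem_filter mem_enum andbT; exact: asboolP.
have [s0|s0] := eqVneq s [::].
  (* Without candidates every nonzero map out of [Lambda i] into a summand is injective; the index
     [i] is a placeholder. *)
  exists (i, 0); split=> [||h x xE] /=; [by rewrite mulr0 mul0r | by left |].
  have [->|[[j /sP]|]] := split_x h x xE; last by right.
  - by left; exists 0; rewrite mul0r.
  - by rewrite s0.
(* All candidates share the vertex of [i], hence are comparable; the smallest annihilator gives the
   largest quotient. *)
have [||j js jmin] := @total_minimum _ ann s _ _ s0.
- move=> a b /sP[ai _ _] /sP[bi _ _].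
  apply: (annle_total hX) (nz_mpath hX a) (nz_mpath hX b) _.
  exact: etrans ai (esym bi).
- by move=> a b c _ _ _; exact: annle_trans.
have [ji aij naji] := elimT (sP j) js.
have [u uE] := @hom_of _ _ _ hX L i (Lam j) (gvec j) (fun y yi => (gvec_ann hX j y).2 (aij y yi)).
have ug : u (gvec i) = gvec j by rewrite -[gvec i]scale1r uE scale1r.
have elem_ann a : a * elem_endo u = 0 -> a * eE j = 0.
  move=> au; apply: ap_ext => y; rewrite apM ap_eE ap_0.
  have [b ->] := gvec_gen hX (PI_proj j y); rewrite linearZ apZ.
  have := congr1 (ap^~ (PI_inj i (gvec i))) au.
  by rewrite apM ap_elem_endo PI_proj_inj ug ap_0 => ->; rewrite scaler0.
exists (j, elem_endo u); split=> /= [||h x xE].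
- by apply: ap_ext => y; rewrite !apM !ap_eE !ap_elem_endo !PI_proj_inj.
- by right; split=> //; rewrite ell_ldim (ldim_lt aij naji).
have [->|[[j' cj' j'E]|]] := split_x h x xE; last by right.
  by left; exists 0; rewrite mul0r.
left; have jj' : ann j j' by apply: jmin; exact/sP.
have [w wE] := @hom_of _ _ _ hX L j (Lam h) (entry h i x (gvec i)) (fun y yj => j'E y (jj' y yj)).
exists (elem_endo w); rewrite {1}(corner_elem_endo xE); apply: ap_ext => y.
rewrite apM !ap_elem_endo PI_proj_inj; congr (PI_inj h _).
have [a ->] := gvec_gen hX (PI_proj i y).
by rewrite linearZ uE wE.
Qed.

(* The radical of [Lambda i] is the direct sum of the submodules generated by
   [a *: gvec i], [a] an arrow; each is isomorphic to some [Lambda (c a)]. *)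
Lemma radical_summands i : exists (J : finType) (cw : J -> I * E),
  [/\ forall a, (ideal_layer i < ideal_layer (cw a).1)%N,
      forall a, eE i * (cw a).2 * eE (cw a).1 = (cw a).2,
      forall x : J -> E, \sum_a (cw a).2 * x a = 0 -> forall a, eE (cw a).1 * x a = 0 &
      forall h x, x = eE i * x * eE h ->
        (exists y : J -> E, x = \sum_a (cw a).2 * y a) \/ layer_le L h i].
Proof.
pose m := mpath i; pose J := out_arrow (X := X) m.
pose v (a : J) : Lam i := mono (arrow_path (val a)) *: gvec i.
have vE (x : R) (a : J) : x *: v a = 0 <-> x * amono m (val a) = 0.
  by rewrite scalerA gvec_ann -mulrA.
have cP (a : J) : exists c : I, forall x, x * amono m (val a) = 0 <-> x * mono (mpath c) = 0.
  have [r [nr -> _ _ _]] := out_arrow_path a.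
  by have [c [_ cE]] := path_class hX L nr; exists c.
pose c a := sval (cid (cP a)).
have cE a x : x * amono m (val a) = 0 <-> x * mono (mpath (c a)) = 0.
  by rewrite /c; case: cid.
have sP a : {s : {linear Lam (c a) -> Lam i} | forall b, s (b *: gvec (c a)) = b *: v a}.
  by apply: hom_of => x /cE/vE.
pose s a := sval (sP a).
have sE a b : s a (b *: gvec (c a)) = b *: v a by exact: (svalP (sP a)).
have s_inj a : injective (s a).
  apply: lin_inj => z; have [b ->] := gvec_gen hX z.
  by rewrite sE => /vE/cE/(gvec_ann hX).
have direct (z : forall a, Lam (c a)) : \sum_a s a (z a) = 0 -> forall a, z a = 0.
  pose b a := sval (cid (gvec_gen hX (z a))).
  have zE a : z a = b a *: gvec (c a) by rewrite /b; case: cid.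
  move=> sz a; rewrite zE; apply/gvec_ann/cE; move: a; apply: amono_direct.
  have : (\sum_a b a * mono (arrow_path (val a))) *: gvec i = 0.
    rewrite -sz scaler_suml; apply: eq_bigr => a _.
    by rewrite zE sE scalerA.
  move=> /gvec_ann; rewrite mulr_suml => sb.
  by rewrite -[RHS]sb; apply: eq_bigr => a _; rewrite mulrA.
exists J, (fun a => (c a, elem_endo (s a))); split=> /= [a|a|x x0 a|h x xE].
(* Equality [c a = i] would make [s a] onto, but it sends the generator to an arrow times [gvec i],
   whose top coefficient is 0. *)
- have [le surj] := injective_layer hX (s_inj a).
  move: le; rewrite /layer_le; case: eqP => // ic _.
  have := surj_top_neq0 hX (surj ic); rewrite -[gvec (c a)]scale1r sE scale1r top_coefZ.
  rewrite /chiv pcoef_mono ?nz_tvertex //.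
  have -> : (arrow_path (val a) == lazy (tvertex hX i)) = false.
    by apply/eqP => /(congr1 (@plen _)).
  by rewrite mul0r eqxx.
- by apply: ap_ext => y; rewrite !apM !ap_eE !ap_elem_endo !PI_proj_inj.
- apply: ap_ext => y; rewrite apM ap_eE ap_0.
  rewrite (direct (fun a => PI_proj (c a) (ap (x a) y))) ?linear0 //.
  have := congr1 (fun u : E => PI_proj i (ap u y)) x0.
  rewrite ap_sum ap_0 linear0 linear_sum => x0'; rewrite -[RHS]x0'.
  by apply: eq_bigr => b _; rewrite apM ap_elem_endo PI_proj_inj.
(* A nonzero top coefficient makes the entry surjective, which bounds the layer of [h]; otherwise
   its image lies in the radical. *)
have [t0|t0] := eqVneq (top_coef (entry i h x (gvec h))) 0; last first.
  by right; have [_ _ /(surjective_layer hX)] := top_hom t0.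
left; have xE' := corner_elem_endo xE; move: (entry i h x) t0 xE' => f t0 xE'.
have [b fb] := gvec_gen hX (f (gvec h)).
have [|y yE] := @radical_decomp _ _ X m b; first by rewrite -t0 fb top_coefE.
have fg : f (gvec h) = \sum_a y a *: v a.
  rewrite fb; apply/eqP; rewrite -subr_eq0.
  have -> : \sum_a y a *: v a = (\sum_a y a * mono (arrow_path (val a))) *: gvec i.
    by rewrite scaler_suml; apply: eq_bigr => a _; rewrite scalerA.
  rewrite -scalerBl; apply/eqP/gvec_ann; rewrite mulrBl yE mulr_suml.
  apply/eqP; rewrite subr_eq0; apply/eqP/eq_bigr => a _; exact: mulrA.
(* Well defined by directness: a relation on [gvec h] maps to a vanishing sum over the arrows, so
   each component vanishes. *)
have uP a : {u : {linear Lam h -> Lam (c a)} |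
    forall d, u (d *: gvec h) = d *: (y a *: gvec (c a))}.
  apply: hom_of => x' /(gvec_ann hX) xg; move: a.
  apply: (direct (fun a => x' *: (y a *: gvec (c a)))).
  have := congr1 f xg; rewrite linear0 linearZ /= fg scaler_sumr; apply: etrans.
  by apply: eq_bigr => a _; rewrite scalerA sE -scalerA.
pose u a := sval (uP a).
have uE a d : u a (d *: gvec h) = d *: (y a *: gvec (c a)) by exact: (svalP (uP a)).
exists (fun a => elem_endo (u a)); rewrite xE'; apply: ap_ext => w.
rewrite ap_sum ap_elem_endo; have [d dE] := gvec_gen hX (PI_proj h w).
have -> : f (PI_proj h w) = \sum_a d *: (y a *: v a).
  by rewrite dE linearZ /= fg scaler_sumr.
rewrite linear_sum; apply: eq_bigr => a _.
by rewrite apM !ap_elem_endo PI_proj_inj dE uE [in RHS]scalerA sE -scalerA.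
Qed.

Lemma strongly_quasi_hereditary_EPI :
  left_strongly_quasi_hereditary (layer_le L) (S_mod L) (P_mod L) /\
  right_strongly_quasi_hereditary (layer_le L) (S_mod L) (P_mod L).
Proof.
have [jt /all_and3[jtE jt_inj jt_gen]] := choice next_quotient.
pose J i := sval (cid (radical_summands i)).
have JP i := svalP (cid (radical_summands i)).
pose cw i : J i -> I * E := sval (cid (JP i)).
have cwP i := svalP (cid (JP i)).
apply: (strongly_quasi_hereditary_layer fin_gen_E eEM eE_sum chiEM chiE_e chiE_nil
  pE_gen pE_ann (ell := @ideal_layer k R L)
  (nx := fun i => (jt i).1) (t := fun i => (jt i).2) jtE jt_inj jt_gen
  (J := J) (c := fun i a => (cw i a).1) (w := fun i a => (cw i a).2)).
- by move=> i; case: (cwP i).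
- by move=> i; case: (cwP i).
- by move=> i; case: (cwP i).
- by move=> i; case: (cwP i).
Qed.

End EndPI.

Theorem theorem2p14 (k : closedFieldType) (R : falgType k)
    (X : monomial_presentation R) (hX : ideally_ordered X)
    (L : principal_system R) :
  left_strongly_quasi_hereditary (layer_le L) (S_mod L) (P_mod L) /\
  right_strongly_quasi_hereditary (layer_le L) (S_mod L) (P_mod L).
Proof. exact: strongly_quasi_hereditary_EPI hX L. Qed.
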